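(* Let $D\subset\mathbb R^2$ be a bounded domain with analytic boundary $\Gamma$, let $\nu$ be the unit normal on $\Gamma$ exterior to $D$, let $\kappa>0$, let $d=(\cos\theta,\sin\theta)^\top$ with $\theta\in[0,2\pi)$, and let $u^{\rm inc}(x)=e^{\mathrm i\kappa x\cdot d}$. Put $f_1=-u^{\rm inc}$ and $f_2=-\partial_\nu u^{\rm inc}$ on $\Gamma$. Then there is at most one pair of functions $(v_{\rm H},v_{\rm M})$ on $\mathbb R^2\setminus\overline D$ solving the coupled boundary value problem $$\Delta v_{\rm H}+\kappa^2v_{\rm H}=0,\qquad \Delta v_{\rm M}-\kappa^2v_{\rm M}=0\qquad\text{in }\mathbb R^2\setminus\overline D,$$ $$v_{\rm H}+v_{\rm M}=f_1,\qquad \partial_\nu v_{\rm H}+\partial_\nu v_{\rm M}=f_2\qquad\text{on }\Gamma,$$ $$\lim_{r\to\infty}r^{1/2}(\partial_rv_{\rm H}-\mathrm i\kappa v_{\rm H})=0,\qquad \lim_{r\to\infty}r^{1/2}(\partial_rv_{\rm M}-\mathrm i\kappa v_{\rm M})=0,\qquad r=|x|.$$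
   Context: $\Gamma$ is a simple closed analytic curve, so $\mathbb R^2\setminus\overline D$ is connected. Solutions are complex valued and understood classically: twice continuously differentiable in $\mathbb R^2\setminus\overline D$, with the functions and their first derivatives extending continuously up to $\Gamma$. The limits in the radiation conditions hold uniformly in all directions $x/|x|$. *)

(* Defs.v *)
From Stdlib Require Import Reals.
From Coquelicot Require Import Coquelicot.
Open Scope R_scope.

Notation R2 := (R * R)%type.

Definition dot (x y : R2) : R := fst x * fst y + snd x * snd y.
Definition norm2 (x : R2) : R := sqrt (dot x x).

Definition closure (A : R2 -> Prop) (x : R2) : Prop :=
  forall P : R2 -> Prop, locally x P -> exists y, A y /\ P y.
Definition boundary (A : R2 -> Prop) (x : R2) : Prop :=
  closure A x /\ closure (fun y => ~ A y) x.
Definition exterior (A : R2 -> Prop) (x : R2) : Prop := ~ closure A x.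

Definition connected (A : R2 -> Prop) : Prop :=
  forall U V : R2 -> Prop,
    open U -> open V ->
    (forall x, A x -> U x \/ V x) ->
    (forall x, A x -> ~ (U x /\ V x)) ->
    (exists x, A x /\ U x) ->
    forall x, A x -> ~ V x.

Definition bounded_domain (D : R2 -> Prop) : Prop :=
  (exists x, D x) /\ open D /\ connected D /\
  (exists M : R, forall x, D x -> norm2 x <= M).

Definition real_analytic (f : R -> R) : Prop :=
  forall t0 : R, exists a : nat -> R,
    locally t0 (fun t : R => is_pseries a (t - t0) (f t)).

Definition tangent (gamma : R -> R2) (t : R) : R2 :=
  (Derive (fun s => fst (gamma s)) t, Derive (fun s => snd (gamma s)) t).

(* [T] is the period of the parametrization; analytic curves are understood to
   be regular, i.e. to have a nowhere vanishing tangent. *)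
Definition simple_closed_analytic_curve (gamma : R -> R2) (T : R) : Prop :=
  0 < T /\
  real_analytic (fun t => fst (gamma t)) /\
  real_analytic (fun t => snd (gamma t)) /\
  (forall t, tangent gamma t <> (0, 0)) /\
  (forall t, gamma (t + T) = gamma t) /\
  (forall s t, 0 <= s < T -> 0 <= t < T -> gamma s = gamma t -> s = t).

Definition parametrizes_boundary (gamma : R -> R2) (D : R2 -> Prop) : Prop :=
  forall x, boundary D x <-> exists t, gamma t = x.

Definition exterior_unit_normal
    (D : R2 -> Prop) (gamma : R -> R2) (nu : R2 -> R2) : Prop :=
  (forall t, dot (nu (gamma t)) (tangent gamma t) = 0) /\
  forall x, boundary D x ->
    norm2 (nu x) = 1 /\
    exists delta : R, 0 < delta /\
      forall s, 0 < s < delta ->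
        exterior D (fst x + s * fst (nu x), snd x + s * snd (nu x)) /\
        D (fst x - s * fst (nu x), snd x - s * snd (nu x)).

(* Derivative of a complex-valued function of one real variable. *)
Definition ex_RC_derive (h : R -> C) (t : R) : Prop :=
  ex_derive (fun s => Re (h s)) t /\ ex_derive (fun s => Im (h s)) t.
Definition RC_derive (h : R -> C) (t : R) : C :=
  (Derive (fun s => Re (h s)) t, Derive (fun s => Im (h s)) t).

Definition d1 (v : R2 -> C) (x : R2) : C :=
  RC_derive (fun t => v (t, snd x)) (fst x).
Definition d2 (v : R2 -> C) (x : R2) : C :=
  RC_derive (fun t => v (fst x, t)) (snd x).

Definition C1_on (E : R2 -> Prop) (v : R2 -> C) : Prop :=
  forall x, E x ->
    ex_RC_derive (fun t => v (t, snd x)) (fst x) /\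
    ex_RC_derive (fun t => v (fst x, t)) (snd x) /\
    continuous (d1 v) x /\ continuous (d2 v) x.
Definition C2_on (E : R2 -> Prop) (v : R2 -> C) : Prop :=
  C1_on E v /\ C1_on E (d1 v) /\ C1_on E (d2 v).

Definition laplacian (v : R2 -> C) (x : R2) : C :=
  (d1 (d1 v) x + d2 (d2 v) x)%C.
Definition directional_derivative (v : R2 -> C) (n x : R2) : C :=
  (RtoC (fst n) * d1 v x + RtoC (snd n) * d2 v x)%C.

(* [l] is the value at the boundary point [x] of the continuous extension of
   [g] from the exterior of [D]. *)
Definition boundary_value (D : R2 -> Prop) (g : R2 -> C) (x : R2) (l : C)
    : Prop :=
  filterlim g (within (exterior D) (locally x)) (locally l).

(* Existence of these limits at all boundary points is equivalent to the
   existence of an extension of [g] which is continuous up to the boundary. *)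
Definition extends_to_boundary (D : R2 -> Prop) (g : R2 -> C) : Prop :=
  forall x, boundary D x -> exists l, boundary_value D g x l.

Definition boundary_normal_derivative
    (D : R2 -> Prop) (nu : R2 -> R2) (v : R2 -> C) (x : R2) (l : C) : Prop :=
  exists g1 g2 : C,
    boundary_value D (d1 v) x g1 /\ boundary_value D (d2 v) x g2 /\
    l = (RtoC (fst (nu x)) * g1 + RtoC (snd (nu x)) * g2)%C.

Definition classical_regularity (D : R2 -> Prop) (v : R2 -> C) : Prop :=
  C2_on (exterior D) v /\
  extends_to_boundary D v /\
  extends_to_boundary D (d1 v) /\
  extends_to_boundary D (d2 v).

Definition radial_derivative (v : R2 -> C) (x : R2) : C :=
  directional_derivative v (fst x / norm2 x, snd x / norm2 x) x.

(* Uniform in the direction: [r0] does not depend on [x / norm2 x]. *)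
Definition radiation_condition (kappa : R) (v : R2 -> C) : Prop :=
  forall eps : R, 0 < eps ->
    exists r0 : R, forall x : R2, r0 < norm2 x ->
      Cmod (RtoC (sqrt (norm2 x)) *
            (radial_derivative v x - Ci * RtoC kappa * v x))%C < eps.

(* Functions on the exterior of [D] are represented by total functions whose
   values elsewhere are irrelevant. *)
Record coupled_bvp (D : R2 -> Prop) (nu : R2 -> R2) (kappa : R)
    (f1 f2 : R2 -> C) (vH vM : R2 -> C) : Prop := {
  bvp_regular_H : classical_regularity D vH;
  bvp_regular_M : classical_regularity D vM;
  bvp_helmholtz : forall x, exterior D x ->
    (laplacian vH x + RtoC (kappa ^ 2) * vH x)%C = RtoC 0;
  bvp_modified_helmholtz : forall x, exterior D x ->
    (laplacian vM x - RtoC (kappa ^ 2) * vM x)%C = RtoC 0;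
  bvp_dirichlet : forall x, boundary D x ->
    exists a b : C, boundary_value D vH x a /\ boundary_value D vM x b /\
      (a + b)%C = f1 x;
  bvp_neumann : forall x, boundary D x ->
    exists a b : C,
      boundary_normal_derivative D nu vH x a /\
      boundary_normal_derivative D nu vM x b /\
      (a + b)%C = f2 x;
  bvp_radiation_H : radiation_condition kappa vH;
  bvp_radiation_M : radiation_condition kappa vM
}.

Definition Cexp (z : C) : C :=
  (RtoC (exp (Re z)) * (cos (Im z), sin (Im z)))%C.

Definition u_inc (kappa : R) (d : R2) (x : R2) : C :=
  Cexp (Ci * RtoC kappa * RtoC (dot x d))%C.

(* Main.v *)
From Stdlib Require Import Reals ZArith Lra Lia Psatz Classical ClassicalChoice ClassicalEpsilon.
From Coquelicot Require Import Coquelicot.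
Require Import Defs.
Open Scope R_scope.

(** Write the differences of two solutions as [uH = a + i b] and
    [uM = p + i q]. In the exterior [uH] satisfies the Helmholtz equation and
    [uM] the modified one, both radiate with the same sign, and [uH + uM]
    vanishes on the boundary together with its normal derivative. Its
    tangential derivative then vanishes too ([gradient_vanishes_on_boundary]),
    so the Cauchy data of [uH] and of [- uM] coincide.

    The radiation condition, which is not the natural one for the modified
    equation, nevertheless forces [uM] to be small. It bounds the growth of
    [uM] along rays linearly ([radiating_linear_growth]), and comparison with
    [C / r^2 + eps r^2] improves this to [O(r^-2)] ([modified_solution_bound]).

    The two solutions communicate through their fluxes. Green's second identity
    makes the fields [a grad b - b grad a] and [p grad q - q grad p]
    divergence-free, and they agree on the boundary, being quadratic in data
    that differ by a sign. Their difference, extended by zero into [D], is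
    continuous and has zero flux through every box: a box that misses the curve
    is treated by the divergence theorem, and the curve is removable for
    continuous fields vanishing on it ([box_flux_removable_curve]). So it has
    zero flux through circles ([circle_flux_zero]), and the flux of [uH]
    through a large circle is that of [uM], which tends to zero.

    Expanding [|uH' - i k uH|^2], where the prime is the radial derivative, the
    radiation condition for [uH] and the vanishing flux show that [r] times the
    integral of [|uH|^2 + |uH'|^2] over the angle tends to zero
    ([circle_density_decay]). Rellich's theorem follows by separation of
    variables: the cosine coefficients of [a] and [b], taken from every base
    angle, solve Bessel's equation, and their energy is bounded by this
    quantity but almost monotone, so they vanish far out
    ([bessel_ode_decay], [rellich]), and the coefficients determine the
    function ([cosine_moments_zero]). The same ordinary differential equation
    gives unique continuation on discs ([disc_unique_continuation]), and as the
    exterior is connected, [uH] vanishes identically.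

    Connectedness of the exterior comes from the curve ([exterior_connected]).
    Near a boundary point the exterior is swept out by translates of an arc
    along the normal, so it lies in one part of any splitting; which one is
    locally constant along the curve, and each part reaches the curve.

    Now [uM] has vanishing boundary values and decays, and the maximum
    principle gives [uM = 0]. *)

(** * Calculus in the plane *)

Lemma ex_small (a b c d : R) : 0 < a -> 0 < b -> 0 < c -> 0 < d ->
  exists s, 0 < s /\ s < a /\ s < b /\ s < c /\ s < d.
Proof.
  intros. exists (Rmin (Rmin a b) (Rmin c d) / 2). unfold Rmin.
  repeat destruct Rle_dec; lra.
Qed.

Lemma ex_large (a b c d : R) : exists s, a < s /\ b < s /\ c < s /\ d < s.
Proof.
  exists (Rmax (Rmax a b) (Rmax c d) + 1). unfold Rmax.
  repeat destruct Rle_dec; lra.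
Qed.

Lemma is_derive_plusR (f g : R -> R) (t l m : R) :
  is_derive f t l -> is_derive g t m -> is_derive (fun s => f s + g s) t (l + m).
Proof. exact (is_derive_plus (V := R_NormedModule) f g t l m). Qed.

Lemma is_derive_minusR (f g : R -> R) (t l m : R) :
  is_derive f t l -> is_derive g t m -> is_derive (fun s => f s - g s) t (l - m).
Proof. exact (is_derive_minus (V := R_NormedModule) f g t l m). Qed.

Lemma is_derive_scalR (f : R -> R) (t l c : R) :
  is_derive f t l -> is_derive (fun s => f s * c) t (l * c).
Proof. exact (is_derive_scal_l (V := R_NormedModule) f t l c). Qed.

Lemma is_derive_multR (f g : R -> R) (t l m : R) :
  is_derive f t l -> is_derive g t m -> is_derive (fun s => f s * g s) t (l * g t + f t * m).
Proof. intros Hf Hg. apply (is_derive_mult f g t l m Hf Hg). intros; apply Rmult_comm. Qed.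

Lemma continuous_plusR {U : UniformSpace} (f g : U -> R) z :
  continuous f z -> continuous g z -> continuous (fun z => f z + g z) z.
Proof. exact (@continuous_plus _ R_AbsRing R_NormedModule f g z). Qed.

Lemma continuous_minusR {U : UniformSpace} (f g : U -> R) z :
  continuous f z -> continuous g z -> continuous (fun z => f z - g z) z.
Proof. exact (@continuous_minus _ R_AbsRing R_NormedModule f g z). Qed.

Lemma continuous_oppR {U : UniformSpace} (f : U -> R) z :
  continuous f z -> continuous (fun z => - f z) z.
Proof. exact (@continuous_opp _ R_AbsRing R_NormedModule f z). Qed.

Lemma continuous_multR {U : UniformSpace} (f g : U -> R) z :
  continuous f z -> continuous g z -> continuous (fun z => f z * g z) z.
Proof. exact (@continuous_mult _ R_AbsRing f g z). Qed.

Lemma continuous_of_derive (f : R -> R) (t l : R) : is_derive f t l -> continuous f t.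
Proof. intros H. apply (ex_derive_continuous f). exists l. exact H. Qed.

Lemma continuous_powR {U : UniformSpace} (f : U -> R) (n : nat) z :
  continuous f z -> continuous (fun z => f z ^ n) z.
Proof.
  intros H. apply (continuous_comp f (fun x => x ^ n)); [exact H|].
  apply (ex_derive_continuous (fun x => x ^ n)). auto_derive. exact I.
Qed.

Lemma continuous_cosR {U : UniformSpace} (f : U -> R) z :
  continuous f z -> continuous (fun z => cos (f z)) z.
Proof.
  intros H. apply (continuous_comp f cos); [exact H|].
  apply continuity_pt_filterlim, continuity_cos.
Qed.

Lemma continuous_sinR {U : UniformSpace} (f : U -> R) z :
  continuous f z -> continuous (fun z => sin (f z)) z.
Proof.
  intros H. apply (continuous_comp f sin); [exact H|].
  apply continuity_pt_filterlim, continuity_sin.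
Qed.

Lemma continuous_invR {U : UniformSpace} (f : U -> R) z :
  f z <> 0 -> continuous f z -> continuous (fun z => / f z) z.
Proof.
  intros N H. apply (continuous_comp f Rinv); [exact H|].
  apply continuity_pt_filterlim, continuity_pt_inv; [apply continuity_pt_id|exact N].
Qed.

Lemma continuous_fstR (z : R2) : continuous (fun z : R2 => fst z) z.
Proof. destruct z as [x y]. exact (@continuous_fst R_UniformSpace R_UniformSpace x y). Qed.

Lemma continuous_sndR (z : R2) : continuous (fun z : R2 => snd z) z.
Proof. destruct z as [x y]. exact (@continuous_snd R_UniformSpace R_UniformSpace x y). Qed.

Ltac cont := first [assumption |
  lazymatch goal with
  | |- continuous (fun z => z) _ => apply continuous_id
  | |- continuous (fun z => fst z) _ => apply continuous_fstR
  | |- continuous (fun z => snd z) _ => apply continuous_sndR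
  | |- continuous (fun _ => ?c) _ => apply continuous_const
  | |- continuous (fun z => @?f z - @?g z) _ => apply (continuous_minusR f g); cont
  | |- continuous (fun z => @?f z + @?g z) _ => apply (continuous_plusR f g); cont
  | |- continuous (fun z => @?f z * @?g z) _ => apply (continuous_multR f g); cont
  | |- continuous (fun z => - @?f z) _ => apply (continuous_oppR f); cont
  | |- continuous (fun z => @?f z ^ ?n) _ => apply (continuous_powR f n); cont
  | |- continuous (fun z => cos (@?f z)) _ => apply (continuous_cosR f); cont
  | |- continuous (fun z => sin (@?f z)) _ => apply (continuous_sinR f); cont
  | _ => auto
  end].

Ltac in_ball := apply Rabs_def1; simpl; unfold minus, plus, opp; simpl; lra.

(** Differentiation of an expression in functions whose derivatives are given
    by the hypotheses; what remains is the equality of the derivatives. *)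
Ltac derive := auto_derive;
  [repeat split; try (eexists; eassumption); simpl in *; try assumption; try lra; try nra
  |repeat match goal with
   | H : is_derive ?f ?t ?l |- context [Derive ?g ?t] =>
     replace (Derive g t) with l by (symmetry; exact (is_derive_unique f t l H))
   end].

Lemma locally_R2 (P : R2 -> Prop) (x : R2) :
  locally x P <->
  exists e, 0 < e /\ forall y : R2,
    Rabs (fst y - fst x) < e -> Rabs (snd y - snd x) < e -> P y.
Proof.
  split.
  - intros [e He]. exists e. split; [apply cond_pos|].
    intros y H1 H2. apply He. split; assumption.
  - intros [e [He H]]. exists (mkposreal e He).
    intros y [H1 H2]. apply H; assumption.
Qed.

Lemma locally_Rabs (t e : R) : 0 < e -> locally t (fun s => Rabs (s - t) < e).
Proof. intros He. exists (mkposreal e He). intros s Hs. exact Hs. Qed.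

Lemma continuous_R2 (f : R2 -> R) (x : R2) :
  continuous f x <->
  forall eps, 0 < eps -> exists e, 0 < e /\ forall y : R2,
    Rabs (fst y - fst x) < e -> Rabs (snd y - snd x) < e ->
    Rabs (f y - f x) < eps.
Proof.
  unfold continuous. rewrite filterlim_locally. split.
  - intros H eps Heps. apply locally_R2. exact (H (mkposreal eps Heps)).
  - intros H [eps Heps]. apply locally_R2. exact (H eps Heps).
Qed.

Lemma continuous_lt {U : UniformSpace} (f : U -> R) (z : U) (c : R) :
  continuous f z -> f z < c -> locally z (fun y => f y < c).
Proof. intros Hf Hc. apply (Hf (fun s => s < c)), (open_lt c), Hc. Qed.

Lemma continuous_gt {U : UniformSpace} (f : U -> R) (z : U) (c : R) :
  continuous f z -> c < f z -> locally z (fun y => c < f y).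
Proof. intros Hf Hc. apply (Hf (fun s => c < s)), (open_gt c), Hc. Qed.

Lemma continuous_2d (f : R2 -> R) (x y : R) :
  continuous f (x, y) -> continuity_2d_pt (fun a b => f (a, b)) x y.
Proof.
  intros H. apply continuity_2d_pt_filterlim.
  apply filterlim_ext with f; [intros []; reflexivity | exact H].
Qed.

Lemma continuous_pt (f : R -> R) (x : R) : continuous f x -> continuity_pt f x.
Proof. intros H. apply continuity_pt_filterlim. exact H. Qed.

Lemma continuous_pair {U : UniformSpace} (f g : U -> R) (t : U) :
  continuous f t -> continuous g t -> continuous (fun s => (f s, g s)) t.
Proof.
  intros Hf Hg. apply filterlim_locally. intros eps.
  generalize (filter_and _ _ (proj1 (filterlim_locally f (f t)) Hf eps)
    (proj1 (filterlim_locally g (g t)) Hg eps)).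
  apply filter_imp. intros s [A B]. split; assumption.
Qed.

Lemma continuous_along {U : UniformSpace} (u : R2 -> R) (f g : U -> R) (t : U) :
  continuous u (f t, g t) -> continuous f t -> continuous g t ->
  continuous (fun s => u (f s, g s)) t.
Proof.
  intros Hu Hf Hg. apply (continuous_comp (fun s => (f s, g s)) u); [|exact Hu].
  apply continuous_pair; assumption.
Qed.

Lemma continuous_section_1 (f : R2 -> R) (x y : R) :
  continuous f (x, y) -> continuous (fun s => f (s, y)) x.
Proof. intros H. apply (continuous_along f (fun s => s) (fun _ => y)); cont. Qed.

Lemma continuous_section_2 (f : R2 -> R) (x y : R) :
  continuous f (x, y) -> continuous (fun s => f (x, s)) y.
Proof. intros H. apply (continuous_along f (fun _ => x) (fun s => s)); cont. Qed.

Lemma ex_RInt_cont (f : R -> R) (a b : R) : (forall t, continuous f t) -> ex_RInt f a b.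
Proof. intros H. apply (ex_RInt_continuous (V := R_CompleteNormedModule)). auto. Qed.

Lemma RInt_is (f : R -> R) (a b : R) :
  (forall t, continuous f t) -> is_RInt f a b (RInt f a b).
Proof. intros H. apply (RInt_correct (V := R_CompleteNormedModule)), ex_RInt_cont, H. Qed.

Lemma is_RInt_plusR (f g : R -> R) (a b l m : R) :
  is_RInt f a b l -> is_RInt g a b m -> is_RInt (fun t => f t + g t) a b (l + m).
Proof. exact (is_RInt_plus (V := R_NormedModule) f g a b l m). Qed.

Lemma is_RInt_scalR (f : R -> R) (a b c l : R) :
  is_RInt f a b l -> is_RInt (fun t => c * f t) a b (c * l).
Proof. exact (is_RInt_scal (V := R_NormedModule) f a b c l). Qed.

Lemma RInt_zero (f : R -> R) (l h : R) :
  (forall t, Rmin l h < t < Rmax l h -> f t = 0) -> RInt f l h = 0.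
Proof.
  intros H. rewrite (RInt_ext f (fun _ => 0)) by exact H.
  rewrite RInt_const. apply Rmult_0_r.
Qed.

Lemma derive_zero_const (f : R -> R) (a b : R) :
  a <= b -> (forall t, a < t < b -> is_derive f t 0) ->
  (forall t, a <= t <= b -> continuous f t) -> f a = f b.
Proof.
  intros Hab H1 H2.
  destruct (MVT_gen f a b (fun _ => 0)) as [c [_ Hc]].
  - rewrite Rmin_left, Rmax_right by lra. exact H1.
  - rewrite Rmin_left, Rmax_right by lra. intros. apply continuous_pt. auto.
  - lra.
Qed.

(** The indicator function of a locally constant predicate has derivative
    zero, so that the mean value theorem replaces the connectedness of the
    interval. *)
Lemma locally_constant_prop (P : R -> Prop) (a b : R) :
  a <= b -> (forall t, a <= t <= b -> locally t (fun s => P s <-> P t)) ->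
  (P a <-> P b).
Proof.
  intros Hab H.
  set (f := fun t => if excluded_middle_informative (P t) then 1 else 0).
  assert (Hd : forall t, a <= t <= b -> is_derive f t 0).
  { intros t Ht.
    apply is_derive_ext_loc with (fun _ => f t).
    - generalize (H t Ht). apply filter_imp. intros s Hs. unfold f.
      destruct (excluded_middle_informative (P t)),
        (excluded_middle_informative (P s)); tauto || reflexivity.
    - apply @is_derive_const. }
  assert (E : f a = f b).
  { apply derive_zero_const; [exact Hab| |]; intros t Ht.
    - apply Hd. lra.
    - apply (continuous_of_derive f t 0). auto. }
  unfold f in E.
  destruct (excluded_middle_informative (P a)),
    (excluded_middle_informative (P b)); tauto || lra.
Qed.

Definition has_grad (E : R2 -> Prop) (u p q : R2 -> R) : Prop :=
  forall x, E x ->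
    is_derive (fun t => u (t, snd x)) (fst x) (p x) /\
    is_derive (fun t => u (fst x, t)) (snd x) (q x) /\
    continuous p x /\ continuous q x.

Lemma grad_differentiable (E : R2 -> Prop) (u p q : R2 -> R) (x y : R) :
  open E -> has_grad E u p q -> E (x, y) ->
  differentiable_pt_lim (fun a b => u (a, b)) x y (p (x, y)) (q (x, y)).
Proof.
  intros HE Hu Hx. apply filterdiff_differentiable_pt_lim.
  apply (is_derive_filterdiff (fun a b => u (a, b)) x y (fun a b => p (a, b))).
  - generalize (HE _ Hx). apply filter_imp. intros z Hz. destruct (Hu z Hz) as (D & _).
    destruct z. exact D.
  - apply (Hu _ Hx).
  - apply continuous_ext with p; [intros []; reflexivity|apply (Hu _ Hx)].
Qed.

Lemma grad_chain (E : R2 -> Prop) (u p q : R2 -> R) (f g : R -> R) (t f' g' : R) :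
  open E -> has_grad E u p q -> E (f t, g t) ->
  is_derive f t f' -> is_derive g t g' ->
  is_derive (fun s => u (f s, g s)) t (p (f t, g t) * f' + q (f t, g t) * g').
Proof.
  intros HE Hu Hx Hf Hg. apply is_derive_Reals.
  apply (derivable_pt_lim_comp_2d (fun a b => u (a, b))).
  - apply (grad_differentiable E); assumption.
  - apply is_derive_Reals, Hf.
  - apply is_derive_Reals, Hg.
Qed.

Lemma grad_continuous (E : R2 -> Prop) (u p q : R2 -> R) (x : R2) :
  open E -> has_grad E u p q -> E x -> continuous u x.
Proof.
  intros HE Hu Hx. destruct x as [x y].
  apply (filterlim_ext (fun z => u (fst z, snd z))); [intros []; reflexivity|].
  apply (proj1 (continuity_2d_pt_filterlim (fun a b => u (a, b)) x y)).
  apply differentiable_continuity_pt.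
  exists (p (x, y)), (q (x, y)).
  apply (grad_differentiable E); assumption.
Qed.

Lemma uniform_in_parameter (f : R2 -> R) (c d x eps : R) :
  (forall z, continuous f z) -> 0 < eps -> exists e, 0 < e /\ forall t y,
    Rabs (t - x) < e -> c <= y <= d -> Rabs (f (t, y) - f (x, y)) < eps.
Proof.
  intros Hf Heps.
  destruct (uniform_continuity_2d (fun a b => f (a, b)) (x - 1) (x + 1) c d
    (fun a b _ _ => continuous_2d f a b (Hf (a, b))) (mkposreal _ Heps)) as [de Hde].
  destruct (ex_small de 1 1 1) as (e & He); try apply cond_pos; try lra.
  exists e. split; [lra|]. intros t y Ht Hy.
  assert (Ht1 : Rabs (t - x) < 1) by lra. apply Rabs_def2 in Ht1.
  apply (Hde x y t y); simpl; try lra. rewrite Rminus_diag, Rabs_R0. apply cond_pos.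
Qed.

Lemma max_on_box (f : R2 -> R) (a b c d : R) :
  a <= b -> c <= d -> (forall x, continuous f x) ->
  exists x0 y0, a <= x0 <= b /\ c <= y0 <= d /\
    forall x y, a <= x <= b -> c <= y <= d -> f (x, y) <= f (x0, y0).
Proof.
  intros Hab Hcd Hf.
  assert (Hy : forall x, exists y0, c <= y0 <= d /\
    forall y, c <= y <= d -> f (x, y) <= f (x, y0)).
  { intros x. destruct (continuity_ab_maj (fun y => f (x, y)) c d Hcd) as [y0 [H1 H2]].
    - intros y _. apply continuous_pt, continuous_section_2, Hf.
    - exists y0. auto. }
  destruct (choice _ Hy) as [top Htop].
  destruct (continuity_ab_maj (fun x => f (x, top x)) a b Hab) as [x0 [Hmax Hx0]].
  - intros x _. apply continuous_pt, filterlim_locally. intros eps.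
    destruct (uniform_in_parameter f c d x eps Hf (cond_pos eps)) as (e & He & K).
    exists (mkposreal e He).
    change (forall t : R, Rabs (t - x) < e -> Rabs (f (t, top t) - f (x, top x)) < eps).
    intros t Ht.
    destruct (Htop x) as [X1 X2], (Htop t) as [T1 T2].
    generalize (K t _ Ht X1) (K t _ Ht T1) (X2 _ T1) (T2 _ X1). intros A B L1 L2.
    apply Rabs_def2 in A, B. apply Rabs_def1; lra.
  - exists x0, (top x0). split; [exact Hx0|]. split; [apply Htop|]. intros x y Hx Hy'.
    eapply Rle_trans; [apply (Htop x), Hy'|apply Hmax, Hx].
Qed.

(** * The maximum principle *)

Lemma is_derive_slope_pos (h : R -> R) (t l : R) :
  is_derive h t l -> 0 < l ->
  exists d, 0 < d /\
    (forall s, t < s < t + d -> h t < h s) /\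
    (forall s, t - d < s < t -> h s < h t).
Proof.
  intros H Hl. apply is_derive_Reals in H.
  destruct (H (l / 2) ltac:(lra)) as [d Hd].
  exists d. split; [apply cond_pos|].
  assert (Q : forall s, s <> t -> Rabs (s - t) < d ->
    exists k, 0 < k /\ h s - h t = k * (s - t)).
  { intros s Hs Hsd. exists ((h s - h t) / (s - t)). split; [|field; lra].
    generalize (Hd (s - t) ltac:(lra) Hsd).
    replace (t + (s - t)) with s by ring.
    intros B. apply Rabs_def2 in B. lra. }
  split; intros s Hs.
  - destruct (Q s) as (k & Hk & E); [lra|rewrite Rabs_pos_eq; lra|]. nra.
  - destruct (Q s) as (k & Hk & E); [lra|rewrite Rabs_left; lra|]. nra.
Qed.

Lemma second_derivative_test (h h' : R -> R) (t l : R) :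
  locally t (fun s => is_derive h s (h' s)) -> is_derive h' t l -> 0 < l ->
  ~ locally t (fun s => h s <= h t).
Proof.
  intros [e1 H1] Hl Hpos [e2 H2].
  destruct (is_derive_slope_pos _ _ _ Hl Hpos) as (d & Hd & Hr & Hlft).
  destruct (ex_small d e1 e2 1) as (m & Hm); try apply cond_pos; [lra|lra|].
  destruct (Rle_lt_dec 0 (h' t)) as [Ht|Ht].
  - destruct (MVT_cor2 h h' t (t + m)) as [c [Hc Hct]]; [lra| |].
    + intros s Hs. apply is_derive_Reals, H1.
      in_ball.
    + assert (h (t + m) <= h t).
      { apply H2. in_ball. }
      assert (h' t < h' c) by (apply Hr; lra). nra.
  - destruct (MVT_cor2 h h' (t - m) t) as [c [Hc Hct]]; [lra| |].
    + intros s Hs. apply is_derive_Reals, H1.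
      in_ball.
    + assert (h (t - m) <= h t).
      { apply H2. in_ball. }
      assert (h' c < h' t) by (apply Hlft; lra). nra.
Qed.

Lemma locally_slice_1 (P : R2 -> Prop) (x : R2) :
  locally x P -> locally (fst x) (fun t => P (t, snd x)).
Proof.
  intros [e H]. exists e. intros t Ht. apply H. split; [exact Ht|apply ball_center].
Qed.

Lemma locally_slice_2 (P : R2 -> Prop) (x : R2) :
  locally x P -> locally (snd x) (fun t => P (fst x, t)).
Proof.
  intros [e H]. exists e. intros t Ht. apply H. split; [apply ball_center|exact Ht].
Qed.

(** A positive value of [w] would produce a positive maximum, where both pure
    second derivatives are nonpositive. *)
Lemma maximum_principle (E : R2 -> Prop) (w wx wy wxx wyy : R2 -> R) :
  open E ->
  (forall x, E x -> continuous w x) ->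
  (forall x, E x -> is_derive (fun t => w (t, snd x)) (fst x) (wx x)) ->
  (forall x, E x -> is_derive (fun t => w (fst x, t)) (snd x) (wy x)) ->
  (forall x, E x -> is_derive (fun t => wx (t, snd x)) (fst x) (wxx x)) ->
  (forall x, E x -> is_derive (fun t => wy (fst x, t)) (snd x) (wyy x)) ->
  (forall x, E x -> 0 < w x -> 0 < wxx x + wyy x) ->
  (forall z eta, ~ E z -> 0 < eta -> locally z (fun y => E y -> w y < eta)) ->
  (forall eta, 0 < eta -> exists M, forall x, E x -> eta < w x ->
     Rabs (fst x) <= M /\ Rabs (snd x) <= M) ->
  forall x, E x -> w x <= 0.
Proof.
  intros HE Hc Hwx Hwy Hwxx Hwyy Hsub Hbd Hinf x0 Hx0.
  apply Rnot_lt_le. intros Hpos.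
  set (eta := w x0 / 2). assert (Heta : 0 < eta) by (unfold eta; lra).
  destruct (Hinf eta Heta) as [M HM].
  set (F := fun y => if excluded_middle_informative (E y)
                     then Rmax (w y - eta) 0 else 0).
  assert (FE : forall y, E y -> F y = Rmax (w y - eta) 0).
  { intros y Hy. unfold F. destruct (excluded_middle_informative (E y)); tauto. }
  assert (HF : forall y, continuous F y).
  { intros y. destruct (classic (E y)) as [Hy|Hy].
    - apply continuous_ext_loc with (fun y => Rmax (w y - eta) 0).
      + generalize (HE _ Hy). apply filter_imp. intros z Hz. symmetry. auto.
      + apply (continuous_comp w (fun t => Rmax (t - eta) 0)); [auto|].
        apply continuity_pt_filterlim. intros e He. exists e. split; [exact He|].
        intros t [_ Ht]. simpl in *. unfold Rdist in *.
        eapply Rle_lt_trans; [|exact Ht].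
        unfold Rmax, Rabs. repeat destruct Rle_dec; repeat destruct Rcase_abs; lra.
    - apply continuous_ext_loc with (fun _ => 0); [|apply continuous_const].
      generalize (Hbd y eta Hy Heta). apply filter_imp. intros z Hz.
      unfold F. destruct (excluded_middle_informative (E z)); [|reflexivity].
      rewrite Rmax_right; auto. generalize (Hz e). lra. }
  destruct (HM x0 Hx0 ltac:(unfold eta; lra)) as [B1 B2].
  assert (HM0 := Rabs_pos (fst x0)).
  destruct (max_on_box F (- M) M (- M) M) as (a & b & _ & _ & Hab);
    [lra|lra|exact HF|].
  assert (Hbox : forall t, Rabs t <= M -> - M <= t <= M).
  { intros t Ht. generalize (Rle_abs t) (Rle_abs (- t)). rewrite Rabs_Ropp. lra. }
  assert (H0 : F x0 <= F (a, b)).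
  { destruct x0. apply Hab; apply Hbox; assumption. }
  rewrite (FE x0 Hx0) in H0. rewrite Rmax_left in H0 by (unfold eta; lra).
  assert (Hy : E (a, b)).
  { apply NNPP. intros Hn. unfold F in H0.
    destruct (excluded_middle_informative (E (a, b))); [tauto|]. unfold eta in *. lra. }
  rewrite (FE _ Hy) in H0.
  assert (Hw : w (a, b) - eta = Rmax (w (a, b) - eta) 0).
  { unfold Rmax in *. destruct Rle_dec; unfold eta in *; lra. }
  assert (Hmax : forall y, E y -> w y <= w (a, b)).
  { intros y Ey. destruct (Rle_lt_dec (w y) eta) as [|Hlt]; [unfold eta in *; lra|].
    destruct (HM y Ey Hlt) as [C1 C2]. apply Hbox in C1. apply Hbox in C2.
    assert (H3 : F y <= F (a, b)) by (destruct y; apply Hab; assumption).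
    rewrite (FE _ Hy), (FE _ Ey), <- Hw in H3.
    generalize (Rmax_l (w y - eta) 0). lra. }
  assert (Hs : 0 < wxx (a, b) + wyy (a, b)).
  { apply Hsub; [exact Hy|]. unfold eta in *. lra. }
  assert (L1 : locally a (fun t => E (t, b))) by exact (locally_slice_1 _ _ (HE _ Hy)).
  assert (L2 : locally b (fun t => E (a, t))) by exact (locally_slice_2 _ _ (HE _ Hy)).
  destruct (Rlt_le_dec 0 (wxx (a, b))) as [P|P].
  - apply (second_derivative_test (fun t => w (t, b)) (fun t => wx (t, b)) a (wxx (a, b))).
    + revert L1. apply filter_imp. intros t Ht. exact (Hwx _ Ht).
    + exact (Hwxx _ Hy).
    + exact P.
    + revert L1. apply filter_imp. auto.
  - apply (second_derivative_test (fun t => w (a, t)) (fun t => wy (a, t)) b (wyy (a, b))).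
    + revert L2. apply filter_imp. intros t Ht. exact (Hwy _ Ht).
    + exact (Hwyy _ Hy).
    + lra.
    + revert L2. apply filter_imp. auto.
Qed.

(** * Cosine moments and Bessel's equation *)

Lemma nonincreasing_of_derive (f f' : R -> R) (a b : R) :
  a <= b -> (forall t, a <= t <= b -> is_derive f t (f' t)) ->
  (forall t, a <= t <= b -> f' t <= 0) -> f b <= f a.
Proof.
  intros Hab H1 H2.
  destruct (MVT_gen f a b f') as [c [Hc E]].
  - rewrite Rmin_left, Rmax_right by lra. intros. apply H1. lra.
  - rewrite Rmin_left, Rmax_right by lra. intros. apply continuous_pt.
    eapply continuous_of_derive. auto.
  - rewrite Rmin_left, Rmax_right in Hc by lra. generalize (H2 c Hc). nra.
Qed.

Lemma continuous_mult_cos (f : R -> R) (n : nat) :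
  (forall t, continuous f t) -> forall t, continuous (fun t => f t * cos (INR n * t)) t.
Proof. intros H t. cont. Qed.

Definition kernel (c t : R) : R := 1 + cos t - c.

(** By [2 cos t cos (n t) = cos ((n - 1) t) + cos ((n + 1) t)], multiplying a
    function all of whose cosine moments vanish by [kernel c] preserves this
    property. *)
Lemma kernel_moments (f : R -> R) (c : R) :
  (forall t, continuous f t) ->
  (forall n : nat, RInt (fun t => f t * cos (INR n * t)) (- PI) PI = 0) ->
  forall (k n : nat),
    is_RInt (fun t => f t * kernel c t ^ k * cos (INR n * t)) (- PI) PI 0.
Proof.
  intros Hf H0. induction k as [|k IH]; intros n.
  - apply is_RInt_ext with (fun t => f t * cos (INR n * t)).
    + intros. simpl. ring.
    + rewrite <- (H0 n). apply RInt_is, continuous_mult_cos, Hf.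
  - destruct n as [|n].
    + replace 0 with ((1 - c) * 0 + 1 * 0) by ring.
      eapply is_RInt_ext; [|apply is_RInt_plusR;
        apply is_RInt_scalR; [exact (IH 0%nat)|exact (IH 1%nat)]].
      intros t _. unfold plus, scal; simpl; unfold mult; simpl.
      rewrite Rmult_0_l, !Rmult_1_l, cos_0. unfold kernel. ring.
    + replace 0 with ((1 - c) * 0 + (/ 2 * 0 + / 2 * 0)) by ring.
      eapply is_RInt_ext; [|apply is_RInt_plusR;
        [apply is_RInt_scalR; exact (IH (S n))
        |apply is_RInt_plusR;
         apply is_RInt_scalR;
         [exact (IH n)|exact (IH (S (S n)))]]].
      intros t _.
      assert (E : cos (INR n * t) + cos (INR (S (S n)) * t)
                  = 2 * (cos t * cos (INR (S n) * t))).
      { replace (INR n * t) with (INR (S n) * t - t) by (rewrite S_INR; ring).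
        replace (INR (S (S n)) * t) with (INR (S n) * t + t)
          by (rewrite (S_INR (S n)); ring).
        rewrite cos_plus, cos_minus. ring. }
      change ((1 - c) * (f t * kernel c t ^ k * cos (INR (S n) * t))
        + (/ 2 * (f t * kernel c t ^ k * cos (INR n * t))
           + / 2 * (f t * kernel c t ^ k * cos (INR (S (S n)) * t)))
        = f t * (kernel c t * kernel c t ^ k) * cos (INR (S n) * t)).
      unfold kernel at 4. generalize dependent (kernel c t ^ k). intros K.
      nra.
Qed.

Lemma RInt_lower (g : R -> R) (a b m : R) :
  a <= b -> (forall t, continuous g t) ->
  (forall t, a <= t <= b -> m <= g t) -> m * (b - a) <= RInt g a b.
Proof.
  intros Hab Hg Hm.
  replace (m * (b - a)) with (RInt (fun _ => m) a b).
  - apply RInt_le; [exact Hab|apply ex_RInt_const|apply ex_RInt_cont; exact Hg|].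
    intros t Ht. apply Hm. lra.
  - rewrite RInt_const. unfold scal; simpl; unfold mult; simpl. ring.
Qed.

(** Powers of [kernel (cos d)] are bounded by one in absolute value outside
    [[-d, d]] and tend to infinity near [0]; a positive value of [f] at [0]
    would make one of the integrals in [kernel_moments] positive. *)
Lemma cosine_moments_le (f : R -> R) :
  (forall t, continuous f t) ->
  (forall n : nat, RInt (fun t => f t * cos (INR n * t)) (- PI) PI = 0) ->
  f 0 <= 0.
Proof.
  intros Hf H0. apply Rnot_lt_le. intros Hpos.
  assert (HPI := PI_RGT_0).
  destruct (proj1 (filterlim_locally f (f 0)) (Hf 0)
    (mkposreal (f 0 / 2) ltac:(lra))) as [e He].
  destruct (ex_small e PI 1 1) as (d & Hd); try apply cond_pos; try lra.
  assert (Hfd : forall t, - d <= t <= d -> f 0 / 2 <= f t).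
  { intros t Ht.
    assert (B : Rabs (f t - f 0) < f 0 / 2).
    { apply He. in_ball. }
    apply Rabs_def2 in B. lra. }
  destruct (continuity_ab_maj (fun t => Rabs (f t)) (- PI) PI) as [tm [Hm _]]; [lra| |].
  { intros t _. apply continuous_pt.
    apply (continuous_comp f Rabs); [auto|apply continuous_Rabs]. }
  set (M := Rabs (f tm)). fold M in Hm.
  assert (HM : 0 <= M) by apply Rabs_pos.
  set (c := cos d).
  assert (Hq : c < cos (d / 2)) by (apply cos_decreasing_1; lra).
  assert (Ecos : forall t, cos t = cos (Rabs t)).
  { intros t. unfold Rabs. destruct Rcase_abs; [symmetry; apply cos_neg|reflexivity]. }
  assert (Hin : forall t e, 0 <= e <= PI -> - e <= t <= e -> cos e <= cos t).
  { intros t e' He' Ht. rewrite (Ecos t). apply Rabs_le in Ht. generalize (Rabs_pos t). intros.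
    apply cos_decr_1; lra. }
  assert (Hout : forall t, d <= Rabs t <= PI -> cos t <= c).
  { intros t Ht. rewrite Ecos. apply cos_decr_1; lra. }
  assert (Hc1 : -1 <= c <= 1) by apply COS_bound.
  set (q := cos (d / 2) - c).
  assert (Hk : exists k : nat, 2 * M * PI < f 0 / 2 * d * (1 + q) ^ k).
  { destruct (Pow_x_infinity (1 + q)) with (b := 2 * M * PI / (f 0 / 2 * d) + 1) as [k Hk].
    - rewrite Rabs_pos_eq; unfold q; lra.
    - exists k. specialize (Hk k (le_n k)).
      rewrite Rabs_pos_eq in Hk by (apply pow_le; unfold q; lra).
      assert (P : 0 < f 0 / 2 * d) by nra.
      apply Rlt_le_trans with (f 0 / 2 * d * (2 * M * PI / (f 0 / 2 * d) + 1)).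
      + replace (f 0 / 2 * d * (2 * M * PI / (f 0 / 2 * d) + 1))
          with (2 * M * PI + f 0 / 2 * d) by (field; lra). lra.
      + apply Rmult_le_compat_l; lra. }
  destruct Hk as [k Hk].
  set (g := fun t => f t * kernel c t ^ k).
  assert (Hg : forall t, continuous g t).
  { intros t. unfold g, kernel. cont. }
  assert (I0 : RInt g (- PI) PI = 0).
  { apply is_RInt_unique. eapply is_RInt_ext; [|exact (kernel_moments f c Hf H0 k 0)].
    intros t _. unfold g. simpl. rewrite Rmult_0_l, cos_0. ring. }
  assert (Hside : forall t, - PI <= t <= PI -> d / 2 <= Rabs t -> - M <= g t).
  { intros t Ht Hdt. unfold g.
    destruct (Rle_lt_dec (Rabs t) d) as [Hle|Hgt].
    - assert (- d <= t <= d).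
      { generalize (Rle_abs t) (Rle_abs (- t)). rewrite Rabs_Ropp. lra. }
      assert (0 <= f t) by (generalize (Hfd t H); lra).
      assert (0 <= kernel c t ^ k).
      { apply pow_le. unfold kernel. generalize (Hin t d ltac:(lra) H). fold c. lra. }
      nra.
    - assert (Hb : Rabs (kernel c t ^ k) <= 1).
      { rewrite <- RPow_abs, <- (pow1 k). apply pow_incr. split; [apply Rabs_pos|].
        assert (cos t <= c).
        { apply Hout. split; [lra|]. apply Rabs_le. lra. }
        unfold kernel. generalize (COS_bound t). intros. apply Rabs_le.
        lra. }
      assert (Hfm := Hm t Ht).
      assert (Rabs (f t * kernel c t ^ k) <= M).
      { rewrite Rabs_mult. generalize (Rabs_pos (f t)) (Rabs_pos (kernel c t ^ k)). nra. }
      generalize (Rle_abs (- (f t * kernel c t ^ k))). rewrite Rabs_Ropp. lra. }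
  assert (I1 : - M * (- (d / 2) - - PI) <= RInt g (- PI) (- (d / 2))).
  { apply RInt_lower; [lra|exact Hg|]. intros t Ht. apply Hside; [lra|].
    rewrite Rabs_left; lra. }
  assert (I3 : - M * (PI - d / 2) <= RInt g (d / 2) PI).
  { apply RInt_lower; [lra|exact Hg|]. intros t Ht. apply Hside; [lra|].
    rewrite Rabs_pos_eq; lra. }
  assert (I2 : f 0 / 2 * (1 + q) ^ k * (d / 2 - - (d / 2))
               <= RInt g (- (d / 2)) (d / 2)).
  { apply RInt_lower; [lra|exact Hg|]. intros t Ht. unfold g.
    assert (f 0 / 2 <= f t) by (apply Hfd; lra).
    assert ((1 + q) ^ k <= kernel c t ^ k).
    { apply pow_incr. unfold kernel, q. generalize (Hin t (d / 2) ltac:(lra) Ht). lra. }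
    assert (0 <= (1 + q) ^ k) by (apply pow_le; unfold q; lra).
    apply Rmult_le_compat; lra. }
  assert (Ch : RInt g (- PI) PI = RInt g (- PI) (- (d / 2))
     + (RInt g (- (d / 2)) (d / 2) + RInt g (d / 2) PI)).
  { rewrite <- (RInt_Chasles g (- PI) (- (d / 2)) PI) by (apply ex_RInt_cont; exact Hg).
    rewrite <- (RInt_Chasles g (- (d / 2)) (d / 2) PI) by (apply ex_RInt_cont; exact Hg).
    reflexivity. }
  rewrite I0 in Ch. nra.
Qed.

(** The value at [0] is that of the even part of [f], which its cosine moments
    determine. *)
Lemma cosine_moments_zero (f : R -> R) :
  (forall t, continuous f t) ->
  (forall n : nat, RInt (fun t => f t * cos (INR n * t)) (- PI) PI = 0) ->
  f 0 = 0.
Proof.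
  intros Hf H0. apply Rle_antisym; [apply cosine_moments_le; assumption|].
  assert (- f 0 <= 0); [|lra].
  apply (cosine_moments_le (fun t => - f t)).
  - intros t. cont.
  - intros n. transitivity (- RInt (fun t => f t * cos (INR n * t)) (- PI) PI).
    + rewrite <- (RInt_opp (V := R_CompleteNormedModule)).
      * apply RInt_ext. intros x _.
        change (- f x * cos (INR n * x) = - (f x * cos (INR n * x))). ring.
      * apply ex_RInt_cont, continuous_mult_cos, Hf.
    + rewrite H0. apply Ropp_0.
Qed.

(** With [w = sqrt r * y] Bessel's equation for [y] becomes
    [w'' + (k^2 + (1/4 - m) / r^2) w = 0], and this is [w'^2 + k^2 w^2]. *)
Definition bessel_energy (k : R) (y y' : R -> R) (r : R) : R :=
  r * (y' r + y r / (2 * r)) ^ 2 + k ^ 2 * r * y r ^ 2.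

Definition bessel_ode (k m : R) (y y' : R -> R) (r : R) : Prop :=
  is_derive y r (y' r) /\
  is_derive y' r (- (y' r / r) - (k ^ 2 - m / r ^ 2) * y r).

Lemma bessel_energy_derive (k m : R) (y y' : R -> R) (r : R) :
  0 < r -> bessel_ode k m y y' r ->
  is_derive (bessel_energy k y y') r
    ((2 * r * y r * y' r + y r ^ 2) * (m - 1 / 4) / r ^ 2).
Proof.
  intros Hr [H1 H2]. unfold bessel_energy.
  derive. field. lra.
Qed.

Lemma bessel_energy_bound (k : R) (y y' : R -> R) (r : R) :
  0 < k -> 0 < r ->
  k * Rabs (2 * r * y r * y' r + y r ^ 2) <= bessel_energy k y y' r.
Proof.
  intros Hk Hr. unfold bessel_energy.
  set (z := y' r + y r / (2 * r)).
  assert (E : 2 * r * y r * y' r + y r ^ 2 = 2 * r * (y r * z))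
    by (unfold z; field; lra).
  rewrite E.
  assert (H1 : 0 <= r * (z - k * y r) ^ 2) by (apply Rmult_le_pos; [lra|apply pow2_ge_0]).
  assert (H2 : 0 <= r * (z + k * y r) ^ 2) by (apply Rmult_le_pos; [lra|apply pow2_ge_0]).
  unfold Rabs. destruct Rcase_abs; nra.
Qed.

Lemma bessel_energy_nonneg (k : R) (y y' : R -> R) (r : R) :
  0 < r -> 0 <= bessel_energy k y y' r.
Proof.
  intros Hr. unfold bessel_energy.
  apply Rplus_le_le_0_compat; [apply Rmult_le_pos|apply Rmult_le_pos; [apply Rmult_le_pos|]];
    first [apply pow2_ge_0|lra].
Qed.

Lemma bessel_energy_zero (k : R) (y y' : R -> R) (r : R) :
  0 < k -> 0 < r -> bessel_energy k y y' r <= 0 -> y r = 0.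
Proof.
  intros Hk Hr H. unfold bessel_energy in H. apply NNPP. intros N.
  assert (0 <= r * (y' r + y r / (2 * r)) ^ 2) by (apply Rmult_le_pos; [lra|apply pow2_ge_0]).
  assert (0 < k ^ 2 * r * y r ^ 2); [|lra].
  apply Rmult_lt_0_compat; [apply Rmult_lt_0_compat; [apply pow_lt|]|apply pow2_gt_0]; assumption.
Qed.

Definition bessel_rate (k m : R) : R := Rabs (m - 1 / 4) / k.

Lemma bessel_rate_bound (k m : R) (y y' : R -> R) (r : R) :
  0 < k -> 0 < r ->
  Rabs ((2 * r * y r * y' r + y r ^ 2) * (m - 1 / 4))
    <= bessel_rate k m * bessel_energy k y y' r.
Proof.
  intros Hk Hr. rewrite Rabs_mult. unfold bessel_rate.
  generalize (bessel_energy_bound k y y' r Hk Hr) (Rabs_pos (m - 1 / 4)).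
  set (A := Rabs (m - 1 / 4)). set (B := Rabs (2 * r * y r * y' r + y r ^ 2)).
  intros H1 H2.
  apply Rmult_le_reg_l with k; [exact Hk|].
  replace (k * (A / k * bessel_energy k y y' r))
    with (A * bessel_energy k y y' r) by (field; lra). nra.
Qed.

(** Gronwall's inequality, forward in [r] for [s = 1] and backward for
    [s = -1]: the energy changes at most at the relative rate [C / r^2], which
    is integrable at infinity. *)
Lemma bessel_energy_monotone (s k m : R) (y y' : R -> R) (r1 r2 : R) :
  s = 1 \/ s = -1 -> 0 < k -> 0 < r1 <= r2 ->
  (forall r, r1 <= r <= r2 -> bessel_ode k m y y' r) ->
  s * (bessel_energy k y y' r2 * exp (s * bessel_rate k m / r2))
    <= s * (bessel_energy k y y' r1 * exp (s * bessel_rate k m / r1)).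
Proof.
  intros Hs Hk Hr H. set (C := bessel_rate k m). set (En := bessel_energy k y y').
  set (X := fun r => (2 * r * y r * y' r + y r ^ 2) * (m - 1 / 4)).
  apply (nonincreasing_of_derive (fun r => s * (En r * exp (s * C / r)))
    (fun r => (s * X r - C * En r) / r ^ 2 * exp (s * C / r)) r1 r2); [lra| |].
  - intros r Hx. assert (D := bessel_energy_derive k m y y' r ltac:(lra) (H r Hx)).
    fold En in D. clearbody En. derive. change (s * C * / r) with (s * C / r).
    unfold X. destruct Hs as [-> | ->]; field; lra.
  - intros r Hx. assert (P := exp_pos (s * C / r)).
    assert (B := bessel_rate_bound k m y y' r Hk ltac:(lra)).
    fold (X r) C (En r) in B. apply Rabs_le_between in B.
    assert (0 < / r ^ 2) by (apply Rinv_0_lt_compat, pow_lt; lra).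
    unfold Rdiv at 1. apply Rmult_le_0_r; [|lra].
    apply Rmult_le_0_r; destruct Hs as [-> | ->]; lra.
Qed.

Lemma bessel_ode_unique (k m a b r0 : R) (y y' : R -> R) :
  0 < k -> 0 <= a -> a < r0 < b ->
  (forall r, a < r < b -> bessel_ode k m y y' r) ->
  y r0 = 0 -> y' r0 = 0 -> forall r, a < r < b -> y r = 0.
Proof.
  intros Hk Ha Hr0 H E0 E1 r Hr.
  assert (Z : bessel_energy k y y' r0 = 0).
  { unfold bessel_energy. rewrite E0, E1. field. lra. }
  apply (bessel_energy_zero k y y'); [exact Hk|lra|].
  destruct (Rle_lt_dec r0 r) as [L|L].
  - generalize (bessel_energy_monotone 1 k m y y' r0 r ltac:(auto) Hk ltac:(lra)
      ltac:(intros s Hs; apply H; lra)) (exp_pos (1 * bessel_rate k m / r)).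
    rewrite Z. nra.
  - generalize (bessel_energy_monotone (-1) k m y y' r r0 ltac:(auto) Hk ltac:(lra)
      ltac:(intros s Hs; apply H; lra)) (exp_pos (-1 * bessel_rate k m / r)).
    rewrite Z. nra.
Qed.

(** The energy cannot tend to zero along a solution unless it vanishes: up to
    the factor [exp (- C / r)], which tends to one, it is nondecreasing. *)
Lemma bessel_ode_decay (k m a : R) (y y' : R -> R) :
  0 < k -> 0 <= a ->
  (forall r, a < r -> bessel_ode k m y y' r) ->
  (forall eps, 0 < eps -> exists r0, forall r, r0 < r ->
     bessel_energy k y y' r < eps) ->
  forall r, a < r -> y r = 0.
Proof.
  intros Hk Ha H Hdec r Hr.
  apply (bessel_energy_zero k y y'); [exact Hk|lra|].
  apply Rnot_lt_le. intros Hpos.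
  set (C := bessel_rate k m).
  assert (HC : 0 <= C).
  { apply Rmult_le_pos; [apply Rabs_pos|]. left. apply Rinv_0_lt_compat, Hk. }
  destruct (Hdec (bessel_energy k y y' r * exp (-1 * C / r))) as [r0 Hr0].
  { apply Rmult_lt_0_compat; [exact Hpos|apply exp_pos]. }
  set (r1 := Rmax r r0 + 1).
  assert (r < r1 /\ r0 < r1) by (generalize (Rmax_l r r0) (Rmax_r r r0); unfold r1; lra).
  generalize (bessel_energy_monotone (-1) k m y y' r r1 ltac:(auto) Hk ltac:(lra)
      ltac:(intros s Hs; apply H; lra)). fold C.
  assert (exp (-1 * C / r1) <= 1).
  { rewrite <- exp_0. apply Rnot_lt_le. intros L. apply exp_lt_inv in L.
    assert (0 < / r1) by (apply Rinv_0_lt_compat; lra). unfold Rdiv in L. nra. }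
  generalize (Hr0 r1 ltac:(lra)) (bessel_energy_nonneg k y y' r1 ltac:(lra))
    (exp_pos (-1 * C / r1)). nra.
Qed.

(** * Separation of variables in polar coordinates *)

Definition eigenfunction (E : R2 -> Prop) (c : R) (u ux uy : R2 -> R) : Prop :=
  exists uxx uxy uyx uyy : R2 -> R,
    has_grad E u ux uy /\ has_grad E ux uxx uxy /\ has_grad E uy uyx uyy /\
    forall x, E x -> uxx x + uyy x = c * u x.

Definition polar (c : R2) (r t : R) : R2 := (fst c + r * cos t, snd c + r * sin t).

Notation circle := (polar (0, 0)).

Lemma continuous_polar (u : R2 -> R) (c : R2) (t0 r t : R) :
  continuous u (polar c r (t0 + t)) ->
  continuous (fun z : R2 => u (polar c (fst z) (t0 + snd z))) (r, t).
Proof.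
  intros H. unfold polar. apply (continuous_along u
    (fun z : R2 => fst c + fst z * cos (t0 + snd z))
    (fun z : R2 => snd c + fst z * sin (t0 + snd z))); [exact H|cont|cont].
Qed.

Lemma polar_continuous_t (u : R2 -> R) (c : R2) (t0 r : R) :
  (forall t, continuous u (polar c r t)) ->
  forall t, continuous (fun s => u (polar c r (t0 + s))) t.
Proof.
  intros H t. apply (continuous_section_2 (fun z => u (polar c (fst z) (t0 + snd z)))).
  apply continuous_polar, H.
Qed.

Lemma polar_periodic (c : R2) (r t0 : R) : polar c r (t0 + PI) = polar c r (t0 + - PI).
Proof.
  unfold polar. replace (t0 + PI) with (t0 + - PI + 2 * INR 1 * PI) by (simpl; ring).
  rewrite cos_period, sin_period. reflexivity.
Qed.

Lemma is_derive_RInt_smooth (E : R2 -> Prop) (f f' : R2 -> R) (a b l h r : R) :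
  open E ->
  (forall s t, a < s < b -> Rmin l h <= t <= Rmax l h -> E (s, t)) ->
  (forall z, E z -> is_derive (fun s => f (s, snd z)) (fst z) (f' z)) ->
  (forall z, E z -> continuous f z) -> (forall z, E z -> continuous f' z) ->
  a < r < b ->
  is_derive (fun r => RInt (fun t => f (r, t)) l h) r (RInt (fun t => f' (r, t)) l h).
Proof.
  intros HE Hin Hd Hf Hf' Hr.
  assert (Hloc : locally r (fun s => a < s < b)).
  { apply (locally_interval _ r a b); simpl; [lra|lra|]. intros; lra. }
  replace (RInt (fun t => f' (r, t)) l h)
    with (RInt (fun t => Derive (fun s => f (s, t)) r) l h).
  - apply (is_derive_RInt_param (fun s t => f (s, t))).
    + revert Hloc. apply filter_imp. intros s Hs t Ht. eexists.
      apply (Hd (s, t)). auto.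
    + intros t Ht. apply continuity_2d_pt_ext_loc with (fun s t => f' (s, t)).
      * destruct (HE (r, t) (Hin r t Hr Ht)) as [e He]. exists e. intros s u Hs Hu.
        symmetry. apply is_derive_unique, (Hd (s, u)), He. split; assumption.
      * apply continuous_2d, Hf'. auto.
    + revert Hloc. apply filter_imp. intros s Hs.
      apply (ex_RInt_continuous (V := R_CompleteNormedModule)).
      intros t Ht. apply continuous_section_2, Hf. auto.
  - apply RInt_ext. intros t Ht. apply is_derive_unique, (Hd (r, t)), Hin; [exact Hr|].
    simpl. lra.
Qed.

Lemma open_strip (a b : R) : open (fun z : R2 => a < fst z < b).
Proof.
  intros [x y] Hx. apply locally_R2. simpl in *. exists (Rmin (x - a) (b - x)).
  split; [apply Rmin_pos; lra|]. intros [u v] Hu _. simpl in *.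
  assert (U1 := Rlt_le_trans _ _ _ Hu (Rmin_l _ _)).
  assert (U2 := Rlt_le_trans _ _ _ Hu (Rmin_r _ _)).
  apply Rabs_def2 in U1. apply Rabs_def2 in U2. lra.
Qed.

Lemma sin_INR_PI (n : nat) : sin (INR n * PI) = 0.
Proof.
  induction n as [|n IH].
  - simpl. rewrite Rmult_0_l. apply sin_0.
  - rewrite S_INR. replace ((INR n + 1) * PI) with (INR n * PI + PI) by ring.
    rewrite neg_sin, IH. ring.
Qed.

(** The derivative along the ray through [polar c r t] of a function with
    gradient [(ux, uy)]. *)
Definition radial (ux uy : R2 -> R) (c : R2) (r t : R) : R :=
  ux (polar c r t) * cos t + uy (polar c r t) * sin t.

Lemma radial_continuous_t (ux uy : R2 -> R) (c : R2) (t0 r : R) :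
  (forall t, continuous ux (polar c r t)) -> (forall t, continuous uy (polar c r t)) ->
  forall t, continuous (fun s => radial ux uy c r (t0 + s)) t.
Proof.
  intros Hx Hy t. assert (Cx := polar_continuous_t ux c t0 r Hx t).
  assert (Cy := polar_continuous_t uy c t0 r Hy t). unfold radial. cont.
Qed.

Section PolarCoefficients.

Context (E : R2 -> Prop) (k : R) (u ux uy : R2 -> R).
Context (HE : open E) (Hu : eigenfunction E (- k ^ 2) u ux uy).
Context (c : R2) (t0 a b : R) (Ha : 0 <= a).
Context (Hann : forall r t, a < r < b -> E (polar c r t)).

Definition cos_coef (n : nat) (r : R) : R :=
  RInt (fun t => u (polar c r (t0 + t)) * cos (INR n * t)) (- PI) PI.

Definition cos_coef' (n : nat) (r : R) : R :=
  RInt (fun t => radial ux uy c r (t0 + t) * cos (INR n * t)) (- PI) PI.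

Lemma is_derive_polar_r (v p q : R2 -> R) (r t : R) :
  has_grad E v p q -> a < r < b ->
  is_derive (fun s => v (polar c s t)) r
    (p (polar c r t) * cos t + q (polar c r t) * sin t).
Proof.
  intros Hv Hr. unfold polar.
  apply (grad_chain E v p q (fun s => fst c + s * cos t) (fun s => snd c + s * sin t));
    [exact HE|exact Hv|apply Hann; exact Hr| |].
  - auto_derive; [exact I|ring].
  - auto_derive; [exact I|ring].
Qed.

Lemma is_derive_polar_t (v p q : R2 -> R) (r t : R) :
  has_grad E v p q -> a < r < b ->
  is_derive (fun s => v (polar c r (t0 + s))) t
    (r * (q (polar c r (t0 + t)) * cos (t0 + t) - p (polar c r (t0 + t)) * sin (t0 + t))).
Proof.
  intros Hv Hr. unfold polar.
  match goal with |- is_derive _ _ (r * (?Q * ?C - ?P * ?S)) =>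
    replace (r * (Q * C - P * S)) with (P * (r * - S) + Q * (r * C)) by ring end.
  apply (grad_chain E v p q (fun s => fst c + r * cos (t0 + s))
          (fun s => snd c + r * sin (t0 + s)));
    [exact HE|exact Hv|apply Hann; exact Hr| |].
  - auto_derive; [exact I|ring].
  - auto_derive; [exact I|ring].
Qed.

(** Separation of variables: the Laplacian in polar coordinates, with the
    angular part integrated by parts twice over a full turn. *)
Lemma cos_coef_bessel (n : nat) (r : R) :
  a < r < b -> bessel_ode k (INR n ^ 2) (cos_coef n) (cos_coef' n) r.
Proof.
  intros Hr. destruct Hu as (uxx & uxy & uyx & uyy & G & Gx & Gy & Heq).
  set (P := fun z : R2 => polar c (fst z) (t0 + snd z)).
  assert (HP : forall z : R2, a < fst z < b -> E (P z)) by (intros; apply Hann; assumption).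
  assert (CP : forall (v : R2 -> R) z, continuous v (P z) -> continuous (fun z => v (P z)) z).
  { intros v [s t] Hv. apply continuous_polar, Hv. }
  set (Vr := fun z : R2 => radial ux uy c (fst z) (t0 + snd z)).
  set (Vrr := fun z : R2 =>
    (uxx (P z) * cos (t0 + snd z) + uxy (P z) * sin (t0 + snd z)) * cos (t0 + snd z)
    + (uyx (P z) * cos (t0 + snd z) + uyy (P z) * sin (t0 + snd z)) * sin (t0 + snd z)).
  assert (Cu : forall z : R2, a < fst z < b -> continuous (fun z => u (P z)) z).
  { intros z Hz. apply CP, (grad_continuous E u ux uy); auto. }
  assert (CVr : forall z : R2, a < fst z < b -> continuous Vr z).
  { intros z Hz. destruct (G _ (HP z Hz)) as (_ & _ & C1 & C2).
    apply CP in C1. apply CP in C2. unfold Vr, radial. fold (P z). cont. }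
  assert (CVrr : forall z : R2, a < fst z < b -> continuous Vrr z).
  { intros z Hz. destruct (Gx _ (HP z Hz)) as (_ & _ & C1 & C2).
    destruct (Gy _ (HP z Hz)) as (_ & _ & C3 & C4).
    apply CP in C1. apply CP in C2. apply CP in C3. apply CP in C4. unfold Vrr. cont. }
  split.
  - apply (is_derive_RInt_smooth (fun z => a < fst z < b)
      (fun z => u (P z) * cos (INR n * snd z)) (fun z => Vr z * cos (INR n * snd z)) a b);
      [apply open_strip|intros s t Hs _; exact Hs| | | |exact Hr].
    + intros [s t] Hs. cbn [fst snd]. apply is_derive_scalR. apply (is_derive_polar_r u ux uy s (t0 + t) G Hs).
    + intros z Hz. assert (C := Cu z Hz). cont.
    + intros z Hz. cont.
  - replace (- (cos_coef' n r / r) - (k ^ 2 - INR n ^ 2 / r ^ 2) * cos_coef n r)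
      with (RInt (fun t => Vrr (r, t) * cos (INR n * t)) (- PI) PI).
    + apply (is_derive_RInt_smooth (fun z => a < fst z < b)
        (fun z => Vr z * cos (INR n * snd z)) (fun z => Vrr z * cos (INR n * snd z)) a b);
        [apply open_strip|intros s t Hs _; exact Hs| | | |exact Hr].
      * intros [s t] Hs. unfold Vr, Vrr, radial. cbn [fst snd]. apply is_derive_scalR.
        apply is_derive_plusR; apply is_derive_scalR.
        -- apply (is_derive_polar_r ux uxx uxy s (t0 + t) Gx Hs).
        -- apply (is_derive_polar_r uy uyx uyy s (t0 + t) Gy Hs).
      * intros z Hz. cont.
      * intros z Hz. cont.
    + set (Q := fun t => polar c r (t0 + t)).
      set (fu := fun t => u (Q t)). set (fx := fun t => ux (Q t)). set (fy := fun t => uy (Q t)).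
      set (Vt := fun t => r * (fy t * cos (t0 + t) - fx t * sin (t0 + t))).
      set (dx := fun t => r * (uxy (Q t) * cos (t0 + t) - uxx (Q t) * sin (t0 + t))).
      set (dy := fun t => r * (uyy (Q t) * cos (t0 + t) - uyx (Q t) * sin (t0 + t))).
      set (Vtt := fun t => r * ((dy t * cos (t0 + t) - fy t * sin (t0 + t))
                                - (dx t * sin (t0 + t) + fx t * cos (t0 + t)))).
      assert (Dt : forall t, is_derive fu t (Vt t))
        by (intros t; apply (is_derive_polar_t u ux uy r t G Hr)).
      assert (Dx : forall t, is_derive fx t (dx t))
        by (intros t; apply (is_derive_polar_t ux uxx uxy r t Gx Hr)).
      assert (Dy : forall t, is_derive fy t (dy t))
        by (intros t; apply (is_derive_polar_t uy uyx uyy r t Gy Hr)).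
      assert (Cfu : forall t, continuous fu t)
        by (intros t; exact (continuous_of_derive _ _ _ (Dt t))).
      assert (CVtt : forall t, continuous Vtt t).
      { intros t. destruct (Gx (Q t) (Hann _ _ Hr)) as (_ & _ & C1 & C2).
        destruct (Gy (Q t) (Hann _ _ Hr)) as (_ & _ & C3 & C4).
        assert (C : forall v : R2 -> R, continuous v (Q t) -> continuous (fun t => v (Q t)) t).
        { intros v Hv. apply (continuous_section_2 (fun z => v (P z))), CP, Hv. }
        apply C in C1. apply C in C2. apply C in C3. apply C in C4.
        assert (C5 := continuous_of_derive _ _ _ (Dx t)).
        assert (C6 := continuous_of_derive _ _ _ (Dy t)).
        unfold Vtt, dx, dy. cont. }
      (* The angular second derivative is minus [n^2] times the function in the
         sense of cosine moments, the boundary terms cancelling by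
         periodicity. *)
      assert (Iparts : is_RInt (fun t => (Vtt t + INR n ^ 2 * fu t) * cos (INR n * t))
        (- PI) PI 0).
      { set (F := fun t => Vt t * cos (INR n * t) + INR n * (fu t * sin (INR n * t))).
        assert (Z : minus (F PI) (F (- PI)) = 0).
        { assert (EQ : Q PI = Q (- PI)) by apply polar_periodic.
          assert (Et : forall t, Vt t = r * (uy (Q t) * cos (t0 + t) - ux (Q t) * sin (t0 + t)))
            by reflexivity.
          unfold F. rewrite !Et. unfold fu. rewrite EQ.
          replace (t0 + PI) with (t0 + - PI + 2 * INR 1 * PI) by (simpl; ring).
          rewrite cos_period, sin_period.
          replace (INR n * - PI) with (- (INR n * PI)) by ring.
          rewrite cos_neg, sin_neg, sin_INR_PI. unfold minus, plus, opp; simpl. ring. }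
        rewrite <- Z. apply (is_RInt_derive F); [|intros t _; cont].
        intros t _. specialize (Dt t). specialize (Dx t). specialize (Dy t). unfold F, Vt.
        derive. unfold Vtt, Vt. ring. }
      apply is_RInt_unique.
      assert (Icoef : is_RInt (fun t => fu t * cos (INR n * t)) (- PI) PI (cos_coef n r))
        by apply RInt_is, continuous_mult_cos, Cfu.
      assert (Icoef' : is_RInt (fun t => Vr (r, t) * cos (INR n * t)) (- PI) PI (cos_coef' n r)).
      { apply RInt_is, continuous_mult_cos. intros t. apply (continuous_section_2 Vr).
        apply CVr. exact Hr. }
      replace (- (cos_coef' n r / r) - (k ^ 2 - INR n ^ 2 / r ^ 2) * cos_coef n r)
        with ((- / r) * cos_coef' n r
          + ((INR n ^ 2 / r ^ 2 - k ^ 2) * cos_coef n r + (- / r ^ 2) * 0)) by (field; lra).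
      eapply is_RInt_ext; [|apply is_RInt_plusR; [apply is_RInt_scalR; exact Icoef'|
         apply is_RInt_plusR; apply is_RInt_scalR; [exact Icoef|exact Iparts]]].
      intros t _.
      change (- / r * (Vr (r, t) * cos (INR n * t)) +
        ((INR n ^ 2 / r ^ 2 - k ^ 2) * (fu t * cos (INR n * t)) +
         - / r ^ 2 * ((Vtt t + INR n ^ 2 * fu t) * cos (INR n * t)))
        = Vrr (r, t) * cos (INR n * t)).
      assert (Hl := Heq (Q t) (Hann r (t0 + t) Hr)).
      change (u (Q t)) with (fu t) in Hl.
      assert (EVr : Vr (r, t) = fx t * cos (t0 + t) + fy t * sin (t0 + t)) by reflexivity.
      assert (EVrr : Vrr (r, t) = (uxx (Q t) * cos (t0 + t) + uxy (Q t) * sin (t0 + t)) * cos (t0 + t)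
        + (uyx (Q t) * cos (t0 + t) + uyy (Q t) * sin (t0 + t)) * sin (t0 + t)) by reflexivity.
      rewrite EVr, EVrr. unfold Vtt, dx, dy.
      assert (Hsc : sin (t0 + t) ^ 2 = 1 - cos (t0 + t) ^ 2).
      { generalize (sin2_cos2 (t0 + t)). unfold Rsqr. nra. }
      transitivity ((- k ^ 2 * fu t - (uxx (Q t) * sin (t0 + t) ^ 2
           - (uxy (Q t) + uyx (Q t)) * sin (t0 + t) * cos (t0 + t)
           + uyy (Q t) * cos (t0 + t) ^ 2)) * cos (INR n * t)); [field; lra|].
      rewrite <- Hl, Hsc.
      transitivity ((uxx (Q t) * cos (t0 + t) ^ 2
        + (uxy (Q t) + uyx (Q t)) * sin (t0 + t) * cos (t0 + t)
        + uyy (Q t) * sin (t0 + t) ^ 2) * cos (INR n * t)); [rewrite Hsc|]; ring.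
Qed.

End PolarCoefficients.

(** * Unique continuation on discs and Rellich's theorem *)

Definition dist2 (c x : R2) : R := Cmod (fst x - fst c, snd x - snd c).

Lemma dist2_polar (c : R2) (r t : R) : 0 <= r -> dist2 c (polar c r t) = r.
Proof.
  intros Hr. unfold dist2, Cmod, polar; simpl fst; simpl snd.
  replace ((fst c + r * cos t - fst c) ^ 2 + (snd c + r * sin t - snd c) ^ 2)
    with (r ^ 2).
  - rewrite <- Rsqr_pow2. apply sqrt_Rsqr, Hr.
  - generalize (sin2_cos2 t). unfold Rsqr. intros. nra.
Qed.

Lemma unit_vector_angle (x y : R) : x ^ 2 + y ^ 2 = 1 ->
  exists t, - PI <= t <= PI /\ x = cos t /\ y = sin t.
Proof.
  intros H.
  assert (Hx : -1 <= x <= 1) by (split; nra).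
  assert (S : sqrt (1 - x²) = Rabs y).
  { replace (1 - x²) with (y²) by (unfold Rsqr; nra). apply sqrt_Rsqr_abs. }
  assert (B := acos_bound x). destruct (Rle_lt_dec 0 y) as [L|L].
  - exists (acos x). rewrite cos_acos, sin_acos, S, Rabs_pos_eq; lra.
  - exists (- acos x). rewrite cos_neg, sin_neg, cos_acos, sin_acos, S, Rabs_left; lra.
Qed.

Lemma dist2_nonneg (c x : R2) : 0 <= dist2 c x.
Proof. apply Cmod_ge_0. Qed.

Lemma dist2_sqr (c x : R2) :
  dist2 c x ^ 2 = (fst x - fst c) ^ 2 + (snd x - snd c) ^ 2.
Proof.
  unfold dist2, Cmod. rewrite <- Rsqr_pow2, Rsqr_sqrt; [reflexivity|].
  apply Rplus_le_le_0_compat; apply pow2_ge_0.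
Qed.

Lemma dist2_triangle (x y z : R2) : dist2 x z <= dist2 x y + dist2 y z.
Proof.
  eapply Rle_trans; [right|exact (Cmod_triangle (fst y - fst x, snd y - snd x)
    (fst z - fst y, snd z - snd y))].
  unfold dist2. f_equal. unfold Cplus. simpl. f_equal; ring.
Qed.

Lemma dist2_small (c : R2) (e : R) : 0 < e ->
  locally c (fun y => dist2 c y < e).
Proof.
  intros He. apply locally_R2. exists (e / 2). split; [lra|]. intros y H1 H2.
  assert (Q := dist2_sqr c y). assert (N := dist2_nonneg c y).
  apply Rabs_def2 in H1. apply Rabs_def2 in H2.
  apply Rnot_le_lt. intros L.
  assert ((fst y - fst c) ^ 2 <= e ^ 2 / 4) by nra.
  assert ((snd y - snd c) ^ 2 <= e ^ 2 / 4) by nra. nra.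
Qed.

Lemma open_contains_disc (E : R2 -> Prop) (c : R2) : open E -> E c ->
  exists rho, 0 < rho /\ forall y, dist2 c y < rho -> E y.
Proof.
  intros HE' Hc. destruct (proj1 (locally_R2 _ _) (HE' c Hc)) as (e & He & H).
  exists e. split; [exact He|]. intros y Hy.
  assert (M := Rmax_Cmod (fst y - fst c, snd y - snd c)). fold (dist2 c y) in M.
  apply H; (eapply Rle_lt_trans; [eapply Rle_trans; [|exact M]|exact Hy]);
    [apply Rmax_l|apply Rmax_r].
Qed.

Definition dsq (x y : R2) : R := (fst x - fst y) ^ 2 + (snd x - snd y) ^ 2.

Lemma dsq_eq x y : dsq x y <= 0 -> x = y.
Proof.
  destruct x as [x1 x2], y as [y1 y2]. unfold dsq; simpl fst; simpl snd. intros H.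
  generalize (pow2_ge_0 (x1 - y1)) (pow2_ge_0 (x2 - y2)). intros A B.
  assert (x1 - y1 = 0) by (apply Rsqr_0_uniq; rewrite Rsqr_pow2; lra).
  assert (x2 - y2 = 0) by (apply Rsqr_0_uniq; rewrite Rsqr_pow2; lra).
  f_equal; lra.
Qed.

Lemma polar_exists (c x : R2) : exists t, x = polar c (dist2 c x) t.
Proof.
  assert (Q := dist2_sqr c x). assert (N := dist2_nonneg c x).
  destruct (Req_dec (dist2 c x) 0) as [Z|Z].
  - exists 0. transitivity c; [apply dsq_eq; unfold dsq; rewrite Z in Q; lra|].
    unfold polar. rewrite Z. destruct c; simpl. f_equal; ring.
  - destruct (unit_vector_angle ((fst x - fst c) / dist2 c x) ((snd x - snd c) / dist2 c x))
      as (t & _ & H1 & H2).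
    + replace (((fst x - fst c) / dist2 c x) ^ 2 + ((snd x - snd c) / dist2 c x) ^ 2)
        with (((fst x - fst c) ^ 2 + (snd x - snd c) ^ 2) / dist2 c x ^ 2) by (field; lra).
      rewrite <- Q. field. lra.
    + exists t. unfold polar. rewrite <- H1, <- H2.
      destruct x as [x1 x2]; simpl. f_equal; field; lra.
Qed.

(** Cauchy-Schwarz, from the square of [g - s cos(n .)] for the optimal [s]. *)
Lemma cos_moment_bound (g : R -> R) (n : nat) :
  (forall t, continuous g t) ->
  RInt (fun t => g t * cos (INR n * t)) (- PI) PI ^ 2
    <= 2 * PI * RInt (fun t => g t ^ 2) (- PI) PI.
Proof.
  intros Hg. assert (HPI := PI_RGT_0).
  set (I := RInt (fun t => g t * cos (INR n * t)) (- PI) PI).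
  set (G := RInt (fun t => g t ^ 2) (- PI) PI).
  set (s := I / (2 * PI)).
  assert (J1 : is_RInt (fun t => g t * cos (INR n * t)) (- PI) PI I).
  { apply RInt_is, continuous_mult_cos, Hg. }
  assert (J2 : is_RInt (fun t => g t ^ 2) (- PI) PI G).
  { apply RInt_is. intros t. cont. }
  assert (J3 : is_RInt (fun t => g t ^ 2 + ((- 2 * s) * (g t * cos (INR n * t)) + s ^ 2))
     (- PI) PI (G + ((- 2 * s) * I + s ^ 2 * (2 * PI)))).
  { apply is_RInt_plusR; [exact J2|]. apply is_RInt_plusR.
    - apply is_RInt_scalR. exact J1.
    - replace (s ^ 2 * (2 * PI)) with (scal (PI - - PI) (s ^ 2)).
      + apply (is_RInt_const (V := R_NormedModule)).
      + unfold scal; simpl; unfold mult; simpl. ring. }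
  assert (P : 0 <= G + ((- 2 * s) * I + s ^ 2 * (2 * PI))).
  { apply (is_RInt_ge_0 _ (- PI) PI) with (2 := J3); [lra|].
    intros t _. generalize (pow2_ge_0 (g t - s * cos (INR n * t))) (COS_bound (INR n * t)).
    intros A B. assert (cos (INR n * t) ^ 2 <= 1) by nra.
    assert (0 <= s ^ 2) by apply pow2_ge_0. nra. }
  replace ((- 2 * s) * I + s ^ 2 * (2 * PI)) with (- (I ^ 2 / (2 * PI))) in P
    by (unfold s; field; lra).
  replace (I ^ 2) with (2 * PI * (I ^ 2 / (2 * PI))) by (field; lra).
  apply Rmult_le_compat_l; lra.
Qed.

Lemma grad_of_locally_zero (E : R2 -> Prop) (u p q : R2 -> R) (x : R2) :
  has_grad E u p q -> E x -> locally x (fun y => u y = 0) -> p x = 0 /\ q x = 0.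
Proof.
  intros Hu Hx [e H]. destruct (Hu x Hx) as (D1 & D2 & _). split.
  - rewrite <- (is_derive_unique _ _ _ D1).
    rewrite <- (Derive_const 0 (fst x)).
    apply Derive_ext_loc. exists e. intros t Ht. apply H.
    split; [exact Ht|apply ball_center].
  - rewrite <- (is_derive_unique _ _ _ D2).
    rewrite <- (Derive_const 0 (snd x)).
    apply Derive_ext_loc. exists e. intros t Ht. apply H.
    split; [apply ball_center|exact Ht].
Qed.

Lemma polar_near (c : R2) (r t e : R) : 0 <= r < e ->
  Rabs (fst (polar c r t) - fst c) < e /\ Rabs (snd (polar c r t) - snd c) < e.
Proof.
  intros Hr. unfold polar; simpl.
  replace (fst c + r * cos t - fst c) with (r * cos t) by ring.
  replace (snd c + r * sin t - snd c) with (r * sin t) by ring.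
  rewrite !Rabs_mult, (Rabs_pos_eq r) by lra.
  assert (Rabs (cos t) <= 1) by (apply Rabs_le, COS_bound).
  assert (Rabs (sin t) <= 1) by (apply Rabs_le, SIN_bound).
  generalize (Rabs_pos (cos t)) (Rabs_pos (sin t)). split; nra.
Qed.

Lemma eigenfunction_grad (E : R2 -> Prop) (c : R) (u ux uy : R2 -> R) :
  eigenfunction E c u ux uy -> has_grad E u ux uy.
Proof. intros (? & ? & ? & ? & H & _). exact H. Qed.

Lemma zero_of_cos_coef (E : R2 -> Prop) (k : R) (u ux uy : R2 -> R)
    (c : R2) (r t0 : R) :
  open E -> eigenfunction E (- k ^ 2) u ux uy -> (forall t, E (polar c r t)) ->
  (forall n, cos_coef u c t0 n r = 0) -> u (polar c r t0) = 0.
Proof.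
  intros HE Hu Hin H.
  rewrite <- (Rplus_0_r t0).
  apply (cosine_moments_zero (fun t => u (polar c r (t0 + t)))).
  - apply polar_continuous_t. intros t.
    apply (grad_continuous E u ux uy); [exact HE| |apply Hin].
    apply (eigenfunction_grad _ _ _ _ _ Hu).
  - exact H.
Qed.

(** Inside a disc every angular coefficient solves an ordinary differential
    equation, hence vanishes as soon as it does near the centre. *)
Lemma disc_unique_continuation (E : R2 -> Prop) (k : R) (u ux uy : R2 -> R)
    (c : R2) (rho : R) :
  open E -> 0 < k -> eigenfunction E (- k ^ 2) u ux uy ->
  (forall x, dist2 c x < rho -> E x) ->
  locally c (fun x => u x = 0) ->
  forall x, dist2 c x < rho -> u x = 0.
Proof.
  intros HE Hk Hu Hin Hz x Hx.
  assert (Hz' := proj1 (locally_R2 _ _) (locally_locally _ _ Hz)).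
  destruct Hz' as [e [He Hz']].
  assert (Hann : forall r t, 0 < r < rho -> E (polar c r t)).
  { intros r t Hr. apply Hin. rewrite dist2_polar; lra. }
  destruct (polar_exists c x) as [t0 Ex].
  (* The differential equation is singular at the centre. *)
  destruct (Rle_lt_or_eq_dec 0 (dist2 c x) (dist2_nonneg c x)) as [Hr|Hr].
  2: { rewrite Ex, <- Hr. apply (locally_singleton _ (fun y : R2 => u y = 0)).
       destruct c as [c1 c2]. unfold polar; simpl.
       replace (c1 + 0 * cos t0) with c1 by ring.
       replace (c2 + 0 * sin t0) with c2 by ring. exact Hz. }
  rewrite Ex. set (r := dist2 c x) in *.
  apply (zero_of_cos_coef E k u ux uy); [exact HE|exact Hu| |].
  - intros t. apply Hann. lra.
  - intros n.
    destruct (ex_small e rho 1 1) as (r0 & H0); try lra.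
    assert (Hzero : forall t, u (polar c r0 t) = 0 /\ ux (polar c r0 t) = 0
      /\ uy (polar c r0 t) = 0).
    { intros t. destruct (polar_near c r0 t e) as [N1 N2]; [lra|].
      assert (L := Hz' _ N1 N2).
      split; [exact (locally_singleton _ (fun y : R2 => u y = 0) L)|].
      apply (grad_of_locally_zero E u); [|apply Hann; lra|exact L].
      apply (eigenfunction_grad _ _ _ _ _ Hu). }
    apply (bessel_ode_unique k (INR n ^ 2) 0 rho r0 (cos_coef u c t0 n)
             (cos_coef' ux uy c t0 n)); try lra.
    + intros s Hs. apply (cos_coef_bessel E k u ux uy HE Hu c t0 0 rho); auto; lra.
    + apply RInt_zero. intros t _. rewrite (proj1 (Hzero _)). ring.
    + apply RInt_zero. intros t _. unfold radial.
      destruct (Hzero (t0 + t)) as (_ & -> & ->). ring.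
Qed.

(** Rellich's theorem: by Cauchy-Schwarz the hypothesis makes the Bessel energy
    of every angular coefficient tend to zero, whereas nonzero solutions of
    Bessel's equation keep their energy. *)
Lemma rellich (E : R2 -> Prop) (k a : R) (u ux uy : R2 -> R) :
  open E -> 0 < k -> 0 <= a -> eigenfunction E (- k ^ 2) u ux uy ->
  (forall r t, a < r -> E (circle r t)) ->
  (forall t0 eps, 0 < eps -> exists r0, forall r, r0 < r ->
     r * RInt (fun t => u (circle r (t0 + t)) ^ 2
                        + radial ux uy (0, 0) r (t0 + t) ^ 2) (- PI) PI < eps) ->
  forall r t, a < r -> u (circle r t) = 0.
Proof.
  intros HE Hk Ha Hu Hin Hdec r t0 Hr.
  assert (HPI := PI_RGT_0).
  assert (G := eigenfunction_grad _ _ _ _ _ Hu).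
  apply (zero_of_cos_coef E k u ux uy); [exact HE|exact Hu|auto|].
  intros n.
  apply (bessel_ode_decay k (INR n ^ 2) a (cos_coef u (0, 0) t0 n)
          (cos_coef' ux uy (0, 0) t0 n) Hk Ha); [| |exact Hr].
  - intros s Hs. apply (cos_coef_bessel E k u ux uy HE Hu (0, 0) t0 a (s + 1)); auto.
    + intros r' t' Hr'. apply Hin. lra.
    + lra.
  - intros eps Heps.
    assert (HK : 0 < 4 * PI * (1 + k ^ 2)).
    { assert (0 <= k ^ 2) by apply pow2_ge_0. nra. }
    destruct (Hdec t0 (eps / (4 * PI * (1 + k ^ 2)))) as [r0 Hr0].
    { apply Rdiv_lt_0_compat; assumption. }
    destruct (ex_large r0 a 1 1) as (r1 & S0). exists r1. intros s Hs.
    specialize (Hr0 s ltac:(lra)).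
    assert (Cu : forall t, continuous (fun t => u (circle s (t0 + t))) t).
    { apply polar_continuous_t. intros t. apply (grad_continuous E u ux uy); auto.
      apply Hin; lra. }
    assert (Cr : forall t, continuous (fun t => radial ux uy (0, 0) s (t0 + t)) t).
    { apply radial_continuous_t; intros t; apply (G (circle s t)), Hin; lra. }
    assert (B1 := cos_moment_bound _ n Cu). assert (B2 := cos_moment_bound _ n Cr).
    cbv beta in B1, B2.
    fold (cos_coef u (0, 0) t0 n s) in B1.
    fold (cos_coef' ux uy (0, 0) t0 n s) in B2.
    set (y := cos_coef u (0, 0) t0 n s) in *.
    set (y' := cos_coef' ux uy (0, 0) t0 n s) in *.
    assert (Split : RInt (fun t => u (circle s (t0 + t)) ^ 2
        + radial ux uy (0, 0) s (t0 + t) ^ 2) (- PI) PI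
      = RInt (fun t => u (circle s (t0 + t)) ^ 2) (- PI) PI
        + RInt (fun t => radial ux uy (0, 0) s (t0 + t) ^ 2) (- PI) PI).
    { apply (RInt_plus (V := R_CompleteNormedModule)); apply ex_RInt_cont; intros t; cont. }
    rewrite Split in Hr0.
    set (A := RInt (fun t => u (circle s (t0 + t)) ^ 2) (- PI) PI) in *.
    set (B := RInt (fun t => radial ux uy (0, 0) s (t0 + t) ^ 2) (- PI) PI) in *.
    assert (HAB : s * (A + B) * (4 * PI * (1 + k ^ 2)) < eps).
    { apply Rmult_lt_compat_r with (1 := HK) in Hr0.
      replace (eps / (4 * PI * (1 + k ^ 2)) * (4 * PI * (1 + k ^ 2))) with eps in Hr0
        by (field; nra). exact Hr0. }
    eapply Rle_lt_trans; [|exact HAB].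
    unfold bessel_energy. fold y y'.
    assert (E1 : (y' + y / (2 * s)) ^ 2 <= 2 * y' ^ 2 + y ^ 2).
    { assert (P : (y' + y / (2 * s)) ^ 2 <= 2 * y' ^ 2 + 2 * (y / (2 * s)) ^ 2)
        by (generalize (pow2_ge_0 (y' - y / (2 * s))); nra).
      replace (2 * (y / (2 * s)) ^ 2) with (y ^ 2 * (/ (2 * s ^ 2))) in P by (field; lra).
      assert (/ (2 * s ^ 2) <= 1) by (rewrite <- Rinv_1; apply Rinv_le_contravar; nra).
      generalize (pow2_ge_0 y). nra. }
    assert (E2 : (y' + y / (2 * s)) ^ 2 + k ^ 2 * y ^ 2 <= (A + B) * (4 * PI * (1 + k ^ 2))).
    { assert (Y := pow2_ge_0 y). assert (Y' := pow2_ge_0 y'). assert (K := pow2_ge_0 k).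
      set (X := PI * A) in *. set (Z := PI * B) in *.
      replace ((A + B) * (4 * PI * (1 + k ^ 2))) with (4 * ((X + Z) * (1 + k ^ 2)))
        by (unfold X, Z; ring).
      assert (y ^ 2 <= 2 * X) by (unfold X; lra). assert (y' ^ 2 <= 2 * Z) by (unfold Z; lra).
      nra. }
    replace (s * (y' + y / (2 * s)) ^ 2 + k ^ 2 * s * y ^ 2)
      with (s * ((y' + y / (2 * s)) ^ 2 + k ^ 2 * y ^ 2)) by ring.
    rewrite Rmult_assoc. apply Rmult_le_compat_l; lra.
Qed.

(** * The divergence theorem with a removable curve *)

Fixpoint sumR (n : nat) (f : nat -> R) : R :=
  match n with O => 0 | S n => sumR n f + f n end.

Lemma sumR_S n f : sumR (S n) f = sumR n f + f n.
Proof. reflexivity. Qed.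

Lemma sumR_le n f g : (forall i, (i < n)%nat -> f i <= g i) -> sumR n f <= sumR n g.
Proof.
  induction n as [|n IH]; intros H; simpl; [lra|].
  apply Rplus_le_compat; [apply IH; intros; apply H; lia|apply H; lia].
Qed.

Lemma sumR_abs n f : Rabs (sumR n f) <= sumR n (fun i => Rabs (f i)).
Proof.
  induction n as [|n IH]; simpl; [rewrite Rabs_R0; lra|].
  eapply Rle_trans; [apply Rabs_triang|lra].
Qed.

Lemma sumR_plus n f g : sumR n (fun i => f i + g i) = sumR n f + sumR n g.
Proof. induction n as [|n IH]; simpl; [ring|rewrite IH; ring]. Qed.

Lemma sumR_scal n c f : sumR n (fun i => c * f i) = c * sumR n f.
Proof. induction n as [|n IH]; simpl; [ring|rewrite IH; ring]. Qed.

Lemma sumR_const n c : sumR n (fun _ => c) = INR n * c.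
Proof. induction n as [|n IH]; simpl sumR; [simpl; ring|rewrite IH, S_INR; ring]. Qed.

Lemma sumR_ext n f g : (forall i, f i = g i) -> sumR n f = sumR n g.
Proof. intros H. induction n as [|n IH]; simpl; [reflexivity|rewrite IH, H; reflexivity]. Qed.

Lemma sumR_exchange n m (f : nat -> nat -> R) :
  sumR n (fun i => sumR m (fun j => f i j)) = sumR m (fun j => sumR n (fun i => f i j)).
Proof.
  induction n as [|n IH]; simpl.
  - rewrite (sumR_const m 0). ring.
  - rewrite IH, sumR_plus. reflexivity.
Qed.

Lemma sumR_term n f i : (forall j, 0 <= f j) -> (i < n)%nat -> f i <= sumR n f.
Proof.
  intros Hf. induction n as [|n IH]; intros Hi; [lia|]. simpl.
  assert (P : 0 <= sumR n f).
  { rewrite <- (Rmult_0_r (INR n)), <- sumR_const. apply sumR_le. auto. }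
  destruct (Nat.eq_dec i n) as [->|N]; [lra|].
  assert (f i <= sumR n f) by (apply IH; lia). generalize (Hf n). lra.
Qed.

Definition near_index (c s : R) (j : nat) : R :=
  if Rle_dec (Rabs (INR j - s)) c then 1 else 0.

Lemma near_index_nonneg c s j : 0 <= near_index c s j.
Proof. unfold near_index. destruct Rle_dec; lra. Qed.

Lemma near_index_count (c s : R) (n : nat) : 0 <= c -> sumR n (near_index c s) <= 2 * c + 1.
Proof.
  intros Hc.
  assert (H : sumR n (near_index c s) <= Rmax 0 (Rmin (INR n) (s + c + 1) - (s - c))).
  { induction n as [|n IH]; [apply Rmax_l|].
    simpl sumR. rewrite S_INR. unfold near_index at 2.
    destruct (Rle_dec (Rabs (INR n - s)) c) as [L|L].
    - apply Rabs_le_between in L. unfold Rmax, Rmin in *.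
      repeat destruct Rle_dec; lra.
    - unfold Rmax, Rmin in *. repeat destruct Rle_dec; lra. }
  eapply Rle_trans; [exact H|].
  unfold Rmax, Rmin. repeat destruct Rle_dec; lra.
Qed.

(** The outward flux of [(P, Q)] through the boundary of [[a, b] x [c, d]]. *)
Definition box_flux (P Q : R2 -> R) (a b c d : R) : R :=
  RInt (fun y => P (b, y)) c d - RInt (fun y => P (a, y)) c d
  + (RInt (fun x => Q (x, d)) a b - RInt (fun x => Q (x, c)) a b).

Definition box (a b c d : R) (x : R2) : Prop := a <= fst x <= b /\ c <= snd x <= d.

Lemma is_derive_RInt_upper (f : R -> R) (a t : R) :
  (forall s, continuous f s) -> is_derive (fun t => RInt f a t) t (f t).
Proof.
  intros Hf. apply (is_derive_RInt f (fun t => RInt f a t) a); [|apply Hf].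
  apply filter_forall. intros s. apply RInt_is, Hf.
Qed.

Lemma RInt_parameter_continuous (f : R2 -> R) (c d x : R) :
  c <= d -> (forall z, continuous f z) ->
  continuous (fun x => RInt (fun y => f (x, y)) c d) x.
Proof.
  intros Hcd Hf. apply filterlim_locally. intros eps.
  assert (He : 0 < eps / (d - c + 1)).
  { apply Rdiv_lt_0_compat; [apply cond_pos|lra]. }
  destruct (uniform_in_parameter f c d x _ Hf He) as (e & Hpos & K).
  exists (mkposreal e Hpos). intros t Ht. change (Rabs (t - x) < e) in Ht.
  change (Rabs (RInt (fun y => f (t, y)) c d - RInt (fun y => f (x, y)) c d) < eps).
  rewrite <- (RInt_minus (V := R_CompleteNormedModule));
    try (apply ex_RInt_cont; intros; apply continuous_section_2, Hf).
  apply Rle_lt_trans with ((d - c) * (eps / (d - c + 1))).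
  - apply abs_RInt_le_const; [exact Hcd| |].
    + apply ex_RInt_cont. intros s. apply continuous_minusR; apply continuous_section_2, Hf.
    + intros s Hs. left. apply K; assumption.
  - apply Rlt_le_trans with ((d - c + 1) * (eps / (d - c + 1))).
    + apply Rmult_lt_compat_r; lra.
    + right. field. lra.
Qed.

Section BoxFlux.

Context (P Q : R2 -> R).
Context (HP : forall z, continuous P z) (HQ : forall z, continuous Q z).

Let contP x t : continuous (fun y => P (x, y)) t.
Proof. apply continuous_section_2, HP. Qed.

Let contQ y t : continuous (fun x => Q (x, y)) t.
Proof. apply continuous_section_1, HQ. Qed.

Let intP1 x c d : ex_RInt (fun y => P (x, y)) c d.
Proof. apply ex_RInt_cont, contP. Qed.

Let intQ1 y a b : ex_RInt (fun x => Q (x, y)) a b.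
Proof. apply ex_RInt_cont, contQ. Qed.

Lemma box_flux_split_1 a m b c d :
  box_flux P Q a b c d = box_flux P Q a m c d + box_flux P Q m b c d.
Proof.
  unfold box_flux.
  rewrite <- (RInt_Chasles (fun x => Q (x, d)) a m b) by apply intQ1.
  rewrite <- (RInt_Chasles (fun x => Q (x, c)) a m b) by apply intQ1.
  unfold plus; simpl. ring.
Qed.

Lemma box_flux_split_2 a b c m d :
  box_flux P Q a b c d = box_flux P Q a b c m + box_flux P Q a b m d.
Proof.
  unfold box_flux.
  rewrite <- (RInt_Chasles (fun y => P (b, y)) c m d) by apply intP1.
  rewrite <- (RInt_Chasles (fun y => P (a, y)) c m d) by apply intP1.
  unfold plus; simpl. ring.
Qed.

Lemma box_flux_point_1 a c d : box_flux P Q a a c d = 0.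
Proof. unfold box_flux. rewrite !RInt_point. unfold zero; simpl. ring. Qed.

Lemma box_flux_point_2 a b c : box_flux P Q a b c c = 0.
Proof. unfold box_flux. rewrite !RInt_point. unfold zero; simpl. ring. Qed.

Lemma box_flux_grid_1 (a h c d : R) (n : nat) :
  box_flux P Q a (a + INR n * h) c d
  = sumR n (fun j => box_flux P Q (a + INR j * h) (a + INR (S j) * h) c d).
Proof.
  induction n as [|n IH].
  - simpl. rewrite Rmult_0_l, Rplus_0_r. apply box_flux_point_1.
  - rewrite sumR_S, <- IH. apply box_flux_split_1.
Qed.

Lemma box_flux_grid_2 (a b c h : R) (n : nat) :
  box_flux P Q a b c (c + INR n * h)
  = sumR n (fun j => box_flux P Q a b (c + INR j * h) (c + INR (S j) * h)).
Proof.
  induction n as [|n IH].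
  - simpl. rewrite Rmult_0_l, Rplus_0_r. apply box_flux_point_2.
  - rewrite sumR_S, <- IH. apply box_flux_split_2.
Qed.

Lemma box_flux_bound (a b c d e : R) :
  a <= b -> c <= d -> (forall x, box a b c d x -> Rabs (P x) <= e /\ Rabs (Q x) <= e) ->
  Rabs (box_flux P Q a b c d) <= 2 * ((b - a) + (d - c)) * e.
Proof.
  intros Hab Hcd H. unfold box_flux.
  assert (BP : forall x, a <= x <= b -> Rabs (RInt (fun y => P (x, y)) c d) <= (d - c) * e).
  { intros x Hx. apply abs_RInt_le_const; [exact Hcd|apply intP1|]. intros t Ht. apply H.
    split; assumption. }
  assert (BQ : forall y, c <= y <= d -> Rabs (RInt (fun x => Q (x, y)) a b) <= (b - a) * e).
  { intros y Hy. apply abs_RInt_le_const; [exact Hab|apply intQ1|]. intros t Ht. apply H.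
    split; assumption. }
  assert (B1 := BP b ltac:(lra)). assert (B2 := BP a ltac:(lra)).
  assert (B3 := BQ d ltac:(lra)). assert (B4 := BQ c ltac:(lra)).
  apply Rabs_le_between in B1, B2, B3, B4. apply Rabs_le. lra.
Qed.

(** The divergence theorem on a box, by differentiating the flux with respect
    to the right edge. *)
Lemma box_flux_divergence_free (E : R2 -> Prop) (Px Qy : R2 -> R) (a b c d : R) :
  open E -> a <= b -> c <= d -> (forall x, box a b c d x -> E x) ->
  (forall z, E z -> is_derive (fun s => P (s, snd z)) (fst z) (Px z)) ->
  (forall z, E z -> is_derive (fun s => Q (fst z, s)) (snd z) (Qy z)) ->
  (forall z, E z -> continuous Px z) -> (forall z, E z -> continuous Qy z) ->
  (forall z, E z -> Px z + Qy z = 0) ->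
  box_flux P Q a b c d = 0.
Proof.
  intros HE Hab Hcd Hin HPx HQy CPx CQy Hdiv.
  rewrite <- (box_flux_point_1 a c d). symmetry.
  apply (derive_zero_const (fun t => box_flux P Q a t c d)); [exact Hab| |].
  - intros t Ht. unfold box_flux.
    replace 0 with (RInt (fun y => Px (t, y)) c d - 0 + (Q (t, d) - Q (t, c))).
    + apply is_derive_plusR; apply is_derive_minusR.
      * apply (is_derive_RInt_smooth E P Px a b); auto.
        intros s y Hs Hy. rewrite Rmin_left, Rmax_right in Hy by lra.
        apply Hin. split; simpl; lra.
      * apply @is_derive_const.
      * apply (is_derive_RInt_upper (fun x => Q (x, d))), contQ.
      * apply (is_derive_RInt_upper (fun x => Q (x, c))), contQ.
    + assert (I : is_RInt (fun y => Qy (t, y)) c d (Q (t, d) - Q (t, c))).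
      { apply (is_RInt_derive (fun y => Q (t, y)) (fun y => Qy (t, y))).
        - intros y Hy. rewrite Rmin_left, Rmax_right in Hy by lra.
          apply (HQy (t, y)), Hin. split; simpl; lra.
        - intros y Hy. rewrite Rmin_left, Rmax_right in Hy by lra.
          apply continuous_section_2, CQy, Hin. split; simpl; lra. }
      rewrite <- (is_RInt_unique _ _ _ _ I).
      assert (Ex : RInt (fun y => Px (t, y)) c d = - RInt (fun y => Qy (t, y)) c d).
      { rewrite <- (RInt_opp (V := R_CompleteNormedModule)) by (eexists; exact I).
        apply RInt_ext. intros y Hy. rewrite Rmin_left, Rmax_right in Hy by lra.
        assert (Z := Hdiv (t, y) (Hin (t, y) ltac:(split; simpl; lra))).
        change (Px (t, y) = - Qy (t, y)). lra. }
      rewrite Ex. ring.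
  - intros t _. unfold box_flux.
    assert (C1 := RInt_parameter_continuous P c d t Hcd HP).
    assert (C2 := continuous_of_derive _ _ _ (is_derive_RInt_upper _ a t (contQ d))).
    assert (C3 := continuous_of_derive _ _ _ (is_derive_RInt_upper _ a t (contQ c))). cont.
Qed.

(** A rectifiable curve on which the field vanishes is removable for the
    divergence theorem: of [n^2] cells of side [O(1/n)] only [O(n)] meet the
    curve, and each contributes [o(1/n)]. *)
Lemma box_flux_removable_curve (g1 g2 : R -> R) (T L : R) (a b c d : R) :
  0 < T -> 0 <= L ->
  (forall s t, 0 <= s <= T -> 0 <= t <= T -> Rabs (g1 s - g1 t) <= L * Rabs (s - t)) ->
  (forall s t, 0 <= s <= T -> 0 <= t <= T -> Rabs (g2 s - g2 t) <= L * Rabs (s - t)) ->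
  (forall t, 0 <= t < T -> P (g1 t, g2 t) = 0 /\ Q (g1 t, g2 t) = 0) ->
  (forall a b c d, a <= b -> c <= d ->
     (forall t, 0 <= t < T -> ~ box a b c d (g1 t, g2 t)) -> box_flux P Q a b c d = 0) ->
  a < b -> c < d -> box_flux P Q a b c d = 0.
Proof.
  intros HT HL Lip1 Lip2 Hzero Hoff Hab Hcd.
  (* From one of [n] equidistant parameters to the next the curve moves by at
     most [L * T / n], which is [L * T / (b - a)] cells horizontally; the summand
     one is the width of the cell itself. *)
  set (K1 := 1 + L * T / (b - a)). set (K2 := 1 + L * T / (d - c)).
  assert (HLT : 0 <= L * T) by (apply Rmult_le_pos; lra).
  assert (HK1 : 0 <= K1).
  { assert (0 <= L * T / (b - a)) by (apply Rdiv_le_0_compat; lra). unfold K1; lra. }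
  assert (HK2 : 0 <= K2).
  { assert (0 <= L * T / (d - c)) by (apply Rdiv_le_0_compat; lra). unfold K2; lra. }
  set (A := (2 * K1 + 1) * (2 * K2 + 1) * (2 * ((b - a) + (d - c)))).
  assert (HA : 0 < A).
  { unfold A. repeat apply Rmult_lt_0_compat; lra. }
  apply Rabs_eq_0. apply Rle_antisym; [|apply Rabs_pos].
  apply le_epsilon. intros eps Heps. rewrite Rplus_0_l.
  assert (He : 0 < eps / A) by (apply Rdiv_lt_0_compat; assumption).
  destruct (uniform_continuity_2d (fun x y => P (x, y)) a b c d
    (fun x y _ _ => continuous_2d P x y (HP (x, y))) (mkposreal _ He)) as [d1 Hd1].
  destruct (uniform_continuity_2d (fun x y => Q (x, y)) a b c d
    (fun x y _ _ => continuous_2d Q x y (HQ (x, y))) (mkposreal _ He)) as [d2 Hd2].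
  simpl in Hd1, Hd2.
  set (dm := Rmin d1 d2).
  assert (Hdm : 0 < dm) by (apply Rmin_pos; apply cond_pos).
  destruct (nfloor_ex (((b - a) + (d - c)) / dm)) as [m Hm].
  { apply Rdiv_le_0_compat; lra. }
  set (n := S m).
  assert (Hn : 0 < INR n) by (apply lt_0_INR; unfold n; lia).
  assert (Hnm : (b - a) + (d - c) < INR n * dm).
  { unfold n. rewrite S_INR.
    apply Rle_lt_trans with (((b - a) + (d - c)) / dm * dm); [right; field; lra|].
    apply Rmult_lt_compat_r; lra. }
  set (hx := (b - a) / INR n). set (hy := (d - c) / INR n).
  assert (Hhx : 0 < hx) by (apply Rdiv_lt_0_compat; lra).
  assert (Hhy : 0 < hy) by (apply Rdiv_lt_0_compat; lra).
  assert (Ehx : INR n * hx = b - a) by (unfold hx; field; lra).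
  assert (Ehy : INR n * hy = d - c) by (unfold hy; field; lra).
  assert (Hxd : hx < dm).
  { apply Rmult_lt_reg_l with (INR n); [exact Hn|]. lra. }
  assert (Hyd : hy < dm).
  { apply Rmult_lt_reg_l with (INR n); [exact Hn|]. lra. }
  set (tt := fun i : nat => INR i * (T / INR n)).
  set (s1 := fun i => (g1 (tt i) - a) / hx).
  set (s2 := fun i => (g2 (tt i) - c) / hy).
  set (B := 2 * (hx + hy) * (eps / A)).
  assert (HB : 0 <= B).
  { unfold B. apply Rmult_le_pos; lra. }
  set (cell := fun j k => box_flux P Q (a + INR j * hx) (a + INR (S j) * hx)
                                      (c + INR k * hy) (c + INR (S k) * hy)).
  assert (Ecell : box_flux P Q a b c d = sumR n (fun j => sumR n (fun k => cell j k))).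
  { replace b with (a + INR n * hx) by lra. replace d with (c + INR n * hy) by lra.
    rewrite box_flux_grid_1. apply sumR_ext. intros j. apply box_flux_grid_2. }
  assert (Hcell : forall j k, (j < n)%nat -> (k < n)%nat ->
    Rabs (cell j k) <= sumR n (fun i => B * near_index K1 (s1 i) j * near_index K2 (s2 i) k)).
  { intros j k Hj Hk.
    assert (Hpos : forall i, 0 <= B * near_index K1 (s1 i) j * near_index K2 (s2 i) k).
    { intros i. apply Rmult_le_pos; [apply Rmult_le_pos; [exact HB|]|];
        apply near_index_nonneg. }
    assert (Hj1 : 0 <= INR j * hx) by (apply Rmult_le_pos; [apply pos_INR|lra]).
    assert (Hk1 : 0 <= INR k * hy) by (apply Rmult_le_pos; [apply pos_INR|lra]).
    assert (Hj2 : INR (S j) * hx <= b - a).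
    { rewrite <- Ehx. apply Rmult_le_compat_r; [lra|]. apply le_INR. lia. }
    assert (Hk2 : INR (S k) * hy <= d - c).
    { rewrite <- Ehy. apply Rmult_le_compat_r; [lra|]. apply le_INR. lia. }
    assert (Sj : INR (S j) * hx = INR j * hx + hx) by (rewrite S_INR; ring).
    assert (Sk : INR (S k) * hy = INR k * hy + hy) by (rewrite S_INR; ring).
    destruct (classic (exists t, 0 <= t < T /\
      box (a + INR j * hx) (a + INR (S j) * hx) (c + INR k * hy) (c + INR (S k) * hy)
        (g1 t, g2 t))) as [(t & Ht & Hbox)|Hno].
    - destruct (nfloor_ex (t / (T / INR n))) as [i Hi].
      { apply Rdiv_le_0_compat; [lra|apply Rdiv_lt_0_compat; lra]. }
      assert (HTn : 0 < T / INR n) by (apply Rdiv_lt_0_compat; lra).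
      assert (Et : t = t / (T / INR n) * (T / INR n)) by (field; lra).
      assert (ETn : INR n * (T / INR n) = T) by (field; lra).
      assert (Ht1 : tt i <= t).
      { unfold tt. rewrite Et. apply Rmult_le_compat_r; lra. }
      assert (Ht2 : t <= tt i + T / INR n).
      { unfold tt. rewrite Et at 1.
        apply Rle_trans with ((INR i + 1) * (T / INR n)); [|right; ring].
        apply Rmult_le_compat_r; lra. }
      assert (Hin : (i < n)%nat).
      { apply INR_lt. apply Rmult_lt_reg_r with (T / INR n); [exact HTn|].
        rewrite ETn. unfold tt in Ht1. lra. }
      assert (Hti : 0 <= tt i).
      { unfold tt. apply Rmult_le_pos; [apply pos_INR|lra]. }
      assert (Hdist : Rabs (t - tt i) <= T / INR n) by (rewrite Rabs_pos_eq; lra).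
      assert (Hlip : forall g, (forall s t, 0 <= s <= T -> 0 <= t <= T ->
        Rabs (g s - g t) <= L * Rabs (s - t)) -> Rabs (g t - g (tt i)) <= L * T / INR n).
      { intros g Hg. eapply Rle_trans; [apply Hg; lra|].
        apply Rle_trans with (L * (T / INR n)); [apply Rmult_le_compat_l; lra|].
        right. field. lra. }
      assert (L1 := Hlip g1 Lip1). assert (L2 := Hlip g2 Lip2).
      destruct Hbox as [Hb1 Hb2]. simpl fst in Hb1; simpl snd in Hb2.
      assert (Hidx : forall (g0 o h K g : R) (l : nat), 0 < h -> K * h = h + L * T / INR n ->
        Rabs (g - g0) <= L * T / INR n -> o + INR l * h <= g <= o + INR (S l) * h ->
        near_index K ((g0 - o) / h) l = 1).
      { intros g0 o h K g l Hh EK Hg Hl. rewrite S_INR in Hl.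
        unfold near_index. destruct Rle_dec as [|N]; [reflexivity|]. exfalso. apply N.
        apply Rmult_le_reg_r with h; [exact Hh|].
        rewrite <- (Rabs_pos_eq h) at 2 by lra. rewrite <- Rabs_mult, EK.
        replace ((INR l - (g0 - o) / h) * h) with (INR l * h + o - g0) by (field; lra).
        apply Rabs_le_between in Hg. apply Rabs_le. lra. }
      assert (I1 : near_index K1 (s1 i) j = 1).
      { apply (Hidx _ _ _ _ (g1 t)); [exact Hhx|unfold K1, hx; field; lra|apply L1|exact Hb1]. }
      assert (I2 : near_index K2 (s2 i) k = 1).
      { apply (Hidx _ _ _ _ (g2 t)); [exact Hhy|unfold K2, hy; field; lra|apply L2|exact Hb2]. }
      eapply Rle_trans; [|apply (sumR_term n _ i Hpos Hin)]. cbv beta.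
      rewrite I1, I2, !Rmult_1_r. unfold cell.
      eapply Rle_trans; [apply (box_flux_bound _ _ _ _ (eps / A)); try lra|].
      + intros [x y] [Hx Hy]. simpl fst in Hx; simpl snd in Hy.
        destruct (Hzero t Ht) as [Z1 Z2].
        rewrite <- (Rminus_0_r (P (x, y))), <- (Rminus_0_r (Q (x, y))).
        rewrite <- Z1 at 1. rewrite <- Z2.
        assert (D1 : dm <= d1) by apply Rmin_l. assert (D2 : dm <= d2) by apply Rmin_r.
        split; left; [apply Hd1|apply Hd2]; try lra; apply Rabs_def1; lra.
      + unfold B. right. rewrite Sj, Sk. ring.
    - assert (Z : cell j k = 0).
      { apply Hoff; [lra|lra|]. intros t Ht Hb. apply Hno. exists t. auto. }
      rewrite Z, Rabs_R0. rewrite <- (Rmult_0_r (INR n)), <- sumR_const.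
      apply sumR_le. auto. }
  rewrite Ecell.
  eapply Rle_trans; [apply sumR_abs|].
  apply Rle_trans with (sumR n (fun j => sumR n (fun k =>
    sumR n (fun i => B * near_index K1 (s1 i) j * near_index K2 (s2 i) k)))).
  { apply sumR_le. intros j Hj. eapply Rle_trans; [apply sumR_abs|].
    apply sumR_le. intros k Hk. apply Hcell; assumption. }
  apply Rle_trans with (sumR n (fun _ => B * (2 * K1 + 1) * (2 * K2 + 1))).
  { rewrite (sumR_ext n _ (fun j => sumR n (fun i => sumR n (fun k =>
      B * near_index K1 (s1 i) j * near_index K2 (s2 i) k)))) by (intros; apply sumR_exchange).
    rewrite sumR_exchange. apply sumR_le. intros i _.
    apply Rle_trans with (sumR n (fun j => B * (2 * K2 + 1) * near_index K1 (s1 i) j)).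
    - apply sumR_le. intros j _. rewrite sumR_scal.
      replace (B * (2 * K2 + 1) * near_index K1 (s1 i) j)
        with (B * near_index K1 (s1 i) j * (2 * K2 + 1)) by ring.
      apply Rmult_le_compat_l; [|apply near_index_count; exact HK2].
      apply Rmult_le_pos; [exact HB|apply near_index_nonneg].
    - rewrite sumR_scal.
      replace (B * (2 * K1 + 1) * (2 * K2 + 1)) with (B * (2 * K2 + 1) * (2 * K1 + 1)) by ring.
      apply Rmult_le_compat_l; [|apply near_index_count; exact HK1].
      apply Rmult_le_pos; lra. }
  rewrite sumR_const. right. unfold B.
  transitivity (2 * (INR n * hx + INR n * hy) * (eps / A) * (2 * K1 + 1) * (2 * K2 + 1)).
  - ring.
  - rewrite Ehx, Ehy. transitivity (A * (eps / A)); [unfold A at 2; ring|field; lra].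
Qed.

(** Zero flux through all boxes yields a stream function [psi] with
    [(P, Q) = (d psi / dy, - d psi / dx)], so that the flux through a closed
    curve is the integral of an exact derivative. *)
Lemma circle_flux_zero :
  (forall a b c d, a < b -> c < d -> box_flux P Q a b c d = 0) ->
  forall r t0 : R,
    is_RInt (fun t => r * (P (circle r (t0 + t)) * cos (t0 + t)
                           + Q (circle r (t0 + t)) * sin (t0 + t))) (- PI) PI 0.
Proof.
  intros H r t0.
  assert (Hall : forall a b c d, box_flux P Q a b c d = 0).
  { assert (H1 : forall a b c d, a < b -> box_flux P Q a b c d = 0).
    { intros a b c d Hab. destruct (Rtotal_order c d) as [L|[->|L]].
      - auto.
      - apply box_flux_point_2.
      - generalize (box_flux_split_2 a b c d c) (H a b d c Hab L) (box_flux_point_2 a b c). lra. }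
    intros a b c d. destruct (Rtotal_order a b) as [L|[->|L]].
    - auto.
    - apply box_flux_point_1.
    - generalize (box_flux_split_1 a b a c d) (H1 b a c d L) (box_flux_point_1 a c d). lra. }
  set (psi := fun z : R2 => RInt (fun s => P (0, s)) 0 (snd z) - RInt (fun s => Q (s, snd z)) 0 (fst z)).
  assert (Epsi : forall z, psi z = RInt (fun s => P (fst z, s)) 0 (snd z) - RInt (fun s => Q (s, 0)) 0 (fst z)).
  { intros z. generalize (Hall 0 (fst z) 0 (snd z)). unfold box_flux, psi. lra. }
  assert (Hpsi : has_grad (fun _ => True) psi (fun z => - Q z) P).
  { intros [x y] _. simpl fst; simpl snd. split; [|split; [|split]].
    - unfold psi; simpl fst; simpl snd.
      replace (- Q (x, y)) with (0 - Q (x, y)) by ring.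
      apply is_derive_minusR; [apply @is_derive_const|].
      apply (is_derive_RInt_upper (fun s => Q (s, y))), contQ.
    - apply (is_derive_ext (fun t => RInt (fun s => P (x, s)) 0 t - RInt (fun s => Q (s, 0)) 0 x)).
      { intros t. symmetry. apply (Epsi (x, t)). }
      replace (P (x, y)) with (P (x, y) - 0) by ring.
      apply is_derive_minusR; [|apply @is_derive_const].
      apply (is_derive_RInt_upper (fun s => P (x, s))), contP.
    - apply continuous_oppR, HQ.
    - apply HP. }
  set (F := fun t => psi (circle r (t0 + t))).
  assert (HF : forall t, is_derive F t (r * (P (circle r (t0 + t)) * cos (t0 + t)
                           + Q (circle r (t0 + t)) * sin (t0 + t)))).
  { intros t.
    replace (r * (P (circle r (t0 + t)) * cos (t0 + t)
                           + Q (circle r (t0 + t)) * sin (t0 + t)))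
      with (- Q (circle r (t0 + t)) * (r * - sin (t0 + t))
            + P (circle r (t0 + t)) * (r * cos (t0 + t))) by ring.
    apply (grad_chain (fun _ => True) psi (fun z => - Q z) P
      (fun t => 0 + r * cos (t0 + t)) (fun t => 0 + r * sin (t0 + t))); auto.
    - apply open_true.
    - auto_derive; [exact I|ring].
    - auto_derive; [exact I|ring]. }
  assert (Z : minus (F PI) (F (- PI)) = 0).
  { unfold F. rewrite polar_periodic. apply (plus_opp_r (G := R_AbelianGroup)). }
  match goal with |- is_RInt ?f _ _ _ => enough (I0 : is_RInt f (- PI) PI
    (minus (F PI) (F (- PI)))) by (rewrite Z in I0; exact I0) end.
  apply (is_RInt_derive F); [intros; apply HF|]. intros t _.
  assert (C := radial_continuous_t P Q (0, 0) t0 r (fun _ => HP _) (fun _ => HQ _) t).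
  unfold radial in C. cont.
Qed.

End BoxFlux.

(** * Decay of radiating solutions of the modified equation *)

Definition lin (al be : R) (u v : R2 -> R) (x : R2) : R := al * u x + be * v x.

Lemma has_grad_lin E al be u p q u' p' q' :
  has_grad E u p q -> has_grad E u' p' q' ->
  has_grad E (lin al be u u') (lin al be p p') (lin al be q q').
Proof.
  intros H H' x Hx. destruct (H x Hx) as (A & B & C & F).
  destruct (H' x Hx) as (A' & B' & C' & F'). unfold lin.
  split; [|split; [|split]].
  - apply is_derive_plusR; apply is_derive_scal; assumption.
  - apply is_derive_plusR; apply is_derive_scal; assumption.
  - cont.
  - cont.
Qed.

Lemma has_grad_mult E u p q u' p' q' : open E ->
  has_grad E u p q -> has_grad E u' p' q' ->
  has_grad E (fun x => u x * u' x) (fun x => p x * u' x + u x * p' x)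
    (fun x => q x * u' x + u x * q' x).
Proof.
  intros HE H H' x Hx.
  assert (Cu := grad_continuous E u p q x HE H Hx).
  assert (Cu' := grad_continuous E u' p' q' x HE H' Hx).
  destruct (H x Hx) as (A & B & C & F). destruct (H' x Hx) as (A' & B' & C' & F').
  split; [|split; [|split]]; [| |cont|cont]; destruct x as [x1 x2].
  - apply (is_derive_multR (fun t => u (t, x2)) (fun t => u' (t, x2)) x1 _ _ A A').
  - apply (is_derive_multR (fun t => u (x1, t)) (fun t => u' (x1, t)) x2 _ _ B B').
Qed.

Lemma eigenfunction_lin E c al be u p q u' p' q' :
  eigenfunction E c u p q -> eigenfunction E c u' p' q' ->
  eigenfunction E c (lin al be u u') (lin al be p p') (lin al be q q').
Proof.
  intros (xx & xy & yx & yy & H1 & H2 & H3 & H4) (xx' & xy' & yx' & yy' & H1' & H2' & H3' & H4').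
  exists (lin al be xx xx'), (lin al be xy xy'), (lin al be yx yx'), (lin al be yy yy').
  split; [|split; [|split]]; try (apply has_grad_lin; assumption).
  intros x Hx. unfold lin. generalize (H4 x Hx) (H4' x Hx). intros A B.
  transitivity (al * (xx x + yy x) + be * (xx' x + yy' x)); [ring|]. rewrite A, B. ring.
Qed.

Definition sqnorm (x : R2) : R := fst x ^ 2 + snd x ^ 2.

Lemma sqnorm_polar r t : sqnorm (circle r t) = r ^ 2.
Proof.
  unfold sqnorm, polar; simpl fst; simpl snd.
  generalize (sin2_cos2 t). unfold Rsqr. intros. nra.
Qed.

Lemma sqnorm_continuous x : continuous sqnorm x.
Proof. unfold sqnorm. cont. Qed.

Lemma sqnorm_dist2 x : sqnorm x = dist2 (0, 0) x ^ 2.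
Proof. rewrite dist2_sqr. unfold sqnorm; simpl fst; simpl snd. rewrite !Rminus_0_r. reflexivity. Qed.

Lemma sqnorm_far (P : R2 -> Prop) (r0 : R) : 0 <= r0 ->
  (forall r t, r0 < r -> P (circle r t)) -> forall x, r0 ^ 2 < sqnorm x -> P x.
Proof.
  intros Hr0 H x Hx. destruct (polar_exists (0, 0) x) as [t Ht]. rewrite Ht. apply H.
  rewrite sqnorm_dist2 in Hx. assert (N := dist2_nonneg (0, 0) x). nra.
Qed.

Lemma barrier_derive (f : R -> R) (t f' c C eps : R) :
  0 < t ^ 2 + c -> is_derive f t f' ->
  is_derive (fun t => f t - C * / (t ^ 2 + c) - eps * (t ^ 2 + c)) t
    (f' + C * (2 * t) / (t ^ 2 + c) ^ 2 - eps * (2 * t)).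
Proof.
  intros Hpos D. derive. field. simpl in *; lra.
Qed.

Lemma barrier_derive2 (f : R -> R) (t f' c C eps : R) :
  0 < t ^ 2 + c -> is_derive f t f' ->
  is_derive (fun t => f t + C * (2 * t) / (t ^ 2 + c) ^ 2 - eps * (2 * t)) t
    (f' + C * (2 / (t ^ 2 + c) ^ 2 - 8 * t ^ 2 / (t ^ 2 + c) ^ 3) - eps * 2).
Proof.
  intros Hpos D. derive. field. simpl in *; nra.
Qed.

(** Comparison with [C / r^2 + eps r^2], a supersolution far out since
    [Delta r^(-2) = 4 r^(-4)] and [Delta r^2 = 4]. *)
Lemma modified_solution_bound (E : R2 -> Prop) (k r1 M : R) (p px py : R2 -> R) :
  0 < k -> 1 <= r1 -> 4 <= k ^ 2 * r1 ^ 2 -> 0 <= M ->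
  eigenfunction E (k ^ 2) p px py ->
  open E -> (forall x, r1 ^ 2 <= sqnorm x -> E x) ->
  (forall r t, r1 <= r -> p (circle r t) <= M * r) ->
  forall x, r1 ^ 2 < sqnorm x -> p x <= M * r1 ^ 3 / sqnorm x.
Proof.
  intros Hk Hr1 Hkr HM (pxx & pxy & pyx & pyy & Hp & Hpx & Hpy & Heq) HE Hin Hgrow x Hx.
  assert (Hr2 : 1 <= r1 ^ 2) by nra.
  assert (Hgrow' : forall y, r1 ^ 2 <= sqnorm y -> p y <= M * sqrt (sqnorm y)).
  { intros y Hy. destruct (polar_exists (0, 0) y) as [t Ht].
    assert (Ed : dist2 (0, 0) y = sqrt (sqnorm y)).
    { rewrite sqnorm_dist2. symmetry. apply sqrt_pow2, dist2_nonneg. }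
    rewrite Ed in Ht. rewrite Ht at 1. apply Hgrow.
    rewrite <- (sqrt_pow2 r1) by lra. apply sqrt_le_1_alt. exact Hy. }
  set (C := M * r1 ^ 3).
  assert (HC : 0 <= C) by (apply Rmult_le_pos; [lra|apply pow_le; lra]).
  apply le_epsilon. intros e0 He0.
  set (eps := e0 / sqnorm x).
  assert (Heps : 0 < eps) by (apply Rdiv_lt_0_compat; lra).
  set (w := fun z => p z - C * / sqnorm z - eps * sqnorm z).
  assert (Hpos : forall z, r1 ^ 2 < sqnorm z -> 0 < sqnorm z) by (intros; lra).
  assert (Cw : forall z, r1 ^ 2 <= sqnorm z -> continuous w z).
  { intros z Hz.
    assert (C1 := continuous_invR sqnorm z ltac:(lra) (sqnorm_continuous z)).
    assert (C2 := sqnorm_continuous z).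
    assert (C3 : continuous p z) by (apply (grad_continuous E p px py); auto).
    unfold w. cont. }
  assert (Hw : w x <= 0).
  { apply (maximum_principle (fun z => r1 ^ 2 < sqnorm z) w
      (fun z => px z + C * (2 * fst z) / sqnorm z ^ 2 - eps * (2 * fst z))
      (fun z => py z + C * (2 * snd z) / sqnorm z ^ 2 - eps * (2 * snd z))
      (fun z => pxx z + C * (2 / sqnorm z ^ 2 - 8 * fst z ^ 2 / sqnorm z ^ 3) - eps * 2)
      (fun z => pyy z + C * (2 / sqnorm z ^ 2 - 8 * snd z ^ 2 / sqnorm z ^ 3) - eps * 2));
      [| | | | | | | | |exact Hx].
    - intros z Hz. apply (continuous_gt sqnorm); [apply sqnorm_continuous|exact Hz].
    - intros z Hz. apply Cw. lra.
    - intros [x1 x2] Hz. apply (barrier_derive (fun t => p (t, x2))); [exact (Hpos _ Hz)|].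
      apply (Hp (x1, x2)), Hin. lra.
    - intros [x1 x2] Hz. unfold w, sqnorm. cbn [fst snd]. rewrite (Rplus_comm (x1 ^ 2)).
      apply (is_derive_ext (fun t => p (x1, t) - C * / (t ^ 2 + x1 ^ 2) - eps * (t ^ 2 + x1 ^ 2))).
      { intros t. rewrite (Rplus_comm (t ^ 2)). reflexivity. }
      apply barrier_derive; [rewrite Rplus_comm; exact (Hpos _ Hz)|].
      apply (Hp (x1, x2)), Hin. lra.
    - intros [x1 x2] Hz. apply (barrier_derive2 (fun t => px (t, x2))); [exact (Hpos _ Hz)|].
      apply (Hpx (x1, x2)), Hin. lra.
    - intros [x1 x2] Hz. unfold sqnorm. cbn [fst snd]. rewrite (Rplus_comm (x1 ^ 2)).
      apply (is_derive_ext (fun t => py (x1, t) + C * (2 * t) / (t ^ 2 + x1 ^ 2) ^ 2 - eps * (2 * t))).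
      { intros t. rewrite (Rplus_comm (t ^ 2)). reflexivity. }
      apply barrier_derive2; [rewrite Rplus_comm; exact (Hpos _ Hz)|].
      apply (Hpy (x1, x2)), Hin. lra.
    - intros z Hz Hwz. unfold w in Hwz.
      assert (Hz0 : 0 < sqnorm z) by lra.
      assert (E1 : pxx z + C * (2 / sqnorm z ^ 2 - 8 * fst z ^ 2 / sqnorm z ^ 3) - eps * 2
        + (pyy z + C * (2 / sqnorm z ^ 2 - 8 * snd z ^ 2 / sqnorm z ^ 3) - eps * 2)
        = k ^ 2 * p z - 4 * C / sqnorm z ^ 2 - 4 * eps).
      { rewrite <- (Heq z) by (apply Hin; lra).
        transitivity (pxx z + pyy z + C * (4 / sqnorm z ^ 2
          - 8 * (fst z ^ 2 + snd z ^ 2) / sqnorm z ^ 3) - 4 * eps); [field; lra|].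
        fold (sqnorm z). field. lra. }
      rewrite E1.
      assert (K : 4 <= k ^ 2 * sqnorm z).
      { eapply Rle_trans; [exact Hkr|]. apply Rmult_le_compat_l; [apply pow2_ge_0|lra]. }
      assert (Hk2 : 0 < k ^ 2) by (apply pow_lt, Hk).
      assert (F1 : 4 * C / sqnorm z ^ 2 <= k ^ 2 * (C * / sqnorm z)).
      { replace (4 * C / sqnorm z ^ 2) with (4 * (C * (/ sqnorm z ^ 2))) by (field; lra).
        replace (k ^ 2 * (C * / sqnorm z)) with (k ^ 2 * sqnorm z * (C * / sqnorm z ^ 2))
          by (field; lra).
        apply Rmult_le_compat_r; [|exact K].
        apply Rmult_le_pos; [exact HC|]. left. apply Rinv_0_lt_compat, pow_lt, Hz0. }
      assert (F2 : 4 * eps <= k ^ 2 * (eps * sqnorm z)).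
      { replace (k ^ 2 * (eps * sqnorm z)) with (k ^ 2 * sqnorm z * eps) by ring.
        apply Rmult_le_compat_r; lra. }
      assert (F3 : k ^ 2 * (C * / sqnorm z + eps * sqnorm z) < k ^ 2 * p z).
      { apply Rmult_lt_compat_l; lra. }
      lra.
    - intros z eta Hz Heta. apply Rnot_lt_le in Hz.
      destruct (Rle_lt_or_eq_dec _ _ Hz) as [L|L].
      + generalize (continuous_lt sqnorm z _ (sqnorm_continuous z) L).
        apply filter_imp. intros y Hy Hy'. lra.
      + assert (Hwz : w z < eta).
        { unfold w. rewrite L. assert (G := Hgrow' z ltac:(lra)).
          rewrite L, sqrt_pow2 in G by lra.
          replace (C * / r1 ^ 2) with (M * r1) by (unfold C; field; lra).
          assert (0 < eps * r1 ^ 2) by (apply Rmult_lt_0_compat; lra). lra. }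
        generalize (continuous_lt w z _ (Cw z ltac:(lra)) Hwz). apply filter_imp. auto.
    - intros eta Heta. exists (M / eps). intros z Hz Hwz.
      assert (Hz0 : 0 < sqnorm z) by lra.
      set (s := sqrt (sqnorm z)).
      assert (Hs2 : s ^ 2 = sqnorm z).
      { unfold s. rewrite <- Rsqr_pow2. apply Rsqr_sqrt. lra. }
      assert (Hs0 : 0 <= s) by apply sqrt_pos.
      assert (Hsb : s <= M / eps).
      { assert (G := Hgrow' z ltac:(lra)). fold s in G.
        assert (0 <= C * / sqnorm z).
        { apply Rmult_le_pos; [exact HC|]. left. apply Rinv_0_lt_compat, Hz0. }
        assert (eps * s ^ 2 < M * s) by (unfold w in Hwz; rewrite Hs2; lra).
        assert (0 < s) by (apply sqrt_lt_R0; exact Hz0).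
        assert (eps * s < M).
        { apply Rmult_lt_reg_r with s; [assumption|]. nra. }
        apply Rmult_le_reg_l with eps; [exact Heps|].
        replace (eps * (M / eps)) with M by (field; lra). lra. }
      assert (Hc : forall y, y ^ 2 <= s ^ 2 -> Rabs y <= M / eps).
      { intros y Hy. apply Rle_trans with s.
        - rewrite <- (Rabs_pos_eq s Hs0). apply Rsqr_le_abs_0. rewrite !Rsqr_pow2. exact Hy.
        - exact Hsb. }
      split; apply Hc; rewrite Hs2; unfold sqnorm.
      + generalize (pow2_ge_0 (snd z)). lra.
      + generalize (pow2_ge_0 (fst z)). lra. }
  unfold w in Hw. fold C. unfold Rdiv.
  assert (eps * sqnorm x = e0) by (unfold eps; field; lra). lra.
Qed.

(** [u + i v] satisfies Sommerfeld's radiation condition. *)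
Definition radiates (k : R) (u ux uy v vx vy : R2 -> R) : Prop :=
  forall eps, 0 < eps -> exists r0, forall r t, r0 < r ->
    Rabs (sqrt r * (radial ux uy (0, 0) r t + k * v (circle r t))) < eps /\
    Rabs (sqrt r * (radial vx vy (0, 0) r t - k * u (circle r t))) < eps.

Lemma sqrt_ge_1 r : 1 <= r -> 1 <= sqrt r.
Proof. intros H. rewrite <- sqrt_1. apply sqrt_le_1_alt, H. Qed.

Lemma radial_derive (E : R2 -> Prop) (u ux uy : R2 -> R) (r t : R) :
  open E -> has_grad E u ux uy -> E (circle r t) ->
  is_derive (fun s => u (circle s t)) r (radial ux uy (0, 0) r t).
Proof.
  intros HE Hu Hx. unfold radial, polar.
  apply (grad_chain E u ux uy (fun s => fst (0, 0) + s * cos t)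
    (fun s => snd (0, 0) + s * sin t)); [exact HE|exact Hu|exact Hx| |];
    simpl; auto_derive; trivial; ring.
Qed.

(** Along a ray [(p^2 + q^2)' = 2 p (p' + k q) + 2 q (q' - k p)], so the
    radiation condition alone bounds the growth. *)
Lemma radiating_linear_growth (E : R2 -> Prop) (k R0 : R) (p px py q qx qy : R2 -> R) :
  open E -> has_grad E p px py -> has_grad E q qx qy ->
  (forall r t, R0 < r -> E (circle r t)) ->
  radiates k p px py q qx qy ->
  exists r1 M, R0 < r1 /\ 0 <= M /\ forall r t, r1 <= r ->
    Rabs (p (circle r t)) <= M * r /\ Rabs (q (circle r t)) <= M * r.
Proof.
  intros HE Hp Hq Hin Hrad.
  destruct (Hrad 1 Rlt_0_1) as [r0 Hr0].
  destruct (ex_large R0 r0 1 1) as (r1 & Hr1).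
  set (W := fun r t => sqrt (1 + (p (circle r t) * p (circle r t)
                                  + q (circle r t) * q (circle r t)))).
  assert (Wp : forall r t, p (circle r t) ^ 2 + q (circle r t) ^ 2 <= W r t ^ 2
                           /\ 1 <= W r t).
  { intros r t. unfold W.
    assert (S : 0 <= p (circle r t) * p (circle r t)
      + q (circle r t) * q (circle r t)) by nra.
    split.
    - rewrite <- (Rsqr_pow2 (sqrt _)), Rsqr_sqrt by lra. nra.
    - apply sqrt_ge_1. lra. }
  assert (Wb : forall r t, Rabs (p (circle r t)) <= W r t
                        /\ Rabs (q (circle r t)) <= W r t).
  { intros r t. destruct (Wp r t) as [A B].
    assert (K : forall y, y ^ 2 <= W r t ^ 2 -> Rabs y <= W r t).
    { intros y Hy. rewrite <- (Rabs_pos_eq (W r t)) by lra.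
      apply Rsqr_le_abs_0. rewrite !Rsqr_pow2. exact Hy. }
    generalize (pow2_ge_0 (p (circle r t))) (pow2_ge_0 (q (circle r t))).
    intros P1 P2. split; apply K; lra. }
  assert (Hgrow : forall r t, r1 <= r -> W r t - 2 * r <= W r1 t - 2 * r1).
  { intros r t Hr.
    apply (nonincreasing_of_derive (fun r => W r t - 2 * r)
      (fun r => (p (circle r t) * radial px py (0, 0) r t
                 + q (circle r t) * radial qx qy (0, 0) r t) / W r t - 2) r1 r Hr).
    - intros s Hs.
      assert (D1 := radial_derive E p px py s t HE Hp (Hin s t ltac:(lra))).
      assert (D2 := radial_derive E q qx qy s t HE Hq (Hin s t ltac:(lra))).
      destruct (Wp s t) as [_ W1]. unfold W in W1 |- *.
      set (f := fun s => p (circle s t)) in *.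
      set (g := fun s => q (circle s t)) in *.
      change (p (circle s t)) with (f s) in *.
      change (q (circle s t)) with (g s) in *.
      apply (is_derive_ext (fun r => sqrt (1 + (f r * f r + g r * g r)) - 2 * r)); [reflexivity|].
      assert (0 < 1 + (f s * f s + g s * g s)) by nra.
      derive. field. lra.
    - intros s Hs. destruct (Wp s t) as [_ W1]. destruct (Wb s t) as [B1 B2].
      destruct (Hr0 s t ltac:(lra)) as [R1 R2].
      assert (Hsq : 1 <= sqrt s) by (apply sqrt_ge_1; lra).
      set (P := p (circle s t)) in *. set (Q := q (circle s t)) in *.
      set (dp := radial px py (0, 0) s t) in *. set (dq := radial qx qy (0, 0) s t) in *.
      rewrite Rabs_mult, (Rabs_pos_eq (sqrt s)) in R1, R2 by lra.
      assert (A1 : Rabs (dp + k * Q) <= 1).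
      { generalize (Rabs_pos (dp + k * Q)). nra. }
      assert (A2 : Rabs (dq - k * P) <= 1).
      { generalize (Rabs_pos (dq - k * P)). nra. }
      assert (E1 : P * dp + Q * dq = P * (dp + k * Q) + Q * (dq - k * P)) by ring.
      assert (E2 : P * dp + Q * dq <= 2 * W s t).
      { rewrite E1. eapply Rle_trans; [apply Rle_abs|].
        eapply Rle_trans; [apply Rabs_triang|]. rewrite !Rabs_mult.
        generalize (Rabs_pos P) (Rabs_pos Q) (Rabs_pos (dp + k * Q)) (Rabs_pos (dq - k * P)).
        nra. }
      assert ((P * dp + Q * dq) / W s t <= 2); [|lra].
      apply Rmult_le_reg_r with (W s t); [lra|].
      unfold Rdiv. rewrite Rmult_assoc, Rinv_l, Rmult_1_r by lra. exact E2. }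
  assert (CW : forall t, continuous (fun t => W r1 t) t).
  { assert (Cc : forall (v vx vy : R2 -> R) t, has_grad E v vx vy ->
      continuous (fun t => v (circle r1 t)) t).
    { intros v vx vy t Hv.
      apply (continuous_ext (fun s => v (circle r1 (0 + s)))).
      { intros s. rewrite Rplus_0_l. reflexivity. }
      apply (polar_continuous_t v (0, 0) 0 r1). intros s.
      apply (grad_continuous E v vx vy); auto. apply Hin. lra. }
    intros t. assert (C1 := Cc p px py t Hp). assert (C2 := Cc q qx qy t Hq). unfold W.
    apply (continuous_comp (fun t => 1 + (p (circle r1 t) * p (circle r1 t)
      + q (circle r1 t) * q (circle r1 t))) sqrt); [cont|apply continuous_sqrt]. }
  destruct (continuity_ab_maj (fun t => W r1 t) (- PI) PI) as [tm [Hm _]].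
  { generalize PI_RGT_0. lra. }
  { intros t _. apply continuous_pt, CW. }
  assert (Hper : forall t, exists t', - PI <= t' <= PI /\
    forall r, circle r t = circle r t').
  { intros t. destruct (unit_vector_angle (cos t) (sin t)) as (t' & Ht' & E1 & E2).
    - generalize (sin2_cos2 t). unfold Rsqr. lra.
    - exists t'. split; [exact Ht'|]. intros r. unfold polar. rewrite E1, E2. reflexivity. }
  exists r1, (Rabs (W r1 tm) + 2). split; [apply Hr1|].
  assert (HM := Rabs_pos (W r1 tm)). split; [lra|]. intros r t Hr.
  destruct (Hper t) as (t' & Ht' & Ept). rewrite Ept.
  destruct (Wb r t') as [B1 B2]. assert (G := Hgrow r t' Hr).
  assert (H1 := Hm t' Ht'). assert (H2 := Rle_abs (W r1 tm)).
  assert (W r t' <= (Rabs (W r1 tm) + 2) * r) by nra.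
  split; lra.
Qed.

(** The linear bound excludes the exponentially growing solutions; the
    comparison applies to [p], [- p], [q] and [- q]. *)
Lemma modified_radiating_decay (E : R2 -> Prop) (k R0 : R) (p px py q qx qy : R2 -> R) :
  0 < k -> 0 <= R0 -> open E ->
  eigenfunction E (k ^ 2) p px py -> eigenfunction E (k ^ 2) q qx qy ->
  (forall r t, R0 < r -> E (circle r t)) ->
  radiates k p px py q qx qy ->
  exists C r2, 0 <= C /\ 1 <= r2 /\ R0 <= r2 /\ forall x, r2 ^ 2 < sqnorm x ->
    Rabs (p x) <= C / sqnorm x /\ Rabs (q x) <= C / sqnorm x.
Proof.
  intros Hk HR0 HE Hp Hq Hin Hrad.
  destruct (radiating_linear_growth E k R0 p px py q qx qy HE
    (eigenfunction_grad _ _ _ _ _ Hp) (eigenfunction_grad _ _ _ _ _ Hq) Hin Hrad)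
    as (r1 & M & Hr1 & HM & Hgrow).
  destruct (ex_large r1 1 (2 / k) 1) as (r2 & Hr2).
  assert (Hkr : 4 <= k ^ 2 * r2 ^ 2).
  { assert (2 <= k * r2).
    { apply Rle_trans with (k * (2 / k)); [right; field; lra|].
      apply Rmult_le_compat_l; lra. }
    replace (k ^ 2 * r2 ^ 2) with ((k * r2) ^ 2) by ring. nra. }
  assert (HinE : forall x, r2 ^ 2 <= sqnorm x -> E x).
  { intros x Hx. apply (sqnorm_far E R0 HR0 Hin). nra. }
  assert (Hopp : forall u ux uy, eigenfunction E (k ^ 2) u ux uy ->
    eigenfunction E (k ^ 2) (lin (-1) 0 u u) (lin (-1) 0 ux ux) (lin (-1) 0 uy uy)).
  { intros. apply eigenfunction_lin; assumption. }
  assert (Hone : forall u ux uy, eigenfunction E (k ^ 2) u ux uy ->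
    (forall r t, r1 <= r -> Rabs (u (circle r t)) <= M * r) ->
    forall x, r2 ^ 2 < sqnorm x -> Rabs (u x) <= M * r2 ^ 3 / sqnorm x).
  { intros u ux uy Hu Hg x Hx. apply Rabs_le. split.
    - assert (B := modified_solution_bound E k r2 M _ _ _ Hk ltac:(lra) Hkr HM (Hopp _ _ _ Hu)
        HE HinE).
      assert (K : lin (-1) 0 u u x <= M * r2 ^ 3 / sqnorm x).
      { apply B; [|exact Hx]. intros r t Hr. unfold lin.
        generalize (Hg r t ltac:(lra)). intros A. apply Rabs_le_between in A. lra. }
      unfold lin in K. lra.
    - apply (modified_solution_bound E k r2 M u ux uy); auto; try lra.
      intros r t Hr. eapply Rle_trans; [apply Rle_abs|]. apply Hg. lra. }
  exists (M * r2 ^ 3), r2. split; [apply Rmult_le_pos; [lra|apply pow_le; lra]|].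
  split; [lra|]. split; [lra|].
  intros x Hx. split.
  - apply (Hone p px py); auto. intros; apply Hgrow; assumption.
  - apply (Hone q qx qy); auto. intros; apply Hgrow; assumption.
Qed.

(** * The boundary curve and the exterior domain *)

Lemma real_analytic_derive_series (f : R -> R) (t0 : R) : real_analytic f ->
  exists (a : nat -> R) (e : R), 0 < e /\ Rbar_lt 0 (CV_radius a) /\
    forall s, Rabs (s - t0) < e -> is_derive f s (PSeries (PS_derive a) (s - t0)).
Proof.
  intros H. destruct (H t0) as [a [e He]].
  assert (P := cond_pos e).
  assert (HR : Rbar_le (e / 2) (CV_radius a)).
  { apply Rbar_not_lt_le. intros L.
    assert (Hs : is_pseries a (e / 2) (f (t0 + e / 2))).
    { replace (e / 2) with (t0 + e / 2 - t0) at 1 by ring. apply He. in_ball. }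
    apply (CV_disk_outside a (e / 2)).
    - rewrite Rabs_pos_eq by lra. exact L.
    - apply ex_series_lim_0. eexists. apply is_pseries_R. exact Hs. }
  assert (He2 : 0 < e / 2) by lra.
  exists a, (e / 2). split; [exact He2|].
  split; [exact (Rbar_lt_le_trans 0 (e / 2) _ He2 HR)|]. intros s Hs.
  apply is_derive_ext_loc with (fun t => PSeries a (t - t0)).
  - generalize (locally_Rabs s (e / 2) He2). apply filter_imp. intros r Hr.
    apply is_pseries_unique, He. change (Rabs (r - t0) < e).
    apply Rabs_def2 in Hs, Hr. apply Rabs_def1; lra.
  - replace (PSeries (PS_derive a) (s - t0)) with (scal 1 (PSeries (PS_derive a) (s - t0)))
      by apply Rmult_1_l.
    apply (is_derive_comp (PSeries a) (fun t => t - t0)); [|auto_derive; [exact I|ring]].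
    apply is_derive_PSeries. exact (Rbar_lt_le_trans (Rabs (s - t0)) (e / 2) _ Hs HR).
Qed.

Lemma real_analytic_derive (f : R -> R) (t0 : R) :
  real_analytic f -> is_derive f t0 (Derive f t0).
Proof.
  intros H. destruct (real_analytic_derive_series f t0 H) as (a & e & He & _ & Hd).
  apply Derive_correct. eexists. apply Hd. rewrite Rminus_diag, Rabs_R0. exact He.
Qed.

Lemma real_analytic_derive_continuous (f : R -> R) (t0 : R) :
  real_analytic f -> continuous (Derive f) t0.
Proof.
  intros H. destruct (real_analytic_derive_series f t0 H) as (a & e & He & HR & Hd).
  apply continuous_ext_loc with (fun t => PSeries (PS_derive a) (t - t0)).
  - generalize (locally_Rabs t0 e He). apply filter_imp. intros s Hs.
    symmetry. apply is_derive_unique, Hd, Hs.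
  - apply (continuous_comp (fun t => t - t0) (PSeries (PS_derive a))); [cont|].
    apply continuity_pt_filterlim, PSeries_continuity.
    rewrite CV_radius_derive, Rminus_diag, Rabs_R0. exact HR.
Qed.

Lemma closure_open_compl (A : R2 -> Prop) : open (fun x => ~ closure A x).
Proof.
  intros x Hx. unfold closure in Hx.
  apply not_all_ex_not in Hx. destruct Hx as [P HP].
  apply imply_to_and in HP. destruct HP as [HP Hn].
  generalize (locally_locally _ _ HP). apply filter_imp.
  intros y Hy Hc. destruct (Hc P Hy) as [w Hw]. apply Hn. exists w. exact Hw.
Qed.

Lemma closure_incl (A : R2 -> Prop) (x : R2) : A x -> closure A x.
Proof. intros H P HP. exists x. split; [exact H|exact (locally_singleton _ P HP)]. Qed.

Lemma unit_components (n : R2) : dot n n = 1 -> Rabs (fst n) <= 1 /\ Rabs (snd n) <= 1.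
Proof.
  unfold dot. destruct n as [x y]; simpl. intros H.
  generalize (Rle_0_sqr x) (Rle_0_sqr y). unfold Rsqr. intros Hx Hy.
  split; apply Rabs_le; split; nra.
Qed.

Lemma orthogonal_to_unit (n t : R2) : dot n n = 1 -> dot n t = 0 ->
  exists la, fst t = - snd n * la /\ snd t = fst n * la.
Proof.
  destruct n as [n1 n2], t as [t1 t2]. unfold dot; simpl. intros Hn Ht.
  exists (n1 * t2 - n2 * t1). split.
  - transitivity (t1 * (n1 * n1 + n2 * n2) - n1 * (n1 * t1 + n2 * t2));
      [rewrite Hn, Ht; ring|ring].
  - transitivity (t2 * (n1 * n1 + n2 * n2) - n2 * (n1 * t1 + n2 * t2));
      [rewrite Hn, Ht; ring|ring].
Qed.

Definition displace (z : R2) (s : R) (e : R2) : R2 := (fst z + s * fst e, snd z + s * snd e).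

Lemma displace_near (z n : R2) (s e : R) : dot n n = 1 -> 0 <= s < e ->
  Rabs (fst (displace z s n) - fst z) < e /\ Rabs (snd (displace z s n) - snd z) < e.
Proof.
  intros Hn Hs. destruct (unit_components n Hn) as [N1 N2]. unfold displace; simpl.
  replace (fst z + s * fst n - fst z) with (s * fst n) by ring.
  replace (snd z + s * snd n - snd z) with (s * snd n) by ring.
  rewrite !Rabs_mult, (Rabs_pos_eq s) by lra. split; nra.
Qed.

Definition real_linear_part (part : C -> R) : Prop := part = Re \/ part = Im.

Section Part.

Context (part : C -> R) (Hpart : real_linear_part part).

Lemma part_plus z w : part (z + w)%C = part z + part w.
Proof. destruct Hpart as [-> | ->]; reflexivity. Qed.

Lemma part_scal r z : part (RtoC r * z)%C = r * part z.
Proof. destruct Hpart as [-> | ->]; destruct z; simpl; ring. Qed.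

Lemma part_ball (z w : C) (eps : R) : @ball (prod_UniformSpace R_UniformSpace R_UniformSpace) z eps w ->
  ball (part z) eps (part w).
Proof. intros [H1 H2]. destruct Hpart as [-> | ->]; assumption. Qed.

Lemma part_filterlim {U : Type} (F : (U -> Prop) -> Prop) (HF : Filter F) (g : U -> C) (l : C) :
  filterlim g F (locally l) -> filterlim (fun y => part (g y)) F (locally (part l)).
Proof.
  intros H. apply filterlim_locally. intros eps.
  assert (K := proj1 (filterlim_locally g l) H eps).
  revert K. apply filter_imp. intros y Hy. apply part_ball. exact Hy.
Qed.

Lemma part_has_grad (E : R2 -> Prop) (v : R2 -> C) :
  C1_on E v -> has_grad E (fun x => part (v x)) (fun x => part (d1 v x)) (fun x => part (d2 v x)).
Proof.
  intros Hv x Hx. destruct (Hv x Hx) as ([H1 H2] & [H3 H4] & H5 & H6).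
  split; [|split; [|split]].
  - destruct Hpart as [-> | ->]; apply Derive_correct; assumption.
  - destruct Hpart as [-> | ->]; apply Derive_correct; assumption.
  - apply part_filterlim; [apply locally_filter|exact H5].
  - apply part_filterlim; [apply locally_filter|exact H6].
Qed.

Lemma part_eigenfunction (E : R2 -> Prop) (c : R) (v : R2 -> C) :
  C2_on E v -> (forall x, E x -> laplacian v x = (RtoC c * v x)%C) ->
  eigenfunction E c (fun x => part (v x)) (fun x => part (d1 v x)) (fun x => part (d2 v x)).
Proof.
  intros (H & H1 & H2) Hl.
  exists (fun x => part (d1 (d1 v) x)), (fun x => part (d2 (d1 v) x)),
    (fun x => part (d1 (d2 v) x)), (fun x => part (d2 (d2 v) x)).
  split; [|split; [|split]]; try (apply part_has_grad; assumption).
  intros x Hx. rewrite <- part_scal, <- Hl by exact Hx. symmetry. apply part_plus.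
Qed.

End Part.

Lemma Re_linear : real_linear_part Re. Proof. left. reflexivity. Qed.
Lemma Im_linear : real_linear_part Im. Proof. right. reflexivity. Qed.

Lemma radiation_parts (k : R) (v : R2 -> C) :
  radiation_condition k v ->
  radiates k (fun x => Re (v x)) (fun x => Re (d1 v x)) (fun x => Re (d2 v x))
             (fun x => Im (v x)) (fun x => Im (d1 v x)) (fun x => Im (d2 v x)).
Proof.
  intros H eps Heps. destruct (H eps Heps) as [r0 Hr0].
  exists (Rmax 0 r0). intros r t Hr.
  assert (Hr' : 0 < r /\ r0 < r) by (generalize (Rmax_l 0 r0) (Rmax_r 0 r0); lra).
  assert (En : norm2 (circle r t) = r).
  { unfold norm2. replace (dot (circle r t) (circle r t)) with (r ^ 2).
    - apply sqrt_pow2. lra.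
    - rewrite <- (sqnorm_polar r t). unfold dot, sqnorm. ring. }
  assert (B := Hr0 (circle r t)). rewrite En in B. specialize (B (proj2 Hr')).
  unfold radial_derivative, directional_derivative in B. rewrite En in B.
  remember (circle r t) as x eqn:Ex.
  assert (E1 : fst x / r = cos t) by (rewrite Ex; unfold polar; simpl; field; lra).
  assert (E2 : snd x / r = sin t) by (rewrite Ex; unfold polar; simpl; field; lra).
  simpl fst in B; simpl snd in B. rewrite E1, E2 in B.
  match type of B with Cmod ?z < _ => set (w := z) in * end.
  assert (M := Rmax_Cmod w).
  assert (M1 := Rle_trans _ _ _ (Rmax_l _ _) M). assert (M2 := Rle_trans _ _ _ (Rmax_r _ _) M).
  split.
  - replace (sqrt r * (radial (fun x => Re (d1 v x)) (fun x => Re (d2 v x)) (0, 0) r t + k * Im (v x)))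
      with (fst w); [lra|].
    unfold w, radial. rewrite <- Ex. destruct (d1 v x), (d2 v x), (v x); simpl. ring.
  - replace (sqrt r * (radial (fun x => Im (d1 v x)) (fun x => Im (d2 v x)) (0, 0) r t - k * Re (v x)))
      with (snd w); [lra|].
    unfold w, radial. rewrite <- Ex. destruct (d1 v x), (d2 v x), (v x); simpl. ring.
Qed.

Lemma radiates_minus k u ux uy v vx vy u' ux' uy' v' vx' vy' :
  radiates k u ux uy v vx vy -> radiates k u' ux' uy' v' vx' vy' ->
  radiates k (lin 1 (-1) u u') (lin 1 (-1) ux ux') (lin 1 (-1) uy uy')
             (lin 1 (-1) v v') (lin 1 (-1) vx vx') (lin 1 (-1) vy vy').
Proof.
  intros H H' eps Heps.
  destruct (H (eps / 2) ltac:(lra)) as [r0 Hr0]. destruct (H' (eps / 2) ltac:(lra)) as [r1 Hr1].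
  exists (Rmax r0 r1). intros r t Hr.
  destruct (Hr0 r t) as [A1 A2]; [generalize (Rmax_l r0 r1); lra|].
  destruct (Hr1 r t) as [B1 B2]; [generalize (Rmax_r r0 r1); lra|].
  apply Rabs_def2 in A1, A2, B1, B2. unfold radial, lin in *.
  split; apply Rabs_def1; lra.
Qed.

Section ExteriorProblem.

Context (D : R2 -> Prop) (gamma : R -> R2) (T : R) (nu : R2 -> R2).
Context (hD : bounded_domain D) (hgamma : simple_closed_analytic_curve gamma T)
  (hGamma : parametrizes_boundary gamma D) (hnu : exterior_unit_normal D gamma nu).

Let HD : open D := proj1 (proj2 hD).

Lemma exterior_open : open (exterior D).
Proof. exact (closure_open_compl D). Qed.

Lemma exterior_not_D x : exterior D x -> ~ D x.
Proof. intros H Hx. apply H, closure_incl, Hx. Qed.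

Lemma exterior_not_boundary x : exterior D x -> ~ boundary D x.
Proof. intros Hx [H _]. contradiction. Qed.

Lemma D_boundary_exterior x : D x \/ boundary D x \/ exterior D x.
Proof.
  destruct (classic (D x)) as [H|H]; [left; exact H|right].
  destruct (classic (closure D x)) as [Hc|Hc]; [left|right; exact Hc].
  split; [exact Hc|]. apply closure_incl. exact H.
Qed.

Lemma path_locally (P : R2 -> Prop) (f g : R -> R) (t : R) :
  locally (f t, g t) P -> continuous f t -> continuous g t ->
  locally t (fun s => P (f s, g s)).
Proof. intros HP Hf Hg. exact (continuous_pair f g t Hf Hg P HP). Qed.

Lemma path_in_D (f g : R -> R) (a b : R) :
  a <= b -> (forall t, continuous f t) -> (forall t, continuous g t) ->
  (forall t, a <= t <= b -> ~ boundary D (f t, g t)) ->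
  (D (f a, g a) <-> D (f b, g b)).
Proof.
  intros Hab Hf Hg H.
  apply (locally_constant_prop (fun t => D (f t, g t)) a b Hab).
  intros t Ht. destruct (D_boundary_exterior (f t, g t)) as [C|[C|C]].
  - generalize (path_locally _ f g t (HD _ C) (Hf t) (Hg t)).
    apply filter_imp. tauto.
  - destruct (H t Ht C).
  - generalize (path_locally _ f g t (exterior_open _ C) (Hf t) (Hg t)).
    apply filter_imp. intros s Hs. split; intros K; [destruct (exterior_not_D _ Hs K)
      |destruct (exterior_not_D _ C K)].
Qed.

Definition splits_exterior (U V : R2 -> Prop) : Prop :=
  open U /\ open V /\ (forall x, exterior D x -> U x \/ V x) /\
  forall x, exterior D x -> ~ (U x /\ V x).

Lemma splits_exterior_sym (U V : R2 -> Prop) : splits_exterior U V -> splits_exterior V U.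
Proof.
  intros (HU & HV & Hc & Hd). split; [exact HV|]. split; [exact HU|].
  split; intros x Hx; [destruct (Hc x Hx); auto|intros [A B]; apply (Hd x Hx); auto].
Qed.

Lemma path_in_part (U V : R2 -> Prop) (f g : R -> R) (a b : R) :
  splits_exterior U V ->
  a <= b -> (forall t, continuous f t) -> (forall t, continuous g t) ->
  (forall t, a <= t <= b -> exterior D (f t, g t)) ->
  (U (f a, g a) <-> U (f b, g b)).
Proof.
  intros (HU & HV & Hcov & Hdis) Hab Hf Hg H.
  apply (locally_constant_prop (fun t => U (f t, g t)) a b Hab).
  intros t Ht. assert (Hx := H t Ht).
  destruct (Hcov _ Hx) as [C|C].
  - generalize (path_locally _ f g t (HU _ C) (Hf t) (Hg t)).
    apply filter_imp. tauto.
  - generalize (filter_and _ _ (path_locally _ f g t (HV _ C) (Hf t) (Hg t))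
      (path_locally _ f g t (exterior_open _ Hx) (Hf t) (Hg t))).
    apply filter_imp. intros s [K1 K2].
    split; intros K; [destruct (Hdis _ K2)|destruct (Hdis _ Hx)]; auto.
Qed.

Definition curve1 (t : R) : R := fst (gamma t).
Definition curve2 (t : R) : R := snd (gamma t).

Lemma curve_pair t : (curve1 t, curve2 t) = gamma t.
Proof. unfold curve1, curve2. destruct (gamma t); reflexivity. Qed.

Lemma period_pos : 0 < T.
Proof. apply hgamma. Qed.

Lemma curve1_derive t : is_derive curve1 t (fst (tangent gamma t)).
Proof. apply real_analytic_derive. apply hgamma. Qed.

Lemma curve2_derive t : is_derive curve2 t (snd (tangent gamma t)).
Proof. apply real_analytic_derive. apply hgamma. Qed.

Lemma tangent1_continuous t : continuous (fun s => fst (tangent gamma s)) t.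
Proof. apply real_analytic_derive_continuous. apply hgamma. Qed.

Lemma tangent2_continuous t : continuous (fun s => snd (tangent gamma s)) t.
Proof. apply real_analytic_derive_continuous. apply hgamma. Qed.

Lemma curve1_continuous t : continuous curve1 t.
Proof. exact (continuous_of_derive _ _ _ (curve1_derive t)). Qed.

Lemma curve2_continuous t : continuous curve2 t.
Proof. exact (continuous_of_derive _ _ _ (curve2_derive t)). Qed.

Lemma tangent_nonzero t :
  0 < fst (tangent gamma t) ^ 2 + snd (tangent gamma t) ^ 2.
Proof.
  destruct hgamma as (_ & _ & _ & H & _). specialize (H t).
  destruct (tangent gamma t) as [a b]; simpl fst; simpl snd.
  destruct (Req_dec a 0) as [->|Na].
  - destruct (Req_dec b 0) as [->|Nb]; [contradiction|].
    generalize (pow2_gt_0 b Nb). lra.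
  - generalize (pow2_gt_0 a Na) (pow2_ge_0 b). lra.
Qed.

Lemma curve_shift (k : Z) (t : R) : gamma (t + IZR k * T) = gamma t.
Proof.
  destruct hgamma as (_ & _ & _ & _ & Hp & _).
  assert (N : forall n t, gamma (t + INR n * T) = gamma t).
  { induction n as [|n IH]; intros s.
    - f_equal. simpl. ring.
    - rewrite S_INR. replace (s + (INR n + 1) * T) with (s + INR n * T + T) by ring.
      rewrite Hp. apply IH. }
  destruct (Z_le_dec 0 k) as [L|L].
  - rewrite <- (Z2Nat.id k L), <- INR_IZR_INZ. apply N.
  - rewrite <- (N (Z.to_nat (- k)) (t + IZR k * T)). f_equal.
    rewrite INR_IZR_INZ, Z2Nat.id, opp_IZR by lia. ring.
Qed.

Lemma curve_representative (t0 t : R) :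
  exists t', t0 <= t' < t0 + T /\ gamma t' = gamma t.
Proof.
  assert (HT := period_pos).
  set (k := Int_part ((t - t0) / T)).
  destruct (base_Int_part ((t - t0) / T)) as [B1 B2]. fold k in B1, B2.
  exists (t + IZR (- k) * T). rewrite curve_shift. split; [|reflexivity].
  rewrite opp_IZR.
  assert (E : t - t0 = (t - t0) / T * T) by (field; lra).
  split; nra.
Qed.

Lemma curve_injective (s t : R) : gamma s = gamma t -> Rabs (s - t) < T -> s = t.
Proof.
  assert (HT := period_pos).
  assert (W : forall s t, s <= t -> gamma s = gamma t -> t - s < T -> s = t).
  { clear s t. intros s t Hst E Hlt.
    assert (Hinj : forall s t, 0 <= s < T -> 0 <= t < T -> gamma s = gamma t -> s = t)
      by apply hgamma.
    set (k := Int_part (s / T)).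
    destruct (base_Int_part (s / T)) as [B1 B2]. fold k in B1, B2.
    assert (Es : s = s / T * T) by (field; lra).
    assert (Hs : 0 <= s + IZR (- k) * T < T) by (rewrite opp_IZR; nra).
    destruct (Rlt_le_dec (t + IZR (- k) * T) T) as [L|L].
    - assert (s + IZR (- k) * T = t + IZR (- k) * T); [|lra].
      apply Hinj; [exact Hs|lra|]. rewrite !curve_shift. exact E.
    - assert (s + IZR (- k) * T = t + IZR (- k) * T + IZR (-1) * T); [|lra].
      apply Hinj; [exact Hs|lra|]. rewrite !curve_shift. exact E. }
  intros E Hlt. apply Rabs_def2 in Hlt.
  destruct (Rle_lt_dec s t).
  - apply W; auto; lra.
  - symmetry. apply W; auto; lra.
Qed.

Lemma dsq_curve_derive (y : R2) (t : R) :
  is_derive (fun s => dsq (gamma s) y) t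
    (2 * ((curve1 t - fst y) * fst (tangent gamma t)
          + (curve2 t - snd y) * snd (tangent gamma t))).
Proof.
  change (is_derive (fun s => (curve1 s - fst y) ^ 2 + (curve2 s - snd y) ^ 2) t
    (2 * ((curve1 t - fst y) * fst (tangent gamma t)
          + (curve2 t - snd y) * snd (tangent gamma t)))).
  assert (D1 := curve1_derive t). assert (D2 := curve2_derive t).
  generalize dependent curve1. generalize dependent curve2. intros. derive. ring.
Qed.

Lemma dsq_curve_continuous (y : R2) (t : R) : continuity_pt (fun s => dsq (gamma s) y) t.
Proof. apply continuous_pt. exact (continuous_of_derive _ _ _ (dsq_curve_derive y t)). Qed.

(** Compactness of the curve and injectivity: points of the curve close to
    [gamma t0] have parameters close to [t0]. *)
Lemma curve_near (t0 alpha : R) : 0 < alpha ->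
  exists m, 0 < m /\ forall t, dsq (gamma t) (gamma t0) < m ->
    exists t', Rabs (t' - t0) < alpha /\ gamma t' = gamma t.
Proof.
  intros Ha. assert (HT := period_pos).
  destruct (ex_small alpha (T / 2) 1 1) as (b & Hb); try lra.
  destruct (continuity_ab_min (fun s => dsq (gamma s) (gamma t0)) (t0 + b) (t0 + T - b))
    as [tm [Hm Htm]]; [lra|intros; apply dsq_curve_continuous|].
  exists (dsq (gamma tm) (gamma t0)). split.
  - apply Rnot_le_lt. intros L. apply dsq_eq in L.
    apply curve_injective in L; [lra|]. apply Rabs_def1; lra.
  - intros t Ht. destruct (curve_representative t0 t) as [t' [Ht' E]].
    rewrite <- E in Ht.
    destruct (Rlt_le_dec t' (t0 + b)) as [L1|L1].
    { exists t'. split; [apply Rabs_def1; lra|exact E]. }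
    destruct (Rlt_le_dec (t0 + T - b) t') as [L2|L2].
    { exists (t' + IZR (-1) * T). rewrite curve_shift. split; [apply Rabs_def1; lra|exact E]. }
    exfalso. generalize (Hm t' ltac:(lra)). lra.
Qed.

Definition on_curve (x : R2) : Prop := exists t, gamma t = x.

Lemma nearest_curve_point (y : R2) :
  exists t0, forall t, dsq (gamma t0) y <= dsq (gamma t) y.
Proof.
  assert (HT := period_pos).
  destruct (continuity_ab_min (fun s => dsq (gamma s) y) 0 T) as [t0 [H _]];
    [lra|intros; apply dsq_curve_continuous|].
  exists t0. intros t. destruct (curve_representative 0 t) as [t' [Ht' <-]].
  apply H. lra.
Qed.

Lemma nearest_segment_off_curve (y : R2) (t0 l : R) :
  ~ on_curve y -> (forall t, dsq (gamma t0) y <= dsq (gamma t) y) -> 0 < l <= 1 ->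
  ~ on_curve (displace (gamma t0) l (fst y - curve1 t0, snd y - curve2 t0)).
Proof.
  intros Hy Hmin Hl [t Ht]. specialize (Hmin t). rewrite Ht in Hmin.
  assert (P : 0 < dsq (gamma t0) y).
  { apply Rnot_le_lt. intros L. apply dsq_eq in L. apply Hy. exists t0. exact L. }
  set (z := displace (gamma t0) l (fst y - curve1 t0, snd y - curve2 t0)) in *.
  assert (E : dsq z y = (1 - l) ^ 2 * dsq (gamma t0) y).
  { unfold z, dsq, displace, curve1, curve2. simpl fst; simpl snd. ring. }
  rewrite E in Hmin.
  assert ((1 - l) ^ 2 < 1) by nra. nra.
Qed.

(** The coordinate of the curve along its tangent at [t0]. *)
Definition along (t0 t : R) : R := dot (gamma t) (tangent gamma t0).

Lemma along_derive (t0 t : R) :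
  is_derive (along t0) t (dot (tangent gamma t) (tangent gamma t0)).
Proof.
  apply is_derive_plusR; apply is_derive_scalR; [apply curve1_derive|apply curve2_derive].
Qed.

Lemma along_increasing (t0 : R) : exists alpha, 0 < alpha /\
  forall s t, Rabs (s - t0) < alpha -> Rabs (t - t0) < alpha -> s < t ->
    along t0 s < along t0 t.
Proof.
  assert (C1 := tangent1_continuous t0). assert (C2 := tangent2_continuous t0).
  destruct (continuous_gt (fun t => fst (tangent gamma t) * fst (tangent gamma t0)
    + snd (tangent gamma t) * snd (tangent gamma t0)) t0 0) as [alpha Hal];
    [cont|generalize (tangent_nonzero t0); lra|].
  exists alpha. split; [apply cond_pos|]. intros s t Hs Ht Hst.
  destruct (MVT_cor2 (along t0) _ s t Hst (fun c _ => proj1 (is_derive_Reals _ _ _)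
    (along_derive t0 c))) as (c & Hc & Hct).
  assert (0 < dot (tangent gamma c) (tangent gamma t0)); [|nra].
  apply Hal. change (Rabs (c - t0) < alpha). apply Rabs_def2 in Hs. apply Rabs_def2 in Ht.
  apply Rabs_def1; lra.
Qed.

(** * Connectedness of the exterior domain *)

Let HE : open (exterior D) := exterior_open.

Lemma curve_boundary t : boundary D (gamma t).
Proof. apply hGamma. exists t. reflexivity. Qed.

Lemma normal_unit t : dot (nu (gamma t)) (nu (gamma t)) = 1.
Proof.
  destruct (proj2 hnu (gamma t) (curve_boundary t)) as [H _].
  unfold norm2 in H.
  rewrite <- (sqrt_sqrt (dot (nu (gamma t)) (nu (gamma t)))).
  - rewrite H. ring.
  - unfold dot. generalize (Rle_0_sqr (fst (nu (gamma t)))) (Rle_0_sqr (snd (nu (gamma t)))).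
    unfold Rsqr. lra.
Qed.

Lemma normal_tangent t : dot (nu (gamma t)) (tangent gamma t) = 0.
Proof. apply hnu. Qed.

Lemma normal_sides t : exists delta, 0 < delta /\ forall s, 0 < s < delta ->
  exterior D (displace (gamma t) s (nu (gamma t))) /\
  D (displace (gamma t) (- s) (nu (gamma t))).
Proof.
  destruct (proj2 hnu (gamma t) (curve_boundary t)) as [_ (de & Hde & H)].
  exists de. split; [exact Hde|]. intros s Hs. destruct (H s Hs) as [H1 H2].
  split; [exact H1|]. unfold displace.
  replace (fst (gamma t) + - s * fst (nu (gamma t)))
    with (fst (gamma t) - s * fst (nu (gamma t))) by ring.
  replace (snd (gamma t) + - s * snd (nu (gamma t)))
    with (snd (gamma t) - s * snd (nu (gamma t))) by ring. exact H2.
Qed.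

Lemma segment_in_D (x y : R2) :
  (forall l, 0 <= l <= 1 ->
     ~ boundary D (fst x + l * (fst y - fst x), snd x + l * (snd y - snd x))) ->
  (D x <-> D y).
Proof.
  intros H.
  assert (P := path_in_D (fun l => fst x + l * (fst y - fst x))
    (fun l => snd x + l * (snd y - snd x)) 0 1 ltac:(lra)
    ltac:(intros; cont) ltac:(intros; cont) H).
  cbv beta in P. destruct x as [x1 x2], y as [y1 y2]. simpl fst in *; simpl snd in *.
  replace (x1 + 0 * (y1 - x1)) with x1 in P by ring.
  replace (x2 + 0 * (y2 - x2)) with x2 in P by ring.
  replace (x1 + 1 * (y1 - x1)) with y1 in P by ring.
  replace (x2 + 1 * (y2 - x2)) with y2 in P by ring. exact P.
Qed.

Lemma displace_continuous_1 (z n : R2) t : continuous (fun s => fst z + s * fst n) t.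
Proof. cont. Qed.

Lemma displace_continuous_2 (z n : R2) t : continuous (fun s => snd z + s * snd n) t.
Proof. cont. Qed.

Lemma ray_in_D (z n : R2) (s l : R) : s <= l ->
  (forall m, s <= m <= l -> ~ boundary D (displace z m n)) ->
  (D (displace z s n) <-> D (displace z l n)).
Proof.
  intros Hsl H. exact (path_in_D _ _ s l Hsl (displace_continuous_1 z n)
    (displace_continuous_2 z n) H).
Qed.

Lemma ray_in_part (U V : R2 -> Prop) (z n : R2) (s l : R) :
  splits_exterior U V -> s <= l ->
  (forall m, s <= m <= l -> exterior D (displace z m n)) ->
  (U (displace z s n) <-> U (displace z l n)).
Proof.
  intros Hs Hsl H. exact (path_in_part U V _ _ s l Hs Hsl
    (displace_continuous_1 z n) (displace_continuous_2 z n) H).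
Qed.

Lemma boundary_on_curve x : boundary D x -> on_curve x.
Proof. apply hGamma. Qed.

Lemma normal_components (t0 : R) (v : R2) :
  dot v (tangent gamma t0) = 0 -> exists b,
    fst v = b * fst (nu (gamma t0)) /\ snd v = b * snd (nu (gamma t0)).
Proof.
  intros Hv. assert (Hn := normal_unit t0). assert (Hnz := tangent_nonzero t0).
  destruct (orthogonal_to_unit _ _ Hn (normal_tangent t0)) as (la & T1 & T2).
  unfold dot in *. rewrite T1, T2 in Hv, Hnz. destruct (nu (gamma t0)) as [n1 n2], v as [a b].
  cbn [fst snd] in *.
  assert (Z : - n2 * a + n1 * b = 0).
  { apply Rmult_eq_reg_l with la; [lra|]. intros Z. rewrite Z in Hnz. lra. }
  exists (a * n1 + b * n2). split.
  - transitivity (a * (n1 * n1 + n2 * n2) + n2 * (- n2 * a + n1 * b));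
      [rewrite Hn, Z; ring|ring].
  - transitivity (b * (n1 * n1 + n2 * n2) - n1 * (- n2 * a + n1 * b));
      [rewrite Hn, Z; ring|ring].
Qed.

Lemma along_displace (t0 t b : R) :
  dot (displace (gamma t) b (nu (gamma t0))) (tangent gamma t0) = along t0 t.
Proof.
  assert (H := normal_tangent t0). unfold along.
  destruct (tangent gamma t0) as [t1 t2], (nu (gamma t0)) as [n1 n2].
  unfold dot, displace in *. cbn [fst snd] in *.
  transitivity (fst (gamma t) * t1 + snd (gamma t) * t2 + b * (n1 * t1 + n2 * t2)); [ring|].
  rewrite H. ring.
Qed.

Lemma near_curve_point (t0 e : R) : 0 < e -> locally t0 (fun t =>
  Rabs (fst (gamma t) - fst (gamma t0)) < e /\ Rabs (snd (gamma t) - snd (gamma t0)) < e).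
Proof.
  intros He.
  exact (filter_and _ _
    (proj1 (filterlim_locally _ _) (curve1_continuous t0) (mkposreal e He))
    (proj1 (filterlim_locally _ _) (curve2_continuous t0) (mkposreal e He))).
Qed.

(** Near [gamma t0] the curve is a graph over its tangent, so its translates
    by small multiples of the normal at [t0] do not meet it: they stay on the
    side on which they start. *)
Lemma normal_columns (t0 : R) : exists alpha b0, 0 < alpha /\ 0 < b0 /\
  forall t b, Rabs (t - t0) < alpha -> 0 < b <= b0 ->
    exterior D (displace (gamma t) b (nu (gamma t0))) /\
    D (displace (gamma t) (- b) (nu (gamma t0))).
Proof.
  destruct (normal_sides t0) as (d1 & Hd1 & Hside).
  assert (Hn := normal_unit t0). assert (Hlong := along_displace t0).
  set (n := nu (gamma t0)) in *.
  destruct (along_increasing t0) as (al & Hal & Hinc).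
  destruct (curve_near t0 al Hal) as (m & Hm & Hnear).
  destruct (ex_small d1 1 (m / 4) 1) as (b0 & Hb0); try lra.
  assert (C1 := curve1_continuous t0).
  assert (C2 := curve2_continuous t0).
  assert (Hlift : forall (P : R2 -> Prop) b, open P -> P (displace (gamma t0) b n) ->
    locally t0 (fun t => P (displace (gamma t) b n))).
  { intros P b HP Pt.
    apply (path_locally P (fun t => curve1 t + b * fst n)
      (fun t => curve2 t + b * snd n)); [apply HP, Pt|cont|cont]. }
  destruct (Hside b0 ltac:(lra)) as [S1 S2].
  assert (L3 : locally t0 (fun t => dsq (gamma t) (gamma t0) < m / 4)).
  { apply (continuous_lt (fun t => dsq (gamma t) (gamma t0))).
    - exact (continuous_of_derive _ _ _ (dsq_curve_derive (gamma t0) t0)).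
    - unfold dsq. lra. }
  destruct (filter_and _ _ (filter_and _ _ (Hlift _ b0 HE S1) (Hlift _ (- b0) HD S2))
    (filter_and _ _ L3 (locally_Rabs t0 al Hal))) as [alpha Halpha].
  exists alpha, b0. split; [apply cond_pos|]. split; [lra|]. intros t b Ht Hb.
  destruct (Halpha t Ht) as [[HEt HDt] [Hdt Hta]]. clear Ht Halpha.
  assert (Hoff : forall b, b <> 0 -> - b0 <= b <= b0 -> ~ boundary D (displace (gamma t) b n)).
  { clear b Hb. intros b Hnz Hb Hbd. destruct (boundary_on_curve _ Hbd) as [t1 Ht1].
    destruct (Hnear t1) as (t' & Ht' & Et').
    { rewrite Ht1. unfold dsq, displace, dot in *. simpl fst; simpl snd.
      generalize (pow2_ge_0 (fst (gamma t) - fst (gamma t0) - b * fst n))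
        (pow2_ge_0 (snd (gamma t) - snd (gamma t0) - b * snd n)).
      assert (b ^ 2 <= b0 ^ 2) by nra.
      assert (b ^ 2 * (fst n * fst n + snd n * snd n) < m / 4) by (rewrite Hn; nra).
      lra. }
    assert (Ea : along t0 t' = along t0 t).
    { unfold along at 1. rewrite Et', Ht1. apply Hlong. }
    assert (t' = t).
    { destruct (Rtotal_order t' t) as [L|[L|L]]; [|exact L|];
        apply Hinc in L; try assumption; lra. }
    subst t'. rewrite Ht1 in Et'. unfold displace in Et'. unfold dot in Hn.
    assert (K1 := f_equal fst Et'). assert (K2 := f_equal snd Et'). cbn [fst snd] in K1, K2.
    assert (fst n = 0) by (apply Rmult_eq_reg_l with b; lra).
    assert (snd n = 0) by (apply Rmult_eq_reg_l with b; lra). nra. }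
  split.
  - destruct (D_boundary_exterior (displace (gamma t) b n)) as [K|[K|K]];
      [exfalso|destruct (Hoff b ltac:(lra) ltac:(lra) K)|exact K].
    apply (exterior_not_D _ HEt). revert K. apply (ray_in_D _ _ b b0); [lra|].
    intros c Hc. apply Hoff; lra.
  - revert HDt. apply (ray_in_D _ _ (- b0) (- b)); [lra|]. intros c Hc. apply Hoff; lra.
Qed.

(** By the intermediate value theorem the translates sweep out a neighbourhood
    of [gamma t0]; the part of it in the exterior is swept by the positive
    ones. *)
Lemma exterior_collar (t0 b0 eps : R) :
  0 < b0 -> 0 < eps ->
  (forall t b, Rabs (t - t0) < eps -> 0 < b <= b0 ->
     D (displace (gamma t) (- b) (nu (gamma t0)))) ->
  locally (gamma t0) (fun y => exterior D y -> exists t b,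
    Rabs (t - t0) < eps /\ 0 < b <= b0 /\ y = displace (gamma t) b (nu (gamma t0))).
Proof.
  intros Hb0 Heps Hcol. assert (Hn := normal_unit t0).
  destruct (unit_components _ Hn) as [N1 N2].
  destruct (along_increasing t0) as (al & Hal & Hinc).
  destruct (near_curve_point t0 (b0 / 4) ltac:(lra)) as [be Hbe].
  destruct (ex_small eps al be 1) as (e & He); try apply cond_pos; try lra.
  assert (Hlo : along t0 (t0 - e) < along t0 t0)
    by (apply Hinc; try apply Rabs_def1; lra).
  assert (Hhi : along t0 t0 < along t0 (t0 + e))
    by (apply Hinc; try apply Rabs_def1; lra).
  assert (Ct : continuous (fun y : R2 => fst y * fst (tangent gamma t0)
    + snd y * snd (tangent gamma t0)) (gamma t0)) by cont.
  assert (Lb : locally (gamma t0) (fun y : R2 => Rabs (fst y - fst (gamma t0)) < b0 / 4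
    /\ Rabs (snd y - snd (gamma t0)) < b0 / 4)).
  { apply locally_R2. exists (b0 / 4). split; [lra|auto]. }
  generalize (filter_and _ _ (filter_and _ _ (continuous_gt _ _ _ Ct Hlo)
    (continuous_lt _ _ _ Ct Hhi)) Lb).
  apply filter_imp. intros [y1 y2] [[Y1 Y2] [Y3 Y4]] Hy. clear Ct Lb.
  set (y := (y1, y2)) in *. change (fst y) with y1 in *. change (snd y) with y2 in *.
  destruct (IVT_gen (along t0) (t0 - e) (t0 + e) (dot y (tangent gamma t0)))
    as (t & Ht & Et).
  { intros t. apply continuous_pt. exact (continuous_of_derive _ _ _ (along_derive t0 t)). }
  { rewrite Rmin_left, Rmax_right by lra. change (dot y (tangent gamma t0)) with
      (y1 * fst (tangent gamma t0) + y2 * snd (tangent gamma t0)). lra. }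
  rewrite Rmin_left, Rmax_right in Ht by lra.
  destruct (normal_components t0 (y1 - fst (gamma t), y2 - snd (gamma t))) as (b & B1 & B2).
  { unfold along, dot in *.
    change ((y1 - fst (gamma t)) * fst (tangent gamma t0)
      + (y2 - snd (gamma t)) * snd (tangent gamma t0) = 0).
    change (fst y) with y1 in Et. change (snd y) with y2 in Et. lra. }
  cbn [fst snd] in B1, B2.
  assert (Ey : y = displace (gamma t) b (nu (gamma t0))).
  { unfold y, displace. f_equal; lra. }
  destruct (Hbe t) as [G1 G2]; [in_ball|].
  assert (Hb : - b0 <= b <= b0).
  { set (n := nu (gamma t0)) in *. unfold dot in Hn.
    assert (Eb : b = (y1 - fst (gamma t)) * fst n + (y2 - snd (gamma t)) * snd n).
    { rewrite B1, B2. transitivity (b * (fst n * fst n + snd n * snd n)); [rewrite Hn|]; ring. }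
    apply Rabs_def2 in Y3, Y4, G1, G2. apply Rabs_le_between in N1, N2.
    assert (K : forall v c, - (b0 / 2) <= v <= b0 / 2 -> -1 <= c <= 1 ->
      - (b0 / 2) <= v * c <= b0 / 2) by (intros; split; nra).
    assert (K1 := K (y1 - fst (gamma t)) (fst n) ltac:(lra) N1).
    assert (K2 := K (y2 - snd (gamma t)) (snd n) ltac:(lra) N2). lra. }
  assert (Hte : Rabs (t - t0) < eps) by (apply Rabs_def1; lra).
  exists t, b. split; [exact Hte|]. split; [|exact Ey]. split; [|lra].
  destruct (Rtotal_order b 0) as [L|[L|L]]; [exfalso|exfalso|exact L].
  - apply (exterior_not_D y Hy). rewrite Ey. replace b with (- - b) by ring.
    apply Hcol; [exact Hte|lra].
  - apply (exterior_not_boundary y Hy). rewrite Ey, L.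
    replace (displace (gamma t) 0 (nu (gamma t0))) with (gamma t); [apply curve_boundary|].
    unfold displace. destruct (gamma t); simpl. f_equal; ring.
Qed.

Definition exterior_near (U : R2 -> Prop) (x : R2) : Prop :=
  locally x (fun y => exterior D y -> U y).

(** The exterior near [gamma t0] consists of columns hanging from one lifted
    arc of the curve. A short such arc lies in one of the two open parts, and
    each column stays in the part of its upper end. *)
Lemma exterior_near_part (U V : R2 -> Prop) (t0 : R) :
  splits_exterior U V -> exterior_near U (gamma t0) \/ exterior_near V (gamma t0).
Proof.
  destruct (normal_columns t0) as (alpha & b0 & Hal & Hb0 & Hcol).
  set (n := nu (gamma t0)) in *.
  assert (Hside : forall P Q : R2 -> Prop, splits_exterior P Q ->
    P (displace (gamma t0) b0 n) -> exterior_near P (gamma t0)).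
  { intros P Q HPQ Pt.
    assert (C1 := curve1_continuous t0).
    assert (C2 := curve2_continuous t0).
    destruct (path_locally P (fun t => curve1 t + b0 * fst n)
      (fun t => curve2 t + b0 * snd n) t0 (proj1 HPQ _ Pt)) as [be Hbe]; [cont|cont|].
    destruct (ex_small alpha be 1 1) as (e & He); try apply cond_pos; try lra.
    unfold exterior_near. generalize (exterior_collar t0 b0 e Hb0 ltac:(lra)
      (fun t b Ht Hb => proj2 (Hcol t b ltac:(lra) Hb))).
    apply filter_imp. intros y Hy Ey. destruct (Hy Ey) as (t & b & Ht & Hb & ->).
    apply (ray_in_part P Q (gamma t) n b b0); auto; [lra| |].
    - intros c Hc'. apply Hcol; lra.
    - apply (Hbe t). change (Rabs (t - t0) < be). lra. }
  intros Hs. destruct (proj1 (proj2 (proj2 Hs)) (displace (gamma t0) b0 n)) as [K|K].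
  - apply Hcol; [rewrite Rminus_diag, Rabs_R0|]; lra.
  - left. apply (Hside U V Hs K).
  - right. apply (Hside V U (splits_exterior_sym _ _ Hs) K).
Qed.

(** A point of the exterior sees its nearest boundary point. *)
Lemma part_reaches_boundary (U V : R2 -> Prop) (y : R2) :
  splits_exterior U V -> exterior D y -> U y ->
  exists t, exterior_near U (gamma t).
Proof.
  intros Hs Hy Uy.
  destruct (nearest_curve_point y) as [t0 Hmin].
  assert (Hoc : ~ on_curve y).
  { intros C. apply hGamma in C. exact (exterior_not_boundary y Hy C). }
  set (v := (fst y - curve1 t0, snd y - curve2 t0)).
  assert (Ey : displace (gamma t0) 1 v = y).
  { unfold displace, v, curve1, curve2. destruct y; simpl. f_equal; ring. }
  assert (Hoff : forall l, 0 < l <= 1 -> ~ boundary D (displace (gamma t0) l v)).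
  { intros l Hl Hb. apply (nearest_segment_off_curve y t0 l Hoc Hmin Hl).
    apply boundary_on_curve, Hb. }
  assert (Hin : forall l, 0 < l <= 1 -> exterior D (displace (gamma t0) l v)).
  { intros l Hl. destruct (D_boundary_exterior (displace (gamma t0) l v)) as [K|[K|K]];
      [exfalso|destruct (Hoff l Hl K)|exact K].
    apply (exterior_not_D y Hy). rewrite <- Ey. revert K.
    apply (ray_in_D _ _ l 1); [lra|]. intros m Hm. apply Hoff. lra. }
  assert (HUl : forall l, 0 < l <= 1 -> U (displace (gamma t0) l v)).
  { intros l Hl. apply (ray_in_part U V _ _ l 1); auto; [lra| |rewrite Ey; exact Uy].
    intros m Hm. apply Hin. lra. }
  exists t0. destruct (exterior_near_part U V t0 Hs) as [K|K]; [exact K|exfalso].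
  assert (L : locally 0 (fun l => exterior D (displace (gamma t0) l v) -> V (displace (gamma t0) l v))).
  { apply (path_locally (fun y => exterior D y -> V y) (fun s => fst (gamma t0) + s * fst v)
      (fun s => snd (gamma t0) + s * snd v)); [|cont|cont].
    rewrite !Rmult_0_l, !Rplus_0_r, <- surjective_pairing. exact K. }
  destruct L as [e He]. destruct (ex_small e 1 1 1) as (l & Hl); try apply cond_pos; try lra.
  apply (proj2 (proj2 (proj2 Hs)) (displace (gamma t0) l v));
    [apply Hin; lra|split; [apply HUl; lra|]].
  apply He; [in_ball|apply Hin; lra].
Qed.

(** Which part of a splitting contains the exterior near a boundary point is
    locally constant along the connected boundary, and both parts would reach
    the boundary. *)
Theorem exterior_connected : connected (exterior D).
Proof.
  intros U V HU HV Hc Hd [x [Hx Ux]] y Hy Vy.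
  assert (Hs : splits_exterior U V) by exact (conj HU (conj HV (conj Hc Hd))).
  assert (Hdisj : forall t, exterior_near U (gamma t) -> ~ exterior_near V (gamma t)).
  { intros t KU KV. assert (K := filter_and _ _ KU KV).
    destruct (normal_sides t) as (de & Hde & H).
    apply locally_R2 in K. destruct K as (e & He & K).
    destruct (ex_small de e 1 1) as (s & Hse); try lra.
    destruct (H s ltac:(lra)) as [Hin _].
    destruct (displace_near (gamma t) _ s e (normal_unit t)) as [A B]; [lra|].
    destruct (K _ A B). apply (Hd _ Hin). auto. }
  assert (Hopen : forall P t, exterior_near P (gamma t) ->
    locally t (fun s => exterior_near P (gamma s))).
  { intros P t K.
    assert (K' := locally_locally _ _ K). rewrite <- curve_pair in K'.
    generalize (path_locally _ _ _ t K' (curve1_continuous t)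
      (curve2_continuous t)).
    apply filter_imp. intros s. rewrite curve_pair. auto. }
  assert (Hloc : forall t, locally t (fun s => exterior_near U (gamma s) <-> exterior_near U (gamma t))).
  { intros t. destruct (exterior_near_part U V t Hs) as [K|K];
      generalize (Hopen _ t K); apply filter_imp; intros s Ks; [tauto|].
    split; intros L; [destruct (Hdisj s L Ks)|destruct (Hdisj t L K)]. }
  destruct (part_reaches_boundary U V x Hs Hx Ux) as [t1 Ht1].
  destruct (part_reaches_boundary V U y (splits_exterior_sym _ _ Hs) Hy Vy) as [t2 Ht2].
  apply (Hdisj t2); [|exact Ht2].
  destruct (Rle_lt_dec t1 t2) as [L|L].
  - apply (locally_constant_prop (fun t => exterior_near U (gamma t)) t1 t2 L); auto.
  - apply (locally_constant_prop (fun t => exterior_near U (gamma t)) t2 t1); auto. lra.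
Qed.

(** * Limits from the exterior *)

Definition zero_ext (u : R2 -> R) (x : R2) : R :=
  if excluded_middle_informative (exterior D x) then u x else 0.

Definition exterior_limit (u : R2 -> R) (x : R2) (l : R) : Prop :=
  filterlim u (within (exterior D) (locally x)) (locally l).

Lemma zero_ext_exterior u x : exterior D x -> zero_ext u x = u x.
Proof.
  intros H. unfold zero_ext.
  destruct (excluded_middle_informative (exterior D x)); tauto.
Qed.

Lemma zero_ext_off u x : ~ exterior D x -> zero_ext u x = 0.
Proof.
  intros H. unfold zero_ext.
  destruct (excluded_middle_informative (exterior D x)); tauto.
Qed.

Lemma exterior_limit_near (u : R2 -> R) (x : R2) (l eps : R) :
  exterior_limit u x l -> 0 < eps ->
  exists d, 0 < d /\ forall y : R2, exterior D y ->
    Rabs (fst y - fst x) < d -> Rabs (snd y - snd x) < d -> Rabs (u y - l) < eps.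
Proof.
  intros H He.
  assert (K := proj1 (filterlim_locally u l) H (mkposreal eps He)).
  apply locally_R2 in K. destruct K as [d [Hd K]].
  exists d. split; [exact Hd|]. intros y Hy H1 H2. exact (K y H1 H2 Hy).
Qed.

Lemma zero_ext_continuous (u : R2 -> R) :
  (forall x, exterior D x -> continuous u x) ->
  (forall x, boundary D x -> exterior_limit u x 0) ->
  forall x, continuous (zero_ext u) x.
Proof.
  intros Hc Hb x. destruct (D_boundary_exterior x) as [C|[C|C]].
  - apply continuous_ext_loc with (fun _ => 0); [|apply continuous_const].
    generalize (HD x C). apply filter_imp. intros y Hy. symmetry. apply zero_ext_off.
    intros K. exact (exterior_not_D y K Hy).
  - apply continuous_R2. intros eps Heps.
    destruct (exterior_limit_near u x 0 eps (Hb x C) Heps) as (d & Hd & K).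
    exists d. split; [exact Hd|]. intros y H1 H2.
    rewrite (zero_ext_off u x), Rminus_0_r.
    2: { intros Q. exact (exterior_not_boundary x Q C). }
    destruct (classic (exterior D y)) as [Hy|Hy].
    + rewrite zero_ext_exterior by exact Hy. rewrite <- (Rminus_0_r (u y)). auto.
    + rewrite zero_ext_off, Rabs_R0; assumption.
  - apply continuous_ext_loc with u; [|apply Hc, C].
    generalize (exterior_open x C). apply filter_imp. intros y Hy. symmetry.
    apply zero_ext_exterior, Hy.
Qed.

Section Tangential.

Context (w wx wy : R2 -> R) (Hw : has_grad (exterior D) w wx wy).
Context (Hw0 : forall x, boundary D x -> exterior_limit w x 0).

(** The derivative of [w] along the translate of the boundary by a small
    multiple [b] of the normal at [t0] is close to the tangential derivative
    [k], whereas the values of [w] there tend to zero with [b]. *)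
Lemma gradient_vanishes_on_boundary (t0 g1 g2 : R) :
  exterior_limit wx (gamma t0) g1 -> exterior_limit wy (gamma t0) g2 ->
  fst (nu (gamma t0)) * g1 + snd (nu (gamma t0)) * g2 = 0 ->
  g1 = 0 /\ g2 = 0.
Proof.
  intros H1 H2 Hg.
  assert (Hn := normal_unit t0).
  assert (Hnt := normal_tangent t0).
  assert (Htt := tangent_nonzero t0).
  destruct (normal_columns t0) as (alpha & b0 & Hal & Hb0 & Hcol).
  set (n := nu (gamma t0)) in *. set (tau := tangent gamma t0) in *.
  set (k := g1 * fst tau + g2 * snd tau).
  assert (Hk : k = 0).
  { apply NNPP. intros Hk0.
    assert (Hk : 0 < Rabs k) by (apply Rabs_pos_lt, Hk0).
    set (F := within (exterior D) (locally (gamma t0))).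
    assert (FF : Filter F) by (apply within_filter, locally_filter).
    assert (Fst : forall (v : R2 -> R) (g : R), filterlim v F (locally g) ->
      filterlim (fun z : R2 * R => v (fst z)) (filter_prod F (locally t0)) (locally g)).
    { intros v g Hv. eapply filterlim_comp; [apply filterlim_fst|exact Hv]. }
    assert (Snd : forall v : R -> R, continuous v t0 ->
      filterlim (fun z : R2 * R => v (snd z)) (filter_prod F (locally t0)) (locally (v t0))).
    { intros v Hv. eapply filterlim_comp; [apply filterlim_snd|exact Hv]. }
    assert (Hlim : filterlim (fun z : R2 * R => wx (fst z) * fst (tangent gamma (snd z))
      + wy (fst z) * snd (tangent gamma (snd z))) (filter_prod F (locally t0)) (locally k)).
    { eapply filterlim_comp_2; [| |exact (filterlim_plus (V := R_NormedModule) _ _)];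
        (eapply filterlim_comp_2; [| |exact (filterlim_mult (K := R_AbsRing) _ _)]);
        [apply Fst, H1|apply (Snd _ (tangent1_continuous t0))
        |apply Fst, H2|apply (Snd _ (tangent2_continuous t0))]. }
    destruct (Hlim _ (locally_Rabs k (Rabs k / 2) ltac:(lra))) as [Q S HQ HS HQS].
    apply locally_R2 in HQ. destruct HQ as (r & Hr & HQ).
    assert (Hr2 : 0 < r / 2) by lra.
    destruct (filter_and _ _ (near_curve_point t0 (r / 2) Hr2) HS) as [be Hbe].
    destruct (ex_small alpha be 1 1) as (h & Hh); try apply cond_pos; try lra.
    (* On the arc of length [h] lifted by [b < r / 2] the tangential derivative
       of [w] stays within [Rabs k / 2] of [k]. *)
    assert (Hder : forall t b, t0 <= t <= t0 + h -> 0 < b <= b0 -> b < r / 2 ->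
      exterior D (displace (gamma t) b n) /\
      Rabs (wx (displace (gamma t) b n) * fst (tangent gamma t)
        + wy (displace (gamma t) b n) * snd (tangent gamma t) - k) < Rabs k / 2).
    { intros t b Ht Hb Hbr.
      assert (Hx : exterior D (displace (gamma t) b n))
        by (apply Hcol; [apply Rabs_def1|]; lra).
      split; [exact Hx|]. destruct (Hbe t) as [[G1 G2] HSt]; [in_ball|].
      destruct (displace_near (gamma t) n b (r / 2) Hn ltac:(lra)) as [K1 K2].
      apply Rabs_def2 in G1, G2, K1, K2.
      apply (HQS (displace (gamma t) b n) t); [|exact HSt].
      apply HQ; [apply Rabs_def1; lra|apply Rabs_def1; lra|exact Hx]. }
    assert (Hsmall : forall t, exists d, 0 < d /\ forall b, 0 < b < d ->
      exterior D (displace (gamma t) b n) -> Rabs (w (displace (gamma t) b n)) < h * Rabs k / 8).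
    { intros t. destruct (exterior_limit_near w (gamma t) 0 (h * Rabs k / 8)) as (d & Hd & L).
      - apply Hw0, curve_boundary.
      - assert (0 < h * Rabs k) by (apply Rmult_lt_0_compat; lra). lra.
      - exists d. split; [exact Hd|]. intros b Hb Hx.
        rewrite <- (Rminus_0_r (w _)). apply L; [exact Hx| |];
          apply (displace_near _ n b d Hn); lra. }
    destruct (Hsmall t0) as (d1 & Hd1 & S1). destruct (Hsmall (t0 + h)) as (d2 & Hd2 & S2).
    destruct (ex_small d1 d2 b0 (r / 2)) as (b & Hb); try lra.
    assert (Hphi : forall t, t0 <= t <= t0 + h -> is_derive (fun t => w (displace (gamma t) b n)) t
      (wx (displace (gamma t) b n) * fst (tangent gamma t)
        + wy (displace (gamma t) b n) * snd (tangent gamma t))).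
    { intros t Ht. destruct (Hder t b) as [Hx _]; try lra.
      apply (grad_chain (exterior D) w wx wy (fun t => curve1 t + b * fst n)
        (fun t => curve2 t + b * snd n)); [exact HE|exact Hw|exact Hx| |].
      - rewrite <- (Rplus_0_r (fst (tangent gamma t))).
        apply is_derive_plusR; [apply curve1_derive|apply @is_derive_const].
      - rewrite <- (Rplus_0_r (snd (tangent gamma t))).
        apply is_derive_plusR; [apply curve2_derive|apply @is_derive_const]. }
    destruct (MVT_cor2 _ _ t0 (t0 + h) ltac:(lra)
      (fun t Ht => proj1 (is_derive_Reals _ _ _) (Hphi t Ht))) as (c & Ec & Hc).
    destruct (Hder c b) as [_ Hest]; try lra.
    destruct (Hder t0 b) as [X1 _]; try lra. destruct (Hder (t0 + h) b) as [X2 _]; try lra.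
    assert (B1 := S1 b ltac:(lra) X1). assert (B2 := S2 b ltac:(lra) X2).
    set (dk := wx (displace (gamma c) b n) * fst (tangent gamma c)
        + wy (displace (gamma c) b n) * snd (tangent gamma c)) in *.
    assert (B3 : Rabs (dk * h) < h * Rabs k / 4).
    { replace (dk * h) with (w (displace (gamma (t0 + h)) b n) - w (displace (gamma t0) b n))
        by (rewrite Ec; ring).
      apply Rabs_def2 in B1. apply Rabs_def2 in B2. apply Rabs_def1; lra. }
    rewrite Rabs_mult, (Rabs_pos_eq h) in B3 by lra.
    assert (B4 : Rabs dk < Rabs k / 4) by (apply Rmult_lt_reg_l with h; lra).
    generalize (Rabs_triang_inv k dk). rewrite (Rabs_minus_sym k dk). lra. }
  destruct (orthogonal_to_unit n tau Hn Hnt) as (la & Et1 & Et2).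
  destruct (orthogonal_to_unit n (g1, g2) Hn Hg) as (mu & Eg1 & Eg2).
  cbn [fst snd] in Eg1, Eg2. unfold k in Hk. unfold dot in Hn.
  rewrite Et1, Et2, Eg1, Eg2 in Hk. rewrite Et1, Et2 in Htt.
  assert (Z : la * mu = 0).
  { transitivity (la * mu * (fst n * fst n + snd n * snd n)); [rewrite Hn|]; lra. }
  apply Rmult_integral in Z. destruct Z as [Z|Z].
  - rewrite Z in Htt. lra.
  - rewrite Eg1, Eg2, Z. split; ring.
Qed.

End Tangential.

(** * Solutions with opposite Cauchy data *)

Lemma exterior_limit_plus u v x l m :
  exterior_limit u x l -> exterior_limit v x m ->
  exterior_limit (fun y => u y + v y) x (l + m).
Proof.
  intros Hu Hv. unfold exterior_limit in *.
  apply (filterlim_comp_2 (G := locally l) (H := locally m) _ _ Rplus Hu Hv).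
  exact (filterlim_plus (V := R_NormedModule) l m).
Qed.

Lemma exterior_limit_mult u v x l m :
  exterior_limit u x l -> exterior_limit v x m ->
  exterior_limit (fun y => u y * v y) x (l * m).
Proof.
  intros Hu Hv. unfold exterior_limit in *.
  apply (filterlim_comp_2 (G := locally l) (H := locally m) _ _ Rmult Hu Hv).
  exact (filterlim_mult (K := R_AbsRing) l m).
Qed.

Lemma exterior_limit_const c x : exterior_limit (fun _ => c) x c.
Proof. apply filterlim_const. Qed.

Lemma exterior_limit_lin al be u v x l m :
  exterior_limit u x l -> exterior_limit v x m ->
  exterior_limit (lin al be u v) x (al * l + be * m).
Proof.
  intros Hu Hv. apply exterior_limit_plus; apply exterior_limit_mult; auto;
    apply exterior_limit_const.
Qed.

Lemma exterior_limit_of_zero u x l :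
  boundary D x -> exterior_limit u x l -> (forall y, exterior D y -> u y = 0) -> l = 0.
Proof.
  intros Hx Hl Hu. apply NNPP. intros Hn.
  destruct (exterior_limit_near u x l (Rabs l) Hl (Rabs_pos_lt _ Hn)) as (d & Hd & H).
  destruct (proj1 (hGamma x) Hx) as [t <-].
  destruct (normal_sides t) as (de & Hde & Hs).
  destruct (ex_small d de 1 1) as (s & Hs0); try lra.
  destruct (Hs s ltac:(lra)) as [Hy _].
  assert (B : Rabs (u (displace (gamma t) s (nu (gamma t))) - l) < Rabs l).
  { apply H; [exact Hy| |]; apply (displace_near _ _ s d (normal_unit t)); lra. }
  rewrite (Hu _ Hy) in B. unfold Rminus in B. rewrite Rplus_0_l, Rabs_Ropp in B. lra.
Qed.

Lemma curve_lipschitz : exists L, 0 <= L /\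
  (forall s t, 0 <= s <= T -> 0 <= t <= T ->
     Rabs (curve1 s - curve1 t) <= L * Rabs (s - t)) /\
  (forall s t, 0 <= s <= T -> 0 <= t <= T ->
     Rabs (curve2 s - curve2 t) <= L * Rabs (s - t)).
Proof.
  assert (HT := period_pos).
  assert (K : forall g g', (forall t, is_derive g t (g' t)) -> (forall t, continuous g' t) ->
    exists L, 0 <= L /\ forall s t, 0 <= s <= T -> 0 <= t <= T ->
      Rabs (g s - g t) <= L * Rabs (s - t)).
  { intros g g' Hg Hg'.
    destruct (continuity_ab_maj (fun t => Rabs (g' t)) 0 T) as [tm [Hm _]]; [lra| |].
    { intros t _. apply continuous_pt, (continuous_comp g' Rabs); [apply Hg'|apply continuous_Rabs]. }
    exists (Rabs (g' tm)). split; [apply Rabs_pos|]. intros s t Hs Ht.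
    destruct (MVT_gen g t s g') as [c [Hc E]].
    - intros; apply Hg.
    - intros; apply continuous_pt. exact (continuous_of_derive _ _ _ (Hg x)).
    - rewrite E, Rabs_mult. apply Rmult_le_compat_r; [apply Rabs_pos|]. apply Hm.
      unfold Rmin, Rmax in Hc. destruct Rle_dec; lra. }
  destruct (K _ _ curve1_derive tangent1_continuous)
    as (L1 & P1 & H1).
  destruct (K _ _ curve2_derive tangent2_continuous)
    as (L2 & P2 & H2).
  exists (L1 + L2). split; [lra|].
  split; intros s t Hs Ht.
  - eapply Rle_trans; [apply H1; assumption|]. generalize (Rabs_pos (s - t)). nra.
  - eapply Rle_trans; [apply H2; assumption|]. generalize (Rabs_pos (s - t)). nra.
Qed.

(** A box missing the curve lies either in [D], where the extension is zero, or
    in the exterior, where it is divergence-free; the curve itself is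
    removable. *)
Lemma zero_ext_box_flux (P Px Py Q Qx Qy : R2 -> R) :
  has_grad (exterior D) P Px Py -> has_grad (exterior D) Q Qx Qy ->
  (forall x, boundary D x -> exterior_limit P x 0) ->
  (forall x, boundary D x -> exterior_limit Q x 0) ->
  (forall z, exterior D z -> Px z + Qy z = 0) ->
  forall a b c d, a < b -> c < d ->
    box_flux (zero_ext P) (zero_ext Q) a b c d = 0.
Proof.
  intros GP GQ BP BQ Hdiv a b c d Hab Hcd.
  assert (CP' := zero_ext_continuous P (fun x => grad_continuous _ P Px Py x HE GP) BP).
  assert (CQ' := zero_ext_continuous Q (fun x => grad_continuous _ Q Qx Qy x HE GQ) BQ).
  destruct curve_lipschitz as (L & HL & Lip1 & Lip2).
  apply (box_flux_removable_curve _ _ CP' CQ' curve1 curve2 T L);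
    auto; [apply period_pos| |].
  - intros t _. rewrite curve_pair.
    assert (N : ~ exterior D (gamma t)).
    { intros K. exact (exterior_not_boundary _ K (curve_boundary t)). }
    rewrite !zero_ext_off by exact N. auto.
  - clear a b c d Hab Hcd. intros a b c d Hab Hcd Hoff.
    assert (Hbd : forall x, box a b c d x -> ~ boundary D x).
    { intros x Hx Hb. destruct (proj1 (hGamma x) Hb) as [t Et].
      destruct (curve_representative 0 t) as (t' & Ht' & Et').
      apply (Hoff t'); [lra|]. rewrite curve_pair, Et', Et. exact Hx. }
    assert (Hsame : forall x, box a b c d x -> (D (a, c) <-> D x)).
    { intros x [Hx1 Hx2]. apply segment_in_D. intros l Hl. apply Hbd.
      split; simpl; split; nra. }
    destruct (classic (D (a, c))) as [Hin|Hout].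
    + assert (Z : forall x, box a b c d x -> ~ exterior D x).
      { intros x Hx K. apply (exterior_not_D x K). apply (Hsame x Hx), Hin. }
      unfold box_flux. rewrite !RInt_zero; [ring| | | |];
        intros t Ht; rewrite Rmin_left, Rmax_right in Ht by lra;
        apply zero_ext_off, Z; split; simpl; lra.
    + assert (Z : forall x, box a b c d x -> exterior D x).
      { intros x Hx. destruct (D_boundary_exterior x) as [K|[K|K]]; [|destruct (Hbd x Hx K)|exact K].
        destruct Hout. apply (Hsame x Hx), K. }
      apply (box_flux_divergence_free _ _ CP' CQ' (exterior D) Px Qy); auto;
        try (intros z Hz; first [apply (GP z Hz)|apply (GQ z Hz)]).
      * intros z Hz. apply is_derive_ext_loc with (fun s => P (s, snd z)); [|apply (GP z Hz)].
        generalize (locally_slice_1 _ _ (HE z Hz)). apply filter_imp. intros s Hs.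
        symmetry. apply zero_ext_exterior, Hs.
      * intros z Hz. apply is_derive_ext_loc with (fun s => Q (fst z, s)); [|apply (GQ z Hz)].
        generalize (locally_slice_2 _ _ (HE z Hz)). apply filter_imp. intros s Hs.
        symmetry. apply zero_ext_exterior, Hs.
Qed.

(** At a positive maximum of [p] its Laplacian [k^2 p] would be positive; the
    decay keeps the maximum from escaping to infinity. *)
Lemma modified_uniqueness (k C r2 : R) (p px py : R2 -> R) :
  0 < k -> 0 <= C ->
  eigenfunction (exterior D) (k ^ 2) p px py ->
  (forall x, boundary D x -> exterior_limit p x 0) ->
  (forall x, r2 ^ 2 < sqnorm x -> Rabs (p x) <= C / sqnorm x) ->
  forall x, exterior D x -> p x <= 0.
Proof.
  intros Hk HC (pxx & pxy & pyx & pyy & Hp & Hpx & Hpy & Heq) Hb Hdec.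
  apply (maximum_principle (exterior D) p px py pxx pyy).
  - apply exterior_open.
  - intros x Hx. apply (grad_continuous (exterior D) p px py); auto.
  - intros x Hx. apply Hp, Hx.
  - intros x Hx. apply Hp, Hx.
  - intros x Hx. apply Hpx, Hx.
  - intros x Hx. apply Hpy, Hx.
  - intros x Hx Hpos. rewrite Heq by exact Hx. apply Rmult_lt_0_compat; [apply pow_lt|]; assumption.
  - intros z eta Hz Heta. destruct (D_boundary_exterior z) as [Q|[Q|Q]].
    + generalize (HD z Q). apply filter_imp. intros y Hy Hy'.
      destruct (exterior_not_D y Hy' Hy).
    + apply (Hb z Q (fun s => s < eta)), (open_lt eta), Heta.
    + contradiction.
  - intros eta Heta. exists (1 + (r2 ^ 2 + C / eta)). intros x Hx Hlt.
    assert (Hce : 0 <= C / eta) by (apply Rdiv_le_0_compat; assumption).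
    assert (H2 := pow2_ge_0 r2).
    assert (Hs : sqnorm x <= r2 ^ 2 + C / eta).
    { destruct (Rle_lt_dec (sqnorm x) (r2 ^ 2)) as [L|L]; [lra|].
      assert (B := Rle_trans _ _ _ (Rle_abs _) (Hdec x L)).
      assert (0 < sqnorm x) by lra.
      assert (eta * sqnorm x < C).
      { apply Rlt_le_trans with (C / sqnorm x * sqnorm x); [|right; field; lra].
        apply Rmult_lt_compat_r; lra. }
      assert (sqnorm x <= C / eta); [|lra].
      apply Rmult_le_reg_l with eta; [exact Heta|].
      replace (eta * (C / eta)) with C by (field; lra). lra. }
    assert (K : forall y, y ^ 2 <= r2 ^ 2 + C / eta -> Rabs y <= 1 + (r2 ^ 2 + C / eta)).
    { intros y Hy. rewrite <- (pow2_abs y) in Hy. generalize (Rabs_pos y). nra. }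
    unfold sqnorm in Hs. generalize (pow2_ge_0 (fst x)) (pow2_ge_0 (snd x)).
    intros A B. split; apply K; lra.
Qed.

Definition opposite_cauchy_data (u ux uy v vx vy : R2 -> R) : Prop :=
  forall x, boundary D x -> exists l g h,
    exterior_limit u x l /\ exterior_limit ux x g /\ exterior_limit uy x h /\
    exterior_limit v x (- l) /\ exterior_limit vx x (- g) /\ exterior_limit vy x (- h).

Section OppositeCauchyData.

Context (k : R) (Hk : 0 < k).
Context (a ax ay b bx by_ p px py q qx qy : R2 -> R).
Context (Ha : eigenfunction (exterior D) (- k ^ 2) a ax ay)
  (Hb : eigenfunction (exterior D) (- k ^ 2) b bx by_)
  (Hp : eigenfunction (exterior D) (k ^ 2) p px py)
  (Hq : eigenfunction (exterior D) (k ^ 2) q qx qy).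
Context (Hap : opposite_cauchy_data a ax ay p px py)
  (Hbq : opposite_cauchy_data b bx by_ q qx qy).
Context (Hrad_ab : radiates k a ax ay b bx by_) (Hrad_pq : radiates k p px py q qx qy).

Definition wronskian (u u' v v' : R2 -> R) : R2 -> R :=
  lin 1 (-1) (fun x => u x * v' x) (fun x => v x * u' x).

Lemma exterior_far : exists R0, 0 <= R0 /\ forall r t, R0 < r -> exterior D (circle r t).
Proof.
  destruct (proj2 (proj2 (proj2 hD))) as [M HM].
  destruct (ex_large 0 M 0 0) as (R0 & HR0). exists R0. split; [lra|]. intros r t Hr Hc.
  destruct (Hc (fun x => R0 ^ 2 < sqnorm x)) as (y & Hy & Hlt).
  { apply (continuous_gt sqnorm); [apply sqnorm_continuous|]. rewrite sqnorm_polar. nra. }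
  assert (B := HM y Hy). unfold norm2 in B.
  replace (dot y y) with (sqnorm y) in B by (unfold dot, sqnorm; ring).
  rewrite sqnorm_dist2 in B, Hlt. assert (N := dist2_nonneg (0, 0) y).
  rewrite sqrt_pow2 in B by exact N. nra.
Qed.

Lemma wronskian_divergence_free (E : R2 -> Prop) (c : R) (u ux uy v vx vy : R2 -> R) :
  open E -> eigenfunction E c u ux uy -> eigenfunction E c v vx vy ->
  exists Px Py Qx Qy, has_grad E (wronskian u ux v vx) Px Py /\
    has_grad E (wronskian u uy v vy) Qx Qy /\ forall x, E x -> Px x + Qy x = 0.
Proof.
  intros HE' (uxx & uxy & uyx & uyy & U1 & U2 & U3 & U4)
    (vxx & vxy & vyx & vyy & V1 & V2 & V3 & V4).
  do 4 eexists. split; [|split].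
  - apply has_grad_lin; apply has_grad_mult; eassumption.
  - apply has_grad_lin; apply has_grad_mult; eassumption.
  - intros x Hx. unfold lin.
    transitivity (u x * (vxx x + vyy x) - v x * (uxx x + uyy x)); [ring|].
    rewrite U4, V4 by exact Hx. ring.
Qed.

Definition angular_flux (u ux uy v vx vy : R2 -> R) (r t : R) : R :=
  u (circle r t) * radial vx vy (0, 0) r t
  - v (circle r t) * radial ux uy (0, 0) r t.

Definition flux_gap (r t : R) : R :=
  angular_flux a ax ay b bx by_ r t - angular_flux p px py q qx qy r t.

(** Both Wronskian fields are divergence-free, and they agree on the boundary
    because they are quadratic in data that are opposite to each other. *)
Lemma equal_circle_flux (R0 r t0 : R) :
  (forall r t, R0 < r -> exterior D (circle r t)) -> R0 < r ->
  is_RInt (fun t => r * flux_gap r (t0 + t)) (- PI) PI 0.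
Proof.
  intros Hfar Hr.
  destruct (wronskian_divergence_free _ _ _ _ _ _ _ _ HE Ha Hb)
    as (Px & Py & Qx & Qy & GP & GQ & Hdiv).
  destruct (wronskian_divergence_free _ _ _ _ _ _ _ _ HE Hp Hq)
    as (Px' & Py' & Qx' & Qy' & GP' & GQ' & Hdiv').
  set (P := lin 1 (-1) (wronskian a ax b bx) (wronskian p px q qx)).
  set (Q := lin 1 (-1) (wronskian a ay b by_) (wronskian p py q qy)).
  assert (GP2 := has_grad_lin _ 1 (-1) _ _ _ _ _ _ GP GP'). fold P in GP2.
  assert (GQ2 := has_grad_lin _ 1 (-1) _ _ _ _ _ _ GQ GQ'). fold Q in GQ2.
  assert (Lim : forall x (u u' v v' s s' w w' : R2 -> R) l l' m m',
    exterior_limit u x l -> exterior_limit u' x l' ->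
    exterior_limit v x m -> exterior_limit v' x m' ->
    exterior_limit s x (- l) -> exterior_limit s' x (- l') ->
    exterior_limit w x (- m) -> exterior_limit w' x (- m') ->
    exterior_limit (lin 1 (-1) (wronskian u u' v v') (wronskian s s' w w')) x 0).
  { intros. replace 0 with (1 * (1 * (l * m') + (-1) * (m * l'))
      + (-1) * (1 * (- l * - m') + (-1) * (- m * - l'))) by ring.
    apply exterior_limit_lin; apply exterior_limit_lin; apply exterior_limit_mult; assumption. }
  assert (BP : forall x, boundary D x -> exterior_limit P x 0).
  { intros x Hx. destruct (Hap x Hx) as (l & g & h & L1 & L2 & L3 & L4 & L5 & L6).
    destruct (Hbq x Hx) as (l' & g' & h' & M1 & M2 & M3 & M4 & M5 & M6).
    apply (Lim x a ax b bx p px q qx l g l' g'); assumption. }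
  assert (BQ : forall x, boundary D x -> exterior_limit Q x 0).
  { intros x Hx. destruct (Hap x Hx) as (l & g & h & L1 & L2 & L3 & L4 & L5 & L6).
    destruct (Hbq x Hx) as (l' & g' & h' & M1 & M2 & M3 & M4 & M5 & M6).
    apply (Lim x a ay b by_ p py q qy l h l' h'); assumption. }
  eapply is_RInt_ext; [|apply (circle_flux_zero (zero_ext P) (zero_ext Q)
    (zero_ext_continuous P (fun x => grad_continuous _ _ _ _ x HE GP2) BP)
    (zero_ext_continuous Q (fun x => grad_continuous _ _ _ _ x HE GQ2) BQ)) with (r := r) (t0 := t0)].
  - intros t _. cbv beta. rewrite !zero_ext_exterior by (apply Hfar; exact Hr).
    unfold P, Q, wronskian, lin, flux_gap, angular_flux, radial.
    match goal with |- ?x = ?y => change (@eq R x y) end. ring.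
  - apply (zero_ext_box_flux _ _ _ _ _ _ GP2 GQ2 BP BQ).
    intros z Hz. unfold lin. generalize (Hdiv z Hz) (Hdiv' z Hz). lra.
Qed.

Definition circle_density (r t : R) : R :=
  a (circle r t) ^ 2 + radial ax ay (0, 0) r t ^ 2
  + (b (circle r t) ^ 2 + radial bx by_ (0, 0) r t ^ 2).

Lemma circle_mean_continuous (u ux uy : R2 -> R) (r t0 : R) :
  has_grad (exterior D) u ux uy -> (forall t, exterior D (circle r t)) ->
  forall t, continuous (fun t => u (circle r (t0 + t)) ^ 2
    + radial ux uy (0, 0) r (t0 + t) ^ 2) t.
Proof.
  intros Hu Hin t.
  assert (C1 := polar_continuous_t u (0, 0) t0 r
    (fun s => grad_continuous _ u ux uy _ HE Hu (Hin s)) t).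
  assert (C2 := radial_continuous_t ux uy (0, 0) t0 r
    (fun s => proj1 (proj2 (proj2 (Hu _ (Hin s)))))
    (fun s => proj2 (proj2 (proj2 (Hu _ (Hin s))))) t). cont.
Qed.

Lemma circle_density_continuous (r t0 : R) : (forall t, exterior D (circle r t)) ->
  forall t, continuous (fun t => circle_density r (t0 + t)) t.
Proof.
  intros Hin t. unfold circle_density. apply continuous_plusR;
    apply circle_mean_continuous; try exact Hin; eapply eigenfunction_grad; eassumption.
Qed.

(** Expanding [|u' - i k u|^2] for [u = a + i b] leaves
    [|u'|^2 + k^2 |u|^2] minus [2 k] times the flux density of [u]. The flux of
    [u] equals that of [p + i q], which tends to zero because [p] and [q] are
    [O(r^-2)]. *)
Lemma circle_density_decay (t0 eps : R) : 0 < eps ->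
  exists r0, forall r, r0 < r ->
    r * RInt (fun t => circle_density r (t0 + t)) (- PI) PI < eps.
Proof.
  intros Heps. destruct exterior_far as (R0 & HR0 & Hfar).
  destruct (modified_radiating_decay (exterior D) k R0 p px py q qx qy Hk HR0 HE Hp Hq Hfar Hrad_pq)
    as (C & r2 & HC & Hr2 & Hr2R & Hdec).
  assert (HPI := PI_RGT_0).
  destruct (ex_small 1 (k ^ 2) 1 1) as (m & Hm); try lra; [apply pow_lt, Hk|].
  set (eta := m * eps / (4 * PI)).
  assert (Heta : 0 < eta).
  { apply Rdiv_lt_0_compat; [apply Rmult_lt_0_compat|]; lra. }
  (* Each of the two radiation terms is at most [de ^ 2 <= eta / 6], and the
     flux density of [p + i q] contributes at most [eta / 3] beyond [r5]. *)
  destruct (ex_small 1 (eta / 6) 1 1) as (de & Hde); try lra.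
  destruct (Hrad_ab de (proj1 Hde)) as [r3 Hr3].
  destruct (Hrad_pq 1 Rlt_0_1) as [r4 Hr4].
  set (K := 2 * k * (2 * C + 2 * k * C ^ 2)).
  assert (HK : 0 <= K).
  { unfold K. assert (0 <= C ^ 2) by apply pow2_ge_0.
    repeat apply Rmult_le_pos; try lra. nra. }
  set (r5 := 3 * K / eta).
  destruct (ex_large r2 r3 r4 r5) as (r6 & Hr6). exists r6. intros r Hr.
  assert (Hr1 : 1 < r) by lra.
  assert (Hpt : forall t, r * circle_density r t <=
    (eta + 2 * k * (r * flux_gap r t)) / m).
  { intros t.
    destruct (Hr3 r t ltac:(lra)) as [X1 X2]. destruct (Hr4 r t ltac:(lra)) as [Y1 Y2].
    destruct (Hdec (circle r t)) as [Z1 Z2].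
    { rewrite sqnorm_polar. nra. }
    rewrite sqnorm_polar in Z1, Z2.
    unfold circle_density, flux_gap, angular_flux.
    set (A := a (circle r t)) in *. set (B := b (circle r t)) in *.
    set (A' := radial ax ay (0, 0) r t) in *. set (B' := radial bx by_ (0, 0) r t) in *.
    set (P := p (circle r t)) in *. set (Q := q (circle r t)) in *.
    set (P' := radial px py (0, 0) r t) in *. set (Q' := radial qx qy (0, 0) r t) in *.
    assert (S : sqrt r * sqrt r = r) by (apply sqrt_sqrt; lra).
    assert (S1 : 1 <= sqrt r) by (apply sqrt_ge_1; lra).
    assert (Hsq : forall X, Rabs (sqrt r * X) < de -> r * X ^ 2 <= eta / 6).
    { intros X HX. replace (r * X ^ 2) with ((sqrt r * X) ^ 2)
        by (rewrite Rpow_mult_distr; simpl; rewrite !Rmult_1_r, S; reflexivity).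
      rewrite <- pow2_abs. generalize (Rabs_pos (sqrt r * X)). nra. }
    assert (X1' := Hsq _ X1). assert (X2' := Hsq _ X2).
    rewrite Rabs_mult, (Rabs_pos_eq (sqrt r)) in Y1, Y2 by lra.
    assert (Y1' : Rabs (P' + k * Q) <= 1) by (generalize (Rabs_pos (P' + k * Q)); nra).
    assert (Y2' : Rabs (Q' - k * P) <= 1) by (generalize (Rabs_pos (Q' - k * P)); nra).
    assert (Hrr : 1 <= r ^ 2) by nra.
    assert (HPQ : r * (P * Q' - Q * P') <= (2 * C + 2 * k * C ^ 2) / r).
    { set (c := C / r ^ 2) in *.
      assert (Hc : 0 <= c <= C).
      { split; [apply Rdiv_le_0_compat; lra|].
        apply Rmult_le_reg_r with (r ^ 2); [lra|]. unfold c.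
        replace (C / r ^ 2 * r ^ 2) with C by (field; lra). nra. }
      replace ((2 * C + 2 * k * C ^ 2) / r) with (r * (2 * c + 2 * (k * (c * C))))
        by (unfold c; field; lra).
      apply Rmult_le_compat_l; [lra|].
      apply Rabs_le_between in Z1, Z2, Y1', Y2'.
      assert (E1 : P * (Q' - k * P) <= c) by nra.
      assert (E2 : - (Q * (P' + k * Q)) <= c) by nra.
      assert (E3 : k * (P ^ 2 + Q ^ 2) <= k * (2 * (c * C)))
        by (apply Rmult_le_compat_l; [lra|nra]).
      lra. }
    assert (HPQ' : 2 * k * (r * (P * Q' - Q * P')) <= eta / 3).
    { apply Rle_trans with (2 * k * ((2 * C + 2 * k * C ^ 2) / r)).
      - apply Rmult_le_compat_l; lra.
      - replace (2 * k * ((2 * C + 2 * k * C ^ 2) / r)) with (K / r) by (unfold K; field; lra).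
        apply Rmult_le_reg_r with r; [lra|].
        replace (K / r * r) with K by (field; lra).
        assert (R5 : r5 * eta <= r * eta) by (apply Rmult_le_compat_r; lra).
        unfold r5 in R5. replace (3 * K / eta * eta) with (3 * K) in R5 by (field; lra). lra. }
    apply Rmult_le_reg_l with m; [lra|].
    replace (m * ((eta + 2 * k * (r * (A * B' - B * A' - (P * Q' - Q * P')))) / m))
      with (eta + 2 * k * (r * (A * B' - B * A' - (P * Q' - Q * P')))) by (field; lra).
    assert (I1 : m * (r * (A ^ 2 + A' ^ 2 + (B ^ 2 + B' ^ 2)))
      <= r * (A' ^ 2 + B' ^ 2 + k ^ 2 * (A ^ 2 + B ^ 2))).
    { replace (m * (r * (A ^ 2 + A' ^ 2 + (B ^ 2 + B' ^ 2))))
        with (r * (m * (A' ^ 2 + B' ^ 2) + m * (A ^ 2 + B ^ 2))) by ring.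
      apply Rmult_le_compat_l; [lra|].
      generalize (pow2_ge_0 A) (pow2_ge_0 B) (pow2_ge_0 A') (pow2_ge_0 B'). nra. }
    assert (I2 : r * (A' ^ 2 + B' ^ 2 + k ^ 2 * (A ^ 2 + B ^ 2))
      = r * (A' + k * B) ^ 2 + r * (B' - k * A) ^ 2 + 2 * k * (r * (A * B' - B * A'))) by ring.
    lra. }
  assert (Hflux : forall t0, is_RInt (fun t => r * flux_gap r (t0 + t)) (- PI) PI 0).
  { intros s0. apply (equal_circle_flux R0); [exact Hfar|lra]. }
  assert (Hbound : is_RInt (fun t => (eta + 2 * k * (r * flux_gap r (t0 + t))) / m) (- PI) PI ((2 * PI * eta + 2 * k * 0) / m)).
  { apply (is_RInt_ext (fun t => / m * (eta + 2 * k * (r * flux_gap r (t0 + t))))).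
    { intros t _. apply Rmult_comm. }
    replace ((2 * PI * eta + 2 * k * 0) / m) with (/ m * ((PI - - PI) * eta + 2 * k * 0))
      by (field; lra).
    apply is_RInt_scalR, is_RInt_plusR.
    - apply (is_RInt_const (V := R_NormedModule)).
    - apply is_RInt_scalR, Hflux. }
  apply Rle_lt_trans with ((2 * PI * eta + 2 * k * 0) / m).
  - apply (is_RInt_le (fun t => r * circle_density r (t0 + t)) _ (- PI) PI _ _ ltac:(lra)) with (2 := Hbound).
    + apply is_RInt_scalR, RInt_is. apply circle_density_continuous. intros; apply Hfar; lra.
    + intros t _. apply Hpt.
  - unfold eta. replace ((2 * PI * (m * eps / (4 * PI)) + 2 * k * 0) / m) with (eps / 2)
      by (field; lra). lra.
Qed.

Lemma helmholtz_zero_far :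
  exists R0, 0 <= R0 /\ forall r t, R0 < r ->
    a (circle r t) = 0 /\ b (circle r t) = 0.
Proof.
  destruct exterior_far as (R0 & HR0 & Hfar). exists R0. split; [exact HR0|].
  assert (Hgen : forall u ux uy, eigenfunction (exterior D) (- k ^ 2) u ux uy ->
    (forall r t, u (circle r t) ^ 2 + radial ux uy (0, 0) r t ^ 2 <= circle_density r t) ->
    forall r t, R0 < r -> u (circle r t) = 0).
  { intros u ux uy Hu Hle. apply (rellich (exterior D) k R0 u ux uy HE Hk HR0 Hu Hfar).
    intros t0 eps Heps. destruct (circle_density_decay t0 eps Heps) as [r0 Hr0].
    destruct (ex_large r0 R0 0 0) as (r1 & Hr1). exists r1. intros r Hr.
    apply Rle_lt_trans with (2 := Hr0 r ltac:(lra)).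
    apply Rmult_le_compat_l; [lra|].
    apply RInt_le; [generalize PI_RGT_0; lra| | |].
    - apply ex_RInt_cont, circle_mean_continuous; [eapply eigenfunction_grad; eassumption|].
      intros; apply Hfar; lra.
    - apply ex_RInt_cont, circle_density_continuous. intros; apply Hfar; lra.
    - intros t _. apply Hle. }
  intros r t Hr. split.
  - apply (Hgen a ax ay Ha); [|exact Hr]. intros s t'. unfold circle_density.
    generalize (pow2_ge_0 (b (circle s t'))) (pow2_ge_0 (radial bx by_ (0, 0) s t')). lra.
  - apply (Hgen b bx by_ Hb); [|exact Hr]. intros s t'. unfold circle_density.
    generalize (pow2_ge_0 (a (circle s t'))) (pow2_ge_0 (radial ax ay (0, 0) s t')). lra.
Qed.

(** The set where [u] vanishes locally is open; by uniqueness on discs so is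
    its complement. *)
Lemma unique_continuation (R0 : R) (u ux uy : R2 -> R) :
  eigenfunction (exterior D) (- k ^ 2) u ux uy ->
  (forall r t, R0 < r -> u (circle r t) = 0) -> 0 <= R0 ->
  forall x, exterior D x -> u x = 0.
Proof.
  intros Hu Hfar HR0 x Hx.
  set (Z := fun x : R2 => locally x (fun y => u y = 0)).
  set (V := fun x => exterior D x /\ ~ Z x).
  assert (HZ : open Z).
  { intros y Hy. exact (locally_locally _ _ Hy). }
  assert (HV : open V).
  { intros y [Hy Hny]. destruct (open_contains_disc _ y HE Hy) as (rho & Hrho & Hin).
    generalize (filter_and _ _ (HE y Hy) (dist2_small y (rho / 2) ltac:(lra))).
    apply filter_imp. intros w [Hw Hd]. split; [exact Hw|]. intros Hzw. apply Hny.
    assert (Hsym : dist2 w y = dist2 y w).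
    { unfold dist2, Cmod. simpl fst; simpl snd. f_equal. ring. }
    assert (Hall : forall v, dist2 w v < rho / 2 -> u v = 0).
    { apply (disc_unique_continuation (exterior D) k u ux uy w (rho / 2) HE Hk Hu); [|exact Hzw].
      intros v Hv. apply Hin.
      assert (Tr := dist2_triangle y w v). lra. }
    assert (Q : locally y (fun v => dist2 w v < rho / 2)).
    { assert (L : dist2 w y < rho / 2) by (rewrite Hsym; exact Hd).
      generalize (dist2_small y (rho / 2 - dist2 w y) ltac:(lra)). apply filter_imp.
      intros v Hv. assert (Tr := dist2_triangle w y v). lra. }
    unfold Z. revert Q. apply filter_imp. exact Hall. }
  destruct (classic (Z x)) as [Hz|Hz]; [exact (locally_singleton _ (fun y : R2 => u y = 0) Hz)|].
  exfalso.
  refine (exterior_connected Z V HZ HV _ _ _ x Hx (conj Hx Hz)).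
  - intros y Hy. destruct (classic (Z y)); [left|right; split]; assumption.
  - intros y Hy [H1 [_ H2]]. contradiction.
  - destruct exterior_far as (R1 & HR1 & HE1).
    destruct (ex_large R0 R1 0 0) as (r & Hr).
    exists (circle r 0). split; [apply HE1; lra|].
    unfold Z. generalize (continuous_gt sqnorm (circle r 0) (R0 ^ 2)
      (sqnorm_continuous _) ltac:(rewrite sqnorm_polar; nra)).
    apply filter_imp. intros y. apply (sqnorm_far (fun y => u y = 0) R0 HR0 Hfar).
Qed.

Theorem opposite_cauchy_data_zero x : exterior D x ->
  a x = 0 /\ b x = 0 /\ p x = 0 /\ q x = 0.
Proof.
  intros Hx. destruct helmholtz_zero_far as (R0 & HR0 & Hfar).
  assert (Za : forall y, exterior D y -> a y = 0).
  { apply (unique_continuation R0 a ax ay Ha); [|exact HR0]. intros; apply Hfar; assumption. }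
  assert (Zb : forall y, exterior D y -> b y = 0).
  { apply (unique_continuation R0 b bx by_ Hb); [|exact HR0]. intros; apply Hfar; assumption. }
  destruct exterior_far as (R1 & HR1 & HE1).
  destruct (modified_radiating_decay (exterior D) k R1 p px py q qx qy Hk HR1 HE Hp Hq HE1 Hrad_pq)
    as (C & r2 & HC & Hr2 & _ & Hdec).
  assert (Hgen : forall u ux uy v vx vy, eigenfunction (exterior D) (k ^ 2) v vx vy ->
    opposite_cauchy_data u ux uy v vx vy -> (forall y, exterior D y -> u y = 0) ->
    (forall y, r2 ^ 2 < sqnorm y -> Rabs (v y) <= C / sqnorm y) ->
    v x = 0).
  { intros u ux uy v vx vy Hv Hc Hu Hd.
    assert (Hlim : forall y, boundary D y -> exterior_limit v y 0).
    { intros y Hy. destruct (Hc y Hy) as (l & g & h & L1 & _ & _ & L4 & _).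
      assert (Zl := exterior_limit_of_zero u y l Hy L1 Hu). rewrite Zl, Ropp_0 in L4. exact L4. }
    apply Rle_antisym.
    - apply (modified_uniqueness k C r2 v vx vy); assumption.
    - assert (lin (-1) 0 v v x <= 0); [|unfold lin in *; lra].
      apply (modified_uniqueness k C r2 _ (lin (-1) 0 vx vx) (lin (-1) 0 vy vy)); auto.
      + apply eigenfunction_lin; assumption.
      + intros y Hy.
        assert (L := exterior_limit_lin (-1) 0 v v y 0 0 (Hlim y Hy) (Hlim y Hy)).
        replace (-1 * 0 + 0 * 0) with 0 in L by ring. exact L.
      + intros y Hy. unfold lin. replace (-1 * v y + 0 * v y) with (- v y) by ring.
        rewrite Rabs_Ropp. auto. }
  split; [auto|]. split; [auto|]. split.
  - apply (Hgen a ax ay p px py); auto. intros; apply Hdec; assumption.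
  - apply (Hgen b bx by_ q qx qy); auto. intros; apply Hdec; assumption.
Qed.

End OppositeCauchyData.

(** * The coupled boundary value problem *)

Section Difference.

Context (kappa : R) (f1 f2 : R2 -> C).
Context (vH vM wH wM : R2 -> C).
Context (hv : coupled_bvp D nu kappa f1 f2 vH vM) (hw : coupled_bvp D nu kappa f1 f2 wH wM).

Lemma part_boundary_value (part : C -> R) (g : R2 -> C) (x : R2) (l : C) :
  real_linear_part part -> boundary_value D g x l -> exterior_limit (fun y => part (g y)) x (part l).
Proof. intros Hpart H. apply part_filterlim; [exact Hpart|apply within_filter, locally_filter|exact H]. Qed.

Definition part_diff (part : C -> R) (v w : R2 -> C) : R2 -> R :=
  lin 1 (-1) (fun x => part (v x)) (fun x => part (w x)).

Lemma part_diff_eigenfunction (part : C -> R) (c : R) (v w : R2 -> C) :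
  real_linear_part part -> classical_regularity D v -> classical_regularity D w ->
  (forall x, exterior D x -> laplacian v x = (RtoC c * v x)%C) ->
  (forall x, exterior D x -> laplacian w x = (RtoC c * w x)%C) ->
  eigenfunction (exterior D) c
    (part_diff part v w) (part_diff part (d1 v) (d1 w)) (part_diff part (d2 v) (d2 w)).
Proof.
  intros Hp [Hv _] [Hw _] Lv Lw. apply eigenfunction_lin; apply part_eigenfunction; assumption.
Qed.

Lemma helmholtz_difference part : real_linear_part part ->
  eigenfunction (exterior D) (- kappa ^ 2)
    (part_diff part vH wH) (part_diff part (d1 vH) (d1 wH)) (part_diff part (d2 vH) (d2 wH)).
Proof.
  assert (K : forall A B : C, (A + RtoC (kappa ^ 2) * B)%C = RtoC 0 ->
    A = (RtoC (- kappa ^ 2) * B)%C).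
  { intros A B H. replace A with (A + RtoC (kappa ^ 2) * B - RtoC (kappa ^ 2) * B)%C by ring.
    rewrite H, RtoC_opp. ring. }
  intros Hp. apply part_diff_eigenfunction; [exact Hp
    |exact (bvp_regular_H _ _ _ _ _ _ _ hv)|exact (bvp_regular_H _ _ _ _ _ _ _ hw)| |];
    intros x Hx; apply K.
  - exact (bvp_helmholtz _ _ _ _ _ _ _ hv x Hx).
  - exact (bvp_helmholtz _ _ _ _ _ _ _ hw x Hx).
Qed.

Lemma modified_difference part : real_linear_part part ->
  eigenfunction (exterior D) (kappa ^ 2)
    (part_diff part vM wM) (part_diff part (d1 vM) (d1 wM)) (part_diff part (d2 vM) (d2 wM)).
Proof.
  assert (K : forall A B : C, (A - RtoC (kappa ^ 2) * B)%C = RtoC 0 ->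
    A = (RtoC (kappa ^ 2) * B)%C).
  { intros A B H. replace A with (A - RtoC (kappa ^ 2) * B + RtoC (kappa ^ 2) * B)%C by ring.
    rewrite H. ring. }
  intros Hp. apply part_diff_eigenfunction; [exact Hp
    |exact (bvp_regular_M _ _ _ _ _ _ _ hv)|exact (bvp_regular_M _ _ _ _ _ _ _ hw)| |];
    intros x Hx; apply K.
  - exact (bvp_modified_helmholtz _ _ _ _ _ _ _ hv x Hx).
  - exact (bvp_modified_helmholtz _ _ _ _ _ _ _ hw x Hx).
Qed.

Lemma part_diff_limit (part : C -> R) (v w : R2 -> C) (x : R2) (l m : C) :
  real_linear_part part -> boundary_value D v x l -> boundary_value D w x m ->
  exterior_limit (part_diff part v w) x (1 * part l + -1 * part m).
Proof. intros Hp Hv Hw. apply exterior_limit_lin; apply part_boundary_value; assumption. Qed.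

(** The coupling conditions say that the sum of the two differences vanishes
    on the boundary together with its normal derivative, hence with its whole
    gradient. *)
Lemma coupled_difference part : real_linear_part part ->
  opposite_cauchy_data
    (part_diff part vH wH) (part_diff part (d1 vH) (d1 wH)) (part_diff part (d2 vH) (d2 wH))
    (part_diff part vM wM) (part_diff part (d1 vM) (d1 wM)) (part_diff part (d2 vM) (d2 wM)).
Proof.
  intros Hpart.
  assert (Hdir : forall x, boundary D x -> exists l,
    exterior_limit (part_diff part vH wH) x l /\ exterior_limit (part_diff part vM wM) x (- l)).
  { intros x Hx.
    destruct (bvp_dirichlet _ _ _ _ _ _ _ hv x Hx) as (l & m & L & M & E).
    destruct (bvp_dirichlet _ _ _ _ _ _ _ hw x Hx) as (l' & m' & L' & M' & E').
    exists (1 * part l + (-1) * part l'). split.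
    - apply part_diff_limit; assumption.
    - rewrite <- E' in E. apply (f_equal part) in E. rewrite !part_plus in E by exact Hpart.
      replace (- (1 * part l + (-1) * part l')) with (1 * part m + (-1) * part m') by lra.
      apply part_diff_limit; assumption. }
  assert (Hgrad := has_grad_lin _ 1 1 _ _ _ _ _ _
    (eigenfunction_grad _ _ _ _ _ (helmholtz_difference part Hpart))
    (eigenfunction_grad _ _ _ _ _ (modified_difference part Hpart))).
  assert (Hzero : forall x, boundary D x ->
    exterior_limit (lin 1 1 (part_diff part vH wH) (part_diff part vM wM)) x 0).
  { intros x Hx. destruct (Hdir x Hx) as (l & L & M).
    assert (S := exterior_limit_lin 1 1 _ _ x _ _ L M).
    replace (1 * l + 1 * - l) with 0 in S by ring. exact S. }
  intros x Hx. destruct (Hdir x Hx) as (l & L & M).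
  destruct (bvp_neumann _ _ _ _ _ _ _ hv x Hx)
    as (A & B & (g1 & g2 & G1 & G2 & EA) & (h1 & h2 & H1 & H2 & EB) & E).
  destruct (bvp_neumann _ _ _ _ _ _ _ hw x Hx)
    as (A' & B' & (g1' & g2' & G1' & G2' & EA') & (h1' & h2' & H1' & H2' & EB') & E').
  assert (PG1 := part_diff_limit part _ _ x _ _ Hpart G1 G1').
  assert (PG2 := part_diff_limit part _ _ x _ _ Hpart G2 G2').
  assert (PH1 := part_diff_limit part _ _ x _ _ Hpart H1 H1').
  assert (PH2 := part_diff_limit part _ _ x _ _ Hpart H2 H2').
  rewrite <- E' in E. rewrite EA, EB, EA', EB' in E.
  apply (f_equal part) in E. rewrite !part_plus, !part_scal in E by exact Hpart.
  set (dg1 := 1 * part g1 + -1 * part g1') in *. set (dg2 := 1 * part g2 + -1 * part g2') in *.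
  set (dh1 := 1 * part h1 + -1 * part h1') in *. set (dh2 := 1 * part h2 + -1 * part h2') in *.
  destruct (proj1 (hGamma x) Hx) as [t Et]. subst x.
  destruct (gradient_vanishes_on_boundary _ _ _ Hgrad Hzero
    t (1 * dg1 + 1 * dh1) (1 * dg2 + 1 * dh2)
    (exterior_limit_lin 1 1 _ _ _ _ _ PG1 PH1) (exterior_limit_lin 1 1 _ _ _ _ _ PG2 PH2))
    as [Z1 Z2].
  { unfold dg1, dg2, dh1, dh2. lra. }
  exists l, dg1, dg2.
  replace (- dg1) with dh1 by lra. replace (- dg2) with dh2 by lra.
  split; [exact L|]. split; [exact PG1|]. split; [exact PG2|].
  split; [exact M|]. split; [exact PH1|exact PH2].
Qed.

Theorem coupled_bvp_unique x : 0 < kappa -> exterior D x -> vH x = wH x /\ vM x = wM x.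
Proof.
  intros hkappa Hx.
  assert (RH := radiates_minus _ _ _ _ _ _ _ _ _ _ _ _ _
    (radiation_parts _ _ (bvp_radiation_H _ _ _ _ _ _ _ hv))
    (radiation_parts _ _ (bvp_radiation_H _ _ _ _ _ _ _ hw))).
  assert (RM := radiates_minus _ _ _ _ _ _ _ _ _ _ _ _ _
    (radiation_parts _ _ (bvp_radiation_M _ _ _ _ _ _ _ hv))
    (radiation_parts _ _ (bvp_radiation_M _ _ _ _ _ _ _ hw))).
  destruct (opposite_cauchy_data_zero kappa hkappa
    _ _ _ _ _ _ _ _ _ _ _ _
    (helmholtz_difference Re Re_linear)
    (helmholtz_difference Im Im_linear)
    (modified_difference Re Re_linear)
    (modified_difference Im Im_linear)
    (coupled_difference Re Re_linear)
    (coupled_difference Im Im_linear)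
    RH RM x Hx) as (Za & Zb & Zp & Zq).
  unfold part_diff, lin in Za, Zb, Zp, Zq.
  split; apply injective_projections.
  - change (Re (vH x) = Re (wH x)). lra.
  - change (Im (vH x) = Im (wH x)). lra.
  - change (Re (vM x) = Re (wM x)). lra.
  - change (Im (vM x) = Im (wM x)). lra.
Qed.

End Difference.

End ExteriorProblem.

Theorem theorem2p2
  (D : R2 -> Prop) (gamma : R -> R2) (T : R) (nu : R2 -> R2)
  (kappa theta : R) (d : R2) (f1 f2 : R2 -> C)
  (hD : bounded_domain D)
  (hgamma : simple_closed_analytic_curve gamma T)
  (hGamma : parametrizes_boundary gamma D)
  (hnu : exterior_unit_normal D gamma nu)
  (hkappa : 0 < kappa)
  (htheta : 0 <= theta < 2 * PI)
  (hd : d = (cos theta, sin theta))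
  (hf1 : forall x, boundary D x -> f1 x = Copp (u_inc kappa d x))
  (hf2 : forall x, boundary D x ->
    f2 x = Copp (directional_derivative (u_inc kappa d) (nu x) x))
  (vH vM wH wM : R2 -> C)
  (hv : coupled_bvp D nu kappa f1 f2 vH vM)
  (hw : coupled_bvp D nu kappa f1 f2 wH wM) :
  forall x, exterior D x -> vH x = wH x /\ vM x = wM x.
Proof.
  intros x Hx.
  apply (coupled_bvp_unique D gamma T nu hD hgamma hGamma hnu kappa f1 f2); assumption.
Qed.
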